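(* Let $[a,b]$ be a compact interval such that the function $(c,\vec x)\mapsto\det(\mathcal H_{\Phi_c(\vec x)})$ from $[a,b]\times\mathcal S$ to $\mathbb R$ does not vanish, and let $\vec\varphi_{c,1},\dots,\vec\varphi_{c,s}$ denote the solutions $\vec\varphi$ of $\nabla_{\Phi_c(\vec\varphi)}=0$ that correspond to local minimums of $\Phi_c$. Then, for all $c=\frac mn$ in $[a,b]$, the asymptotics of the number of simple $(n,m)$-$(R,\vec r)$-graphs is $$SG_{R,\vec r}(n,m)\sim\frac{n^{2m}}{2^m m!}\sum_{\vec\varphi\in\{\vec\varphi_{c,1},\dots,\vec\varphi_{c,s}\}}\left(\frac{\vec r^{\;\vec\varphi}}{\vec\varphi^{\;\vec\varphi}}\right)^n(\vec\varphi^TR\vec\varphi)^m\,\frac{\exp\!\Big(-\frac{c}{\vec\varphi^TR\vec\varphi}\mathrm{Tr}(\mathrm{diag}(\vec\varphi)R)-\big(\frac{c}{\vec\varphi^TR\vec\varphi}\big)^2\mathrm{Tr}\big((\mathrm{diag}(\vec\varphi)R)^2\big)\Big)}{\sqrt{\det(\mathcal H_{\Phi_c(\vec\varphi)})\prod_{i=1}^q\varphi_i}} .$$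
   Context: Fix a positive integer $q$, an irreducible symmetric $q\times q$ matrix $R$ and a vector $\vec r=(r_1,\dots,r_q)^T$, both with non-negative coefficients. Vectors are column vectors; $\vec u^{\,\vec v}=\prod_i u_i^{v_i}$; $\log$ acts coordinate-wise; $\mathrm{diag}(\vec x)$ is the diagonal matrix with diagonal $\vec x$; $\mathrm{Tr}$ is the trace. Asymptotics are for $n\to\infty$ with $R,\vec r$ fixed. A simple $(R,\vec r)$-graph is a labelled graph on vertex set $\{1,\dots,n\}$ with neither loops nor multiple edges, in which each vertex $v$ is given a type $t(v)\in\{1,\dots,q\}$; its weight is $\omega(G)=\prod_{u}r_{t(u)}\prod_{\overline{vw}}R_{t(v),t(w)}$ (products over the vertices and the edges). The ''number'' of such graphs in a family is the sum of their weights; $SG_{R,\vec r}(n,m)$ is the number of simple $(n,m)$-$(R,\vec r)$-graphs, i.e. those with $n$ vertices and $m$ edges. Let $\mathcal S=\{\vec x\in\mathbb R_{\ge0}^q : x_1+\dots+x_q=1\}$ and, on $\mathcal S$ (with the convention $0\log 0=0$), $\Phi_c(\vec x)=\sum_i x_i(\log x_i-\log r_i)-c\log(\vec x^TR\vec x)$. Let $E$ denote a $q\times(q-1)$ matrix with left-kernel of dimension $1$ containing the all-ones row vector (for example, the matrix whose first $q-1$ rows form the identity matrix and whose last row is $(-1,\dots,-1)$). The gradient and Hessian (the coefficients in the Taylor expansion of $\vec\epsilon\mapsto\Phi_c(\vec x+E\vec\epsilon)$ near any point $\vec x$ of the interior of $\mathcal S$) are $$\nabla_{\Phi_c(\vec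 x)}=\Big(\log(\vec x)^T-\log(\vec r)^T-\tfrac{2c}{\vec x^TR\vec x}\vec x^TR\Big)E,$$ $$\mathcal H_{\Phi_c(\vec x)}=E^T\Big(\mathrm{diag}(\vec x)^{-1}+\tfrac{2c}{\vec x^TR\vec x}\big(\tfrac{2}{\vec x^TR\vec x}R\vec x\,\vec x^TR-R\big)\Big)E .$$
   Formalization: The vector r is assumed strictly positive (log r is undefined otherwise), and E is normalised so that its maximal minors are 1 or -1, as for the example matrix; for other E the determinant of the Hessian is rescaled and the printed formula is off by a constant factor. *)

(* Defs.v *)
From HB Require Import structures.
From mathcomp Require Import all_boot all_order all_algebra.
From mathcomp Require Import all_classical all_reals all_analysis.

Set Implicit Arguments.
Unset Strict Implicit.
Unset Printing Implicit Defensive.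

Import Order.TTheory GRing.Theory Num.Theory.
Import numFieldNormedType.Exports.

Local Open Scope classical_set_scope.
Local Open Scope ring_scope.

(* No simultaneous row/column permutation makes R block-triangular with a
   nontrivial block structure. *)
Definition irreducible_mx (K : realType) (q : nat) (R : 'M[K]_q) : Prop :=
  forall A : {set 'I_q}, (0 < #|A| < q)%N ->
  exists i j, [/\ i \in A, j \notin A & R i j != 0].

(* The vertex set {1, ..., n} is 'I_n, and an unordered edge {v, w} is encoded
   by the pair (v, w) with v < w; hence a set of such pairs has neither loops
   nor multiple edges. *)
Definition simple_edges (n : nat) (G : {set 'I_n * 'I_n}) : bool :=
  [forall e in G, (e.1 < e.2)%N].

(* The orientation chosen for the edges is irrelevant for symmetric R. *)
Definition graph_weight (K : realType) (q : nat) (R : 'M[K]_q) (r : 'cV[K]_q)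
    (n : nat) (G : {set 'I_n * 'I_n}) (t : {ffun 'I_n -> 'I_q}) : K :=
  (\prod_(u < n) r (t u) 0) * \prod_(e in G) R (t e.1) (t e.2).

Definition SG (K : realType) (q : nat) (R : 'M[K]_q) (r : 'cV[K]_q)
    (n m : nat) : K :=
  \sum_(G : {set 'I_n * 'I_n} | simple_edges G && (#|G| == m))
    \sum_(t : {ffun 'I_n -> 'I_q}) graph_weight R r G t.

Definition simplex (K : realType) (q : nat) : set 'cV[K]_q :=
  [set x | (forall i, 0 <= x i 0) /\ \sum_i x i 0 = 1].

Definition open_simplex (K : realType) (q : nat) : set 'cV[K]_q :=
  [set x | (forall i, 0 < x i 0) /\ \sum_i x i 0 = 1].

Definition qform (K : realType) (q : nat) (R : 'M[K]_q) (x : 'cV[K]_q) : K :=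
  (x^T *m R *m x) 0 0.

(* ln 0 = 0 in the library, which gives the convention 0 log 0 = 0. *)
Definition Phi (K : realType) (q : nat) (R : 'M[K]_q) (r : 'cV[K]_q)
    (c : K) (x : 'cV[K]_q) : K :=
  \sum_i x i 0 * (ln (x i 0) - ln (r i 0)) - c * ln (qform R x).

(* E has left kernel of dimension 1, containing the all-ones row.  Such an E is
   determined up to right multiplication by an invertible B, which multiplies
   det (E^T M E) by (det B)^2.  Asking that the maximal minors of E be 1 or -1
   (they all agree up to sign) fixes the scale; the matrix whose first q-1 rows
   form the identity and whose last row is (-1, ..., -1) is an instance. *)
Definition tangent_frame (K : realType) (q : nat) (E : 'M[K]_(q, q.-1)) : Prop :=
  [/\ \rank (kermx E) = 1%N,
      (const_mx 1 : 'rV[K]_q) *m E = 0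
    & forall i : 'I_q, `|\det (row' i E)| = 1].

Definition grad_Phi (K : realType) (q : nat) (E : 'M[K]_(q, q.-1))
    (R : 'M[K]_q) (r : 'cV[K]_q) (c : K) (x : 'cV[K]_q) : 'rV[K]_(q.-1) :=
  ((map_mx (@ln K) x)^T - (map_mx (@ln K) r)^T
     - (2 * c / qform R x) *: (x^T *m R)) *m E.

Definition hess_Phi (K : realType) (q : nat) (E : 'M[K]_(q, q.-1))
    (R : 'M[K]_q) (c : K) (x : 'cV[K]_q) : 'M[K]_(q.-1) :=
  E^T *m (invmx (diag_mx x^T)
          + (2 * c / qform R x) *:
              ((2 / qform R x) *: (R *m x *m x^T *m R) - R)) *m E.

Definition local_minima (K : realType) (q : nat) (E : 'M[K]_(q, q.-1))
    (R : 'M[K]_q) (r : 'cV[K]_q) (c : K) : set 'cV[K]_q :=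
  [set phi | [/\ open_simplex phi,
                 grad_Phi E R r c phi = 0
               & \forall x \near within (@simplex K q) (nbhs phi),
                   Phi R r c phi <= Phi R r c x]].

Definition SG_term (K : realType) (q : nat) (E : 'M[K]_(q, q.-1))
    (R : 'M[K]_q) (r : 'cV[K]_q) (n m : nat) (c : K) (phi : 'cV[K]_q) : K :=
  let D := diag_mx phi^T *m R in
  let k := c / qform R phi in
  ((\prod_i r i 0 `^ phi i 0) / (\prod_i phi i 0 `^ phi i 0)) ^+ n
  * qform R phi ^+ m
  * (expR (- k * \tr D - k ^+ 2 * \tr (D *m D))
     / Num.sqrt (\det (hess_Phi E R c phi) * \prod_i phi i 0)).

Definition SG_asymptotics (K : realType) (q : nat) (E : 'M[K]_(q, q.-1))
    (R : 'M[K]_q) (r : 'cV[K]_q) (n m : nat) : K :=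
  let c := m%:R / n%:R in
  n%:R ^+ (2 * m) / (2 ^+ m * m`!%:R)
  * \sum_(phi \in local_minima E R r c) SG_term E R r n m c phi.

(* The filter on pairs (n, m) expressing "n tends to infinity, uniformly over
   all m such that m / n lies in [a, b]". *)
Definition ratio_oo (K : realType) (a b : K) : filter_on (nat * nat) :=
  FilterType (within [set p : nat * nat | a <= p.2%:R / p.1%:R <= b]
                (filter_prod \oo (globally [set: nat])))
    (within_filter _ _).

(* Main.v *)
Require Import Defs.
From HB Require Import structures.
From mathcomp Require Import all_boot all_order all_algebra.
From mathcomp Require Import all_classical all_reals all_analysis.
From mathcomp Require Import measurable_realfun.
From mathcomp Require Import ring lra.

Set Implicit Arguments.
Unset Strict Implicit.
Unset Printing Implicit Defensive.

Import Order.TTheory GRing.Theory Num.Theory.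
Import numFieldNormedType.Exports.

Local Open Scope classical_set_scope.
Local Open Scope ring_scope.

(** The proof is the saddle point method, carried out with explicit two-sided
    bounds. Fix the types [t] of the vertices. The weights of the simple graphs
    with [m] edges then sum to the [m]-th elementary symmetric polynomial of the
    weights of the pairs of vertices ([SG_elsym]). Divided by its leading term
    [p1 ^ m / m!], where [p1] is the sum of the weights, this polynomial is the
    probability that [m] independent random pairs are distinct. Recursions of
    Newton type turn this into a birthday problem, and the answer is the
    exponential of [- m ^ 2 p2 / (2 p1 ^ 2)] up to a relative error of order
    [1 / n] ([edge_sum_asym]). Only the frequencies [x] of the types enter:
    forbidden loops and forbidden multiple edges produce the two traces of the
    exponential factor, and what remains is [n ^ (2 m) / (2 ^ m m!)] times
    [qform R x ^ m].

    Grouping the type assignments by their frequencies brings in multinomial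
    coefficients. By Stirling's formula, the total weight of the frequency
    vector [x] is [exp (- n Phi_c x)] up to a factor polynomial in [n], so the
    sum concentrates around the minimisers of [Phi_c] with [c = m / n].

    There is exactly one minimiser, and the determinant hypothesis is what
    forces this. For [c >= 0] the function [Phi_c] attains a local minimum at
    an interior point: the infinite slope of [x ln x] at [0] keeps minimisers
    away from the boundary ([min_interior]). The Hessian is positive
    semidefinite there, hence positive definite as its determinant does not
    vanish, and it stays positive definite along every segment, since it cannot
    change signature without becoming singular ([posdef_propagate]). So [Phi_c]
    is strictly convex, has one critical point [phi_c], and the sum in the
    statement has one term ([local_minima_convex]).

    Near [phi_c] the function is squeezed between two multiples, close to one
    another, of the quadratic form of its Hessian, and elsewhere it exceeds its
    minimum by a fixed amount ([Phi_local]). The sum over frequencies is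
    therefore a Gaussian sum over a lattice, of asymptotic value
    [(2 pi n) ^ (d / 2) / sqrt (det H)]; this is proved one coordinate at a
    time, splitting [H] by Schur complements ([lattice_gauss_le],
    [lattice_gauss_ge]). Multiplying by the contribution of the edges yields
    the asserted term up to a power of a constant, the one left undetermined in
    Stirling's formula ([graph_local]). The case of no edges, where the total
    weight is a power of the number of types, shows that this power is [1]
    ([graph_const]).

    All these estimates are uniform for [c] in a neighbourhood of any given
    point, so compactness of the interval makes them uniform on it
    ([graph_uniform]). Irreducibility excludes [R = 0] with several types; for
    [R = 0] and one type both sides are equal. *)

(** * Elementary symmetric polynomials and power sums *)

Definition elsym (K : realType) (T : finType) (w : T -> K) (m : nat) : K :=
  \sum_(G : {set T} | #|G| == m) \prod_(e in G) w e.

Definition elsymD1 (K : realType) (T : finType) (w : T -> K) (e : T) (m : nat)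
    : K :=
  \sum_(G : {set T} | (#|G| == m) && (e \notin G)) \prod_(f in G) w f.

Definition psum (K : realType) (T : finType) (w : T -> K) (j : nat) : K :=
  \sum_e w e ^+ j.

Lemma elsym0 (K : realType) (T : finType) (w : T -> K) : elsym w 0 = 1.
Proof.
rewrite /elsym (big_pred1 (finset.set0 : {set T})) ?big_set0// => G.
exact: cards_eq0.
Qed.

Lemma elsymD10 (K : realType) (T : finType) (w : T -> K) e : elsymD1 w e 0 = 1.
Proof.
rewrite /elsymD1 (big_pred1 (finset.set0 : {set T})) ?big_set0// => G /=.
by rewrite cards_eq0; case: eqP => //= ->; rewrite finset.in_set0.
Qed.

Lemma elsymS_with (K : realType) (T : finType) (w : T -> K) e m :
  \sum_(G : {set T} | (#|G| == m.+1) && (e \in G)) \prod_(f in G) w f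
    = w e * elsymD1 w e m.
Proof.
rewrite /elsymD1 big_distrr/=.
rewrite (reindex_onto (fun G : {set T} => e |: G) (fun G => G :\ e))/=; last first.
  by move=> G /andP[_ eG]; rewrite finset.setD1K.
apply: eq_big => [G|G /andP[/andP[_ _] /eqP eG]].
  rewrite finset.setU11 andbT; case: (boolP (e \in G)) => eG.
    rewrite andbF; apply/negbTE; rewrite negb_and; apply/orP; right.
    by apply/eqP => h; move: eG; rewrite -h finset.setD11.
  rewrite cardsU1 eG/= andbT add1n eqSS; case: eqP => //= _.
  by rewrite finset.setU1K// eqxx.
rewrite (bigD1 e) ?finset.setU11//=; congr (_ * _); apply: eq_bigl => f.
by rewrite -[in RHS]eG finset.in_setD1 andbC.
Qed.

Lemma elsymS_split (K : realType) (T : finType) (w : T -> K) e m :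
  elsym w m.+1 = elsymD1 w e m.+1 + w e * elsymD1 w e m.
Proof.
rewrite -elsymS_with /elsym (bigID (fun G : {set T} => e \in G))/= addrC.
by congr (_ + _).
Qed.

(** Both sides count sets of size [m + 1] with a marked element. *)
Lemma elsymS_sum (K : realType) (T : finType) (w : T -> K) m :
  m.+1%:R * elsym w m.+1 = \sum_e w e * elsymD1 w e m.
Proof.
under eq_bigr do rewrite -elsymS_with.
rewrite (exchange_big_dep (fun G : {set T} => #|G| == m.+1))/=; last first.
  by move=> e G _ /andP[].
rewrite /elsym big_distrr/=; apply: eq_bigr => G /eqP Gm.
rewrite [RHS](eq_bigl (fun e => e \in G)) => [|e]; last by rewrite Gm eqxx.
rewrite sumr_const mulr_natl; congr (_ *+ _); rewrite -Gm; exact: eq_card.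
Qed.

Lemma elsymD1_ge0 (K : realType) (T : finType) (w : T -> K) e m :
  (forall f, 0 <= w f) -> 0 <= elsymD1 w e m.
Proof. by move=> w0; apply: sumr_ge0 => G _; apply: prodr_ge0. Qed.

Lemma elsym_ge0 (K : realType) (T : finType) (w : T -> K) m :
  (forall f, 0 <= w f) -> 0 <= elsym w m.
Proof. by move=> w0; apply: sumr_ge0 => G _; apply: prodr_ge0. Qed.

Lemma psum_ge0 (K : realType) (T : finType) (w : T -> K) j :
  (forall f, 0 <= w f) -> 0 <= psum w j.
Proof. by move=> w0; apply: sumr_ge0 => e _; apply: exprn_ge0. Qed.

Lemma elsymD1_le (K : realType) (T : finType) (w : T -> K) e m :
  (forall f, 0 <= w f) -> elsymD1 w e m <= elsym w m.
Proof.
move=> w0; case: m => [|m]; first by rewrite elsym0 elsymD10.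
by rewrite (elsymS_split w e) lerDl mulr_ge0 ?elsymD1_ge0.
Qed.

Lemma elsymS_le (K : realType) (T : finType) (w : T -> K) m :
  (forall f, 0 <= w f) -> m.+1%:R * elsym w m.+1 <= psum w 1 * elsym w m.
Proof.
move=> w0; rewrite elsymS_sum /psum big_distrl/=; apply: ler_sum => e _.
by rewrite expr1 ler_wpM2l// elsymD1_le.
Qed.

(** In the marked count [elsymS_sum], the sum over sets avoiding the marked
    element is expanded by [elsymS_split], and the remainder has a sign. One more
    expansion gives [elsymSSS_le]. *)
Lemma elsymSS_ge (K : realType) (T : finType) (w : T -> K) m :
  (forall f, 0 <= w f) ->
  psum w 1 * elsym w m.+1 - psum w 2 * elsym w m <= m.+2%:R * elsym w m.+2.
Proof.
move=> w0; rewrite elsymS_sum /psum !big_distrl/= -sumrB; apply: ler_sum => e _.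
rewrite (elsymS_split w e) expr1 expr2 mulrDr mulrA -addrA gerDl subr_le0.
by rewrite ler_wpM2l ?mulr_ge0// elsymD1_le.
Qed.

Lemma elsymSSS_le (K : realType) (T : finType) (w : T -> K) m :
  (forall f, 0 <= w f) ->
  m.+3%:R * elsym w m.+3 <=
  psum w 1 * elsym w m.+2 - psum w 2 * elsym w m.+1 + psum w 3 * elsym w m.
Proof.
move=> w0; rewrite elsymS_sum /psum !big_distrl/= -sumrB -big_split/=.
apply: ler_sum => e _.
have := elsymD1_le e m w0; have := elsymS_split w e m.
have := elsymS_split w e m.+1 => -> ->.
move: (elsymD1 w e m) (elsymD1 w e m.+1) (elsymD1 w e m.+2) (w0 e) => u v x we ue.
have h := exprn_ge0 3 we; have := ler_wpM2l h ue; lra.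
Qed.

(** * The birthday problem *)

Lemma expR_le_1Bx (K : realType) (z : K) : 0 <= z <= 2^-1 ->
  expR (- z - 2 * z ^+ 2) <= 1 - z.
Proof.
move=> /andP[z0 z2]; rewrite -opprD expRN.
rewrite -[leRHS]invrK lef_pV2 ?posrE ?expR_gt0 ?invr_gt0//; last lra.
apply: le_trans (expR_ge1Dx _); rewrite -[leLHS]div1r ler_pdivrMr; last lra.
nra.
Qed.

(** Below, [a m] stands for [m! e_m / p1 ^ m], the probability that [m]
    independent elements drawn with the given weights are distinct, and [beta]
    for [p2 / p1 ^ 2], that of one collision. The bound says that [a] decreases
    slowly, which lets the recursions be read as one-step recursions. *)
Lemma birthday_ratio (K : realType) (a : nat -> K) (beta : K) (M : nat) :
  0 <= beta -> M%:R * beta <= 4^-1 -> a 0%N = 1 -> a 1%N = 1 ->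
  (forall m, 0 <= a m) ->
  (forall m, a m.+1 - m.+1%:R * beta * a m <= a m.+2) ->
  forall m, (m <= M)%N -> a m <= (1 + 4 * (m%:R * beta)) * a m.+1.
Proof.
move=> b0 Mb a0 a1 age arec.
have small m : (m <= M)%N -> m%:R * beta <= 4^-1.
  by move=> mM; apply: le_trans Mb; rewrite ler_wpM2r// ler_nat.
elim => [_|m IH mM]; first by rewrite a0 a1; lra.
have /IH {}IH := ltnW mM.
have := small _ mM; have := arec m; have := age m.+1; have := age m.
have bm : 0 <= m%:R * beta by rewrite mulr_ge0.
have zE : m.+1%:R * beta = m%:R * beta + beta by rewrite -natr1 mulrDl mul1r.
move: IH bm; rewrite zE.
move: (a m) (a m.+1) (a m.+2) (m%:R * beta) => u v w y.
move=> uv y0 u0 v0 wge yb.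
have uv2 : u <= 2 * v.
  have h : (1 - 4 * y) * v >= 0 by rewrite mulr_ge0//; lra.
  by lra.
set z := y + beta in yb wge *.
have z0 : 0 <= z by rewrite /z; lra.
have h1 : z * u <= z * (2 * v) by rewrite ler_wpM2l.
have h2 : (1 - 2 * z) * v <= w by lra.
have h3 := ler_wpM2l (_ : 0 <= 1 + 4 * z) h2.
apply: le_trans (h3 _); last lra.
have h4 : 0 <= z * (1 - 4 * z) * v by rewrite !mulr_ge0//; lra.
by lra.
Qed.

(** By [birthday_ratio] the recursion reads
    [(1 - y - 4 y ^ 2) a (m + 1) <= a (m + 2)] with [y = (m + 1) beta]; summing
    the logarithms of the factors gives the exponent. *)
Lemma birthday_ge (K : realType) (a : nat -> K) (beta : K) (M : nat) :
  0 <= beta -> M%:R * beta <= 4^-1 -> a 0%N = 1 -> a 1%N = 1 ->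
  (forall m, 0 <= a m) ->
  (forall m, a m.+1 - m.+1%:R * beta * a m <= a m.+2) ->
  expR (- (M%:R ^+ 2 * beta / 2) - 12 * (M%:R ^+ 3 * beta ^+ 2)) <= a M.
Proof.
move=> b0 Mb a0 a1 age arec.
have ratio := birthday_ratio b0 Mb a0 a1 age arec.
suff H : forall m, (m <= M)%N ->
    expR (- (m%:R ^+ 2 * beta / 2) - 12 * (m%:R ^+ 3 * beta ^+ 2)) <= a m.
  exact: H.
have aux m : expR (- (m%:R ^+ 2 * beta / 2) - 12 * (m%:R ^+ 3 * beta ^+ 2)) <= 1 :> K.
  by rewrite -expR0 ler_expR -opprD oppr_le0 addr_ge0 ?mulr_ge0 ?exprn_ge0.
elim => [_|[|m] IH mM]; first by rewrite a0 aux.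
  by rewrite a1 aux.
have {IH} := IH (ltnW mM).
have yb : m.+2%:R * beta <= 4^-1.
  by apply: le_trans Mb; rewrite ler_wpM2r// ler_nat.
have r := ratio m (ltnW (ltnW mM)).
have ar := arec m; have a1ge := age m.+1.
have m0 : 0 <= m%:R :> K by [].
move: r ar a1ge m0 yb; rewrite -[m.+2%:R]natr1 -[m.+1%:R]natr1.
move: (a m) (a m.+1) (a m.+2) (m%:R) => u v w x uv wge v0 x0 yb IH.
set y := (x + 1) * beta.
have xb : 0 <= x * beta by rewrite mulr_ge0.
have y0 : 0 <= y by rewrite /y mulr_ge0// addr_ge0.
have y4 : y <= 4^-1 by rewrite /y; lra.
pose z := y + 4 * y ^+ 2.
have zb : 0 <= z <= 2^-1 by rewrite /z; nra.
have zy : z + 2 * z ^+ 2 <= y + 12 * y ^+ 2.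
  have : z <= 2 * y by rewrite /z; nra.
  by rewrite /z => h; nra.
have yu : y * u <= y * ((1 + 4 * y) * v).
  rewrite ler_wpM2l//; apply: (le_trans uv); rewrite ler_wpM2r//.
  by rewrite /y; lra.
have h2 : (1 - z) * v <= w by rewrite /z; rewrite -/y in wge; lra.
apply: le_trans h2.
have h3 : expR (- y - 12 * y ^+ 2) <= 1 - z.
  by apply: le_trans (expR_le_1Bx zb); rewrite ler_expR; lra.
have h4 : expR (- y - 12 * y ^+ 2) * v <= (1 - z) * v by rewrite ler_wpM2r.
apply: le_trans h4; have h5 := ler_wpM2l (expR_ge0 (- y - 12 * y ^+ 2)) IH.
apply: le_trans h5; rewrite -expRD ler_expR /y.
have b2 := sqr_ge0 beta; have xb2 : 0 <= x * beta ^+ 2 by rewrite mulr_ge0.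
have xxb2 : 0 <= x ^+ 2 * beta ^+ 2 by rewrite mulr_ge0 ?sqr_ge0.
by nra.
Qed.

(** The third-order recursion corrects [birthday_ge]: triple coincidences, of
    probability [gamma], are added back as in inclusion and exclusion. *)
Lemma birthday_le (K : realType) (a : nat -> K) (beta gamma : K) (M : nat) :
  0 <= beta -> 0 <= gamma ->
  M%:R * beta <= 4^-1 -> a 0%N = 1 -> a 1%N = 1 ->
  (forall m, 0 <= a m) -> (forall m, a m.+1 <= a m) ->
  (forall m, a m.+1 - m.+1%:R * beta * a m <= a m.+2) ->
  (forall m, a m.+3 <= a m.+2 - m.+2%:R * beta * a m.+1
                       + m.+2%:R * m.+1%:R * gamma * a m) ->
  a M <= expR (- (M%:R ^+ 2 * beta / 2) + M%:R * beta + 4 * (M%:R ^+ 3 * gamma)).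
Proof.
move=> b0 g0 Mb a0 a1 age adec arec arec3.
have ratio := birthday_ratio b0 Mb a0 a1 age arec.
suff H : forall m, (m <= M)%N ->
    a m <= expR (- (m%:R ^+ 2 * beta / 2) + m%:R * beta + 4 * (m%:R ^+ 3 * gamma)).
  exact: H.
have ale1 m : a m <= 1 by elim: m => [|m IH]; rewrite ?a0// (le_trans (adec m)).
have ratio2 m : (m <= M)%N -> a m <= 2 * a m.+1.
  move=> mM; apply: (le_trans (ratio m mM)); rewrite ler_wpM2r//.
  have : m%:R * beta <= 4^-1.
    by apply: le_trans Mb; rewrite ler_wpM2r// ler_nat.
  by lra.
have e1 x : 0 <= x -> 1 <= expR x :> K.
  by move=> ?; rewrite -[leLHS]expR0 ler_expR.
elim => [_|[|[|m]] IH mM].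
- by apply: le_trans (ale1 _) (e1 _ _); lra.
- by apply: le_trans (ale1 _) (e1 _ _); lra.
- by apply: le_trans (ale1 _) (e1 _ _); lra.
have {IH} := IH (ltnW mM).
have r1 := ratio2 m.+1 (ltnW (ltnW mM)).
have r0 := ratio2 m (ltnW (ltnW (ltnW mM))).
have ar := arec3 m; have d := adec m.+1.
have m0 : 0 <= m%:R :> K by [].
move: r0 r1 ar d (age m.+2) m0; rewrite -[m.+3%:R]natr1 -[m.+2%:R]natr1 -[m.+1%:R]natr1.
move: (a m) (a m.+1) (a m.+2) (a m.+3) (m%:R) => t u v w x tu uv wle vu v0 x0 IH.
have h1 : (x + 1 + 1) * beta * v <= (x + 1 + 1) * beta * u.
  by rewrite ler_wpM2l// mulr_ge0//; lra.
have h2 : (x + 1 + 1) * (x + 1) * gamma * t <= (x + 1 + 1) * (x + 1) * gamma * (4 * v).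
  by rewrite ler_wpM2l// ?mulr_ge0//; lra.
pose E := - ((x + 1 + 1) * beta) + 4 * ((x + 1 + 1) * (x + 1) * gamma).
have h3 : w <= (1 + E) * v by rewrite /E; lra.
have h4 : (1 + E) * v <= expR E * v by rewrite ler_wpM2r// expR_ge1Dx.
apply: (le_trans h3); apply: (le_trans h4).
apply: (le_trans (ler_wpM2l (expR_ge0 E) IH)).
rewrite -expRD ler_expR /E.
have xg : 0 <= x * gamma by rewrite mulr_ge0.
have xxg : 0 <= x ^+ 2 * gamma by rewrite mulr_ge0 ?sqr_ge0.
by nra.
Qed.

(** * Graphs with prescribed types *)

Lemma elsym_le (K : realType) (T : finType) (w : T -> K) m :
  (forall f, 0 <= w f) -> elsym w m <= psum w 1 ^+ m / m`!%:R.
Proof.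
move=> w0; have p0 := psum_ge0 1 w0.
elim: m => [|m IH]; first by rewrite elsym0 expr0 fact0 divr1.
have h := le_trans (elsymS_le m w0) (ler_wpM2l p0 IH).
have -> : psum w 1 ^+ m.+1 / m.+1`!%:R
    = m.+1%:R^-1 * (psum w 1 * (psum w 1 ^+ m / m`!%:R)).
  by rewrite factS natrM exprS; field; rewrite nat1r !pnatr_eq0 -lt0n fact_gt0.
by rewrite ler_pdivlMl ?ltr0n.
Qed.

(** The normalised sequence [m! e_m / p1 ^ m] satisfies the recursions of the
    birthday problem. *)
Lemma elsym_bounds (K : realType) (T : finType) (w : T -> K) m :
  (forall f, 0 <= w f) -> 0 < psum w 1 ->
  let beta := psum w 2 / psum w 1 ^+ 2 in
  let gamma := psum w 3 / psum w 1 ^+ 3 in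
  m%:R * beta <= 4^-1 ->
  psum w 1 ^+ m / m`!%:R
    * expR (- (m%:R ^+ 2 * beta / 2) - 12 * (m%:R ^+ 3 * beta ^+ 2)) <= elsym w m
  /\ elsym w m <= psum w 1 ^+ m / m`!%:R
    * expR (- (m%:R ^+ 2 * beta / 2) + m%:R * beta + 4 * (m%:R ^+ 3 * gamma)).
Proof.
move=> w0 p1 beta gamma mb.
have pn0 : psum w 1 != 0 by rewrite gt_eqF.
pose a k := k`!%:R * elsym w k / psum w 1 ^+ k.
have b0 : 0 <= beta by rewrite divr_ge0 ?exprn_ge0 ?psum_ge0.
have g0 : 0 <= gamma by rewrite divr_ge0 ?exprn_ge0 ?psum_ge0.
have a0 : a 0%N = 1 by rewrite /a elsym0 fact0 expr0 mulr1 divr1.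
have a1 : a 1%N = 1.
  rewrite /a factS fact0 muln1 elsymS_sum expr1.
  under eq_bigr do rewrite elsymD10 mulr1.
  by rewrite -(@eq_bigr _ _ _ _ _ _ (fun e => w e ^+ 1)) ?divff// => i _; rewrite expr1.
have age k : 0 <= a k by rewrite /a !mulr_ge0 ?invr_ge0 ?exprn_ge0 ?elsym_ge0 ?psum_ge0.
have adec k : a k.+1 <= a k.
  have := elsymS_le k w0; rewrite -(ler_pM2l (_ : 0 < k`!%:R / psum w 1 ^+ k.+1)); last first.
    by rewrite divr_gt0 ?exprn_gt0// ltr0n fact_gt0.
  rewrite /a factS natrM exprS => h.
  by apply: le_trans (le_trans h _); rewrite le_eqVlt; apply/orP; left; apply/eqP;
    field; rewrite expf_neq0// pn0.
have arec k : a k.+1 - k.+1%:R * beta * a k <= a k.+2.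
  have := elsymSS_ge k w0; rewrite -(ler_pM2l (_ : 0 < k.+1`!%:R / psum w 1 ^+ k.+2)); last first.
    by rewrite divr_gt0 ?exprn_gt0// ltr0n fact_gt0.
  rewrite /a !factS !natrM !exprS /beta => h.
  by apply: le_trans (le_trans h _); rewrite le_eqVlt; apply/orP; left; apply/eqP;
    field; rewrite expf_neq0// pn0.
have arec3 k : a k.+3 <= a k.+2 - k.+2%:R * beta * a k.+1
                       + k.+2%:R * k.+1%:R * gamma * a k.
  have := elsymSSS_le k w0; rewrite -(ler_pM2l (_ : 0 < k.+2`!%:R / psum w 1 ^+ k.+3)); last first.
    by rewrite divr_gt0 ?exprn_gt0// ltr0n fact_gt0.
  rewrite /a !factS !natrM !exprS /beta /gamma => h.
  by apply: le_trans (le_trans h _); rewrite le_eqVlt; apply/orP; left; apply/eqP;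
    field; rewrite expf_neq0// pn0.
have aE : elsym w m = psum w 1 ^+ m / m`!%:R * a m.
  by rewrite /a; field; rewrite expf_neq0// pnatr_eq0 -lt0n fact_gt0.
have c0 : 0 <= psum w 1 ^+ m / m`!%:R.
  by rewrite divr_ge0 ?exprn_ge0// ltW.
rewrite aE; split; rewrite ler_wpM2l//.
  exact: birthday_ge.
exact: birthday_le.
Qed.

(** An unordered pair of vertices is represented by its increasing orientation;
    giving weight zero to the other pairs makes the weighted count of simple
    graphs an elementary symmetric polynomial over all pairs. *)
Definition edge_wt (K : realType) (q : nat) (R : 'M[K]_q) (n : nat)
    (t : {ffun 'I_n -> 'I_q}) (e : 'I_n * 'I_n) : K :=
  if (e.1 < e.2)%N then R (t e.1) (t e.2) else 0.

Lemma SG_elsym (K : realType) (q : nat) (R : 'M[K]_q) (r : 'cV[K]_q) n m :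
  SG R r n m =
  \sum_(t : {ffun 'I_n -> 'I_q}) (\prod_u r (t u) 0) * elsym (edge_wt R t) m.
Proof.
rewrite /SG exchange_big/=; apply: eq_bigr => t _; rewrite /graph_weight.
rewrite -big_distrr/=; congr (_ * _).
rewrite /elsym [RHS](bigID (fun G => simple_edges G))/= [X in _ = _ + X]big1 ?addr0.
  apply: eq_big => [G|G /andP[/forall_inP sG _]]; first by rewrite andbC.
  by apply: eq_bigr => e eG; rewrite /edge_wt sG.
move=> G /andP[_]; rewrite negb_forall_in => /exists_inP[e eG ne].
by rewrite (bigD1 e)//= /edge_wt (negbTE ne) mul0r.
Qed.

Definition cnt (q n : nat) (t : {ffun 'I_n -> 'I_q}) (i : 'I_q) : nat :=
  #|[pred u | t u == i]|.

Definition freq (K : realType) (q n : nat) (t : {ffun 'I_n -> 'I_q}) : 'cV[K]_q :=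
  \col_i ((cnt t i)%:R / n%:R).

Lemma sum_cnt (K : realType) (q n : nat) (t : {ffun 'I_n -> 'I_q}) (F : 'I_q -> K) :
  \sum_u F (t u) = \sum_i (cnt t i)%:R * F i.
Proof.
rewrite (partition_big t xpredT)//=; apply: eq_bigr => i _.
rewrite (eq_bigr (fun=> F i)) => [|u /eqP->//].
by rewrite sumr_const mulr_natl.
Qed.

Lemma prod_cnt (K : realType) (q n : nat) (t : {ffun 'I_n -> 'I_q}) (F : 'I_q -> K) :
  \prod_u F (t u) = \prod_i F i ^+ cnt t i.
Proof.
rewrite (partition_big t xpredT)//=; apply: eq_bigr => i _.
rewrite (eq_bigr (fun=> F i)) => [|u /eqP->//].
by rewrite prodr_const.
Qed.

Lemma sum_cnt_nat (q n : nat) (t : {ffun 'I_n -> 'I_q}) : (\sum_i cnt t i = n)%N.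
Proof.
rewrite -[RHS]card_ord -[in RHS]sum1_card (partition_big t xpredT)//=.
apply: eq_bigr => i _; by rewrite sum1_card.
Qed.

Lemma sum_lt_pairs (K : realType) n (S : 'I_n -> 'I_n -> K) :
  (forall u v, S u v = S v u) ->
  2 * \sum_(e : 'I_n * 'I_n | (e.1 < e.2)%N) S e.1 e.2 =
  \sum_u \sum_v S u v - \sum_u S u u.
Proof.
move=> Ssym; rewrite [X in _ = X - _]pair_big/=.
rewrite [X in _ = X - _](bigID (fun e : 'I_n * 'I_n => (e.1 < e.2)%N))/=.
rewrite [X in _ = _ + X - _](bigID (fun e : 'I_n * 'I_n => (e.1 == e.2)))/=.
have -> : \sum_(i : 'I_n * 'I_n | ~~ (i.1 < i.2)%N && (i.1 == i.2)) S i.1 i.2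
    = \sum_u S u u.
  rewrite (reindex_onto (fun u : 'I_n => (u, u)) (fun e => e.1))/=; last first.
    by move=> [u v] /= /andP[_ /eqP->].
  by apply: eq_bigl => u; rewrite ltnn !eqxx.
have -> : \sum_(i : 'I_n * 'I_n | ~~ (i.1 < i.2)%N && (i.1 != i.2)) S i.1 i.2
    = \sum_(e : 'I_n * 'I_n | (e.1 < e.2)%N) S e.1 e.2.
  rewrite (reindex_onto (fun e : 'I_n * 'I_n => (e.2, e.1)) (fun e => (e.2, e.1)))/=; last first.
    by case.
  apply: eq_big => [[u v]|[u v] _] //=; rewrite ?eqxx ?andbT -?leqNgt//.
  by rewrite ltn_neqAle andbC eq_sym; congr (_ && _).
by ring.
Qed.

Lemma psum_edge_wt (K : realType) (q : nat) (R : 'M[K]_q) n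
    (t : {ffun 'I_n -> 'I_q}) j :
  R^T = R -> (0 < j)%N ->
  2 * psum (edge_wt R t) j =
  \sum_i \sum_k (cnt t i)%:R * (cnt t k)%:R * R i k ^+ j
  - \sum_i (cnt t i)%:R * R i i ^+ j.
Proof.
move=> Rs j0; have Rsym i k : R i k = R k i by rewrite -[in LHS]Rs mxE.
rewrite -(sum_cnt t (fun i => R i i ^+ j)).
transitivity (2 * \sum_(e : 'I_n * 'I_n | (e.1 < e.2)%N) R (t e.1) (t e.2) ^+ j).
  congr (_ * _); rewrite /psum [LHS](bigID (fun e : 'I_n * 'I_n => (e.1 < e.2)%N))/=.
  rewrite [X in _ + X]big1 ?addr0 => [|e /negbTE ne].
    by apply: eq_bigr => e e12; rewrite /edge_wt e12.
  by rewrite /edge_wt ne expr0n -[j]prednK.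
rewrite (@sum_lt_pairs _ _ (fun u v => R (t u) (t v) ^+ j)) => [|u v]; last first.
  by rewrite Rsym.
congr (_ - _).
rewrite (sum_cnt t (fun i => \sum_v R i (t v) ^+ j)).
apply: eq_bigr => i _; rewrite (sum_cnt t (fun k => R i k ^+ j)) big_distrr/=.
by apply: eq_bigr => k _; rewrite mulrA.
Qed.

(** * Power sums of the edge weights in terms of type frequencies *)

Lemma qformE (K : realType) (q : nat) (R : 'M[K]_q) (x : 'cV[K]_q) :
  qform R x = \sum_i \sum_j x i 0 * x j 0 * R i j.
Proof.
rewrite /qform mxE exchange_big/=; apply: eq_bigr => j _.
rewrite mxE big_distrl/=; apply: eq_bigr => i _.
by rewrite mxE mulrAC.
Qed.

Lemma tr_diagM (K : realType) (q : nat) (R : 'M[K]_q) (x : 'cV[K]_q) :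
  \tr (diag_mx x^T *m R) = \sum_i x i 0 * R i i.
Proof.
by rewrite /mxtrace; apply: eq_bigr => i _; rewrite mul_diag_mx !mxE.
Qed.

Lemma tr_diagM2 (K : realType) (q : nat) (R : 'M[K]_q) (x : 'cV[K]_q) :
  R^T = R ->
  \tr ((diag_mx x^T *m R) *m (diag_mx x^T *m R)) =
  \sum_i \sum_j x i 0 * x j 0 * R i j ^+ 2.
Proof.
move=> Rs; have Rsym i k : R i k = R k i by rewrite -[in LHS]Rs mxE.
rewrite /mxtrace; apply: eq_bigr => i _; rewrite mxE; apply: eq_bigr => j _.
rewrite !mul_diag_mx !mxE (Rsym j i); ring.
Qed.

(** The exponential factor of the formula: its two traces account for loops
    and for multiple edges. *)
Definition edge_corr (K : realType) (q : nat) (R : 'M[K]_q) (c : K)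
    (x : 'cV[K]_q) : K :=
  let D := diag_mx x^T *m R in
  let k := c / qform R x in
  expR (- k * \tr D - k ^+ 2 * \tr (D *m D)).

Lemma freq_ge0 (K : realType) (q n : nat) (t : {ffun 'I_n -> 'I_q}) i :
  0 <= freq K t i 0.
Proof. by rewrite mxE divr_ge0. Qed.

Lemma sum_freq (K : realType) (q n : nat) (t : {ffun 'I_n -> 'I_q}) :
  (0 < n)%N -> \sum_i freq K t i 0 = 1.
Proof.
move=> n0; under eq_bigr do rewrite mxE.
by rewrite -big_distrl/= -natr_sum sum_cnt_nat divff// pnatr_eq0 -lt0n.
Qed.

Lemma psum_freq (K : realType) (q : nat) (R : 'M[K]_q) n
    (t : {ffun 'I_n -> 'I_q}) j : (0 < n)%N ->
  R^T = R -> (0 < j)%N ->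
  psum (edge_wt R t) j = n%:R ^+ 2 / 2 *
    (\sum_i \sum_k freq K t i 0 * freq K t k 0 * R i k ^+ j
     - n%:R^-1 * \sum_i freq K t i 0 * R i i ^+ j).
Proof.
move=> n0 Rs j0; have := psum_edge_wt t Rs j0.
have nn : n%:R != 0 :> K by rewrite pnatr_eq0 -lt0n.
have cf i : (cnt t i)%:R = n%:R * freq K t i 0 by rewrite mxE mulrC mulfVK.
under eq_bigr => i _ do under eq_bigr => k _ do rewrite !cf.
under [X in _ - X]eq_bigr => i _ do rewrite cf.
have -> : \sum_i (\sum_i0 n%:R * freq K t i 0 * (n%:R * freq K t i0 0) * R i i0 ^+ j)
   = n%:R ^+ 2 * \sum_i \sum_k freq K t i 0 * freq K t k 0 * R i k ^+ j.
  rewrite big_distrr; apply: eq_bigr => i _; rewrite big_distrr; apply: eq_bigr => k _.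
  by rewrite /=; ring.
have -> : \sum_i n%:R * freq K t i 0 * R i i ^+ j = n%:R * \sum_i freq K t i 0 * R i i ^+ j.
  by rewrite big_distrr; apply: eq_bigr => i _ /=; rewrite mulrA.
move: (psum _ _) (\sum_i _) (\sum_i _) => p Y X h.
have -> : p = (n%:R ^+ 2 * X - n%:R * Y) / 2 by rewrite -h; field.
by field.
Qed.

Lemma quad_avg_le (K : realType) (q : nat) (x : 'cV[K]_q) (F : 'I_q -> 'I_q -> K) W :
  (forall i, 0 <= x i 0) -> \sum_i x i 0 = 1 -> (forall i j, F i j <= W) ->
  \sum_i \sum_j x i 0 * x j 0 * F i j <= W.
Proof.
move=> x0 x1 FW; apply: (@le_trans _ _ (\sum_i \sum_j x i 0 * x j 0 * W)).
  by apply: ler_sum => i _; apply: ler_sum => j _; rewrite ler_wpM2l// mulr_ge0.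
under eq_bigr do rewrite -big_distrl -big_distrr/= x1 mulr1.
by rewrite -big_distrl/= x1 mul1r.
Qed.

Lemma lin_avg_le (K : realType) (q : nat) (x : 'cV[K]_q) (F : 'I_q -> K) W :
  (forall i, 0 <= x i 0) -> \sum_i x i 0 = 1 -> (forall i, F i <= W) ->
  \sum_i x i 0 * F i <= W.
Proof.
move=> x0 x1 FW; apply: (@le_trans _ _ (\sum_i x i 0 * W)).
  by apply: ler_sum => i _; rewrite ler_wpM2l.
by rewrite -big_distrl/= x1 mul1r.
Qed.

Lemma mx_le_bound (K : realType) (q : nat) (R : 'M[K]_q) :
  (forall i j, 0 <= R i j) -> exists2 W, 1 <= W & forall i j, R i j <= W.
Proof.
move=> R0; exists (1 + \sum_i \sum_j R i j) => [|i j].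
  by rewrite lerDl; apply: sumr_ge0 => i _; apply: sumr_ge0.
rewrite (bigD1 i)//= (bigD1 j)//= addrA addrCA -!addrA lerDl.
rewrite addr_ge0//; rewrite addr_ge0//; first exact: sumr_ge0.
by apply: sumr_ge0 => k _; apply: sumr_ge0.
Qed.

(** Removing the diagonal pairs is a correction with a factor [u = 1 / n]; it
    shifts the collision probability by [O (u)]. *)
Lemma collision_shift (K : realType) (Q T1 T2 T2' u W delta : K) :
  0 < delta -> delta <= Q -> 1 <= W -> 0 <= T1 <= W -> 0 <= T2 <= W ^+ 2 ->
  0 <= T2' <= W ^+ 2 -> 0 <= u -> u * W <= delta / 2 -> 0 <= T2 - u * T2' ->
  let S := (T2 - u * T2') / (Q - u * T1) ^+ 2 in
  [/\ 0 <= S, S <= 4 * (W / delta) ^+ 2,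
      T2 / Q ^+ 2 - u * (W / delta) ^+ 2 <= S
    & S <= T2 / Q ^+ 2 + u * (8 * (W / delta) ^+ 3)].
Proof.
move=> d0 dQ W1 /andP[T10 T1W] /andP[T20 T2W] /andP[T20' T2W'] u0 uW p0 S.
have Q0 : 0 < Q by lra.
have uT1 : u * T1 <= u * W by rewrite ler_wpM2l.
have uT10 : 0 <= u * T1 by rewrite mulr_ge0.
have Qh : Q / 2 <= Q - u * T1 by lra.
have Qp : 0 < Q - u * T1 by lra.
have iQ : Q^-1 <= delta^-1 by rewrite lef_pV2.
have iQ0 : 0 <= Q^-1 by rewrite invr_ge0 ltW.
have id0 : 0 <= delta^-1 by rewrite invr_ge0 ltW.
have iQ2 : Q^-1 ^+ 2 <= delta^-1 ^+ 2 by rewrite lerXn2r ?nnegrE.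
have iQ3 : Q^-1 ^+ 3 <= delta^-1 ^+ 3 by rewrite lerXn2r ?nnegrE.
have S0 : 0 <= S by rewrite divr_ge0// exprn_ge0// ltW.
have uT2' : 0 <= u * T2' by rewrite mulr_ge0.
have iQp1 : (Q - u * T1)^-1 <= 2 * Q^-1.
  have -> : 2 * Q^-1 = (Q / 2)^-1 by field; rewrite gt_eqF.
  by rewrite lef_pV2 ?posrE//; lra.
have iQp2 : 0 <= (Q - u * T1)^-1 by rewrite invr_ge0 ltW.
have iQp : (Q - u * T1)^-1 ^+ 2 <= (2 * Q^-1) ^+ 2.
  by rewrite lerXn2r ?nnegrE// mulr_ge0.
have iQp0 : 0 <= (Q - u * T1)^-1 ^+ 2 by rewrite sqr_ge0.
have SE : S = (T2 - u * T2') * (Q - u * T1)^-1 ^+ 2 by rewrite /S exprVn.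
split => //.
- rewrite SE exprMn.
  have h1 : (T2 - u * T2') * (Q - u * T1)^-1 ^+ 2 <= T2 * (2 * Q^-1) ^+ 2.
    by rewrite ler_pM//; lra.
  apply: (le_trans h1); rewrite exprMn.
  have : T2 * Q^-1 ^+ 2 <= W ^+ 2 * delta^-1 ^+ 2 by rewrite ler_pM// sqr_ge0.
  by lra.
- have h1 : (T2 - u * T2') * Q^-1 ^+ 2 <= S.
    have h : Q^-1 <= (Q - u * T1)^-1 by rewrite lef_pV2 ?posrE//; lra.
    by rewrite SE ler_wpM2l// lerXn2r ?nnegrE.
  have h2 : u * (T2' * Q^-1 ^+ 2) <= u * (W ^+ 2 * delta^-1 ^+ 2).
    by rewrite ler_wpM2l// ler_pM// sqr_ge0.
  by rewrite -exprVn exprMn; lra.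
- have h1 : S <= T2 * (Q - u * T1)^-1 ^+ 2.
    by rewrite SE ler_wpM2r//; lra.
  have -> : T2 / Q ^+ 2 = T2 * (Q - u * T1)^-1 ^+ 2
      - (T2 * (u * (T1 * (2 * Q - u * T1)))) * Q^-1 ^+ 2 * (Q - u * T1)^-1 ^+ 2.
    by field; rewrite !gt_eqF.
  have h2 : T2 * (u * (T1 * (2 * Q - u * T1))) * Q^-1 ^+ 2 * (Q - u * T1)^-1 ^+ 2
      <= T2 * (u * (T1 * (2 * Q))) * Q^-1 ^+ 2 * (2 * Q^-1) ^+ 2.
    have hA : T2 * (u * (T1 * (2 * Q - u * T1))) <= T2 * (u * (T1 * (2 * Q))).
      by rewrite ler_wpM2l// ler_wpM2l// ler_wpM2l//; lra.
    have hA0 : 0 <= T2 * (u * (T1 * (2 * Q - u * T1))).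
      by rewrite !mulr_ge0//; lra.
    have hB := ler_wpM2r (sqr_ge0 Q^-1) hA.
    have hB0 := mulr_ge0 hA0 (sqr_ge0 Q^-1).
    exact: ler_pM hB0 iQp0 hB iQp.
  have h3 : T2 * (u * (T1 * (2 * Q))) * Q^-1 ^+ 2 * (2 * Q^-1) ^+ 2
     = 8 * (u * (T2 * (T1 * Q^-1 ^+ 3))) by field; rewrite gt_eqF.
  have h4 : u * (T2 * (T1 * Q^-1 ^+ 3)) <= u * (W ^+ 2 * (W * delta^-1 ^+ 3)).
    have iQ30 : 0 <= Q^-1 ^+ 3 by rewrite exprn_ge0.
    rewrite ler_wpM2l//; apply: (ler_pM T20 (mulr_ge0 T10 iQ30) T2W).
    exact: ler_pM.
  rewrite exprMn; lra.
Qed.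

Lemma pow_shift (K : realType) (u z : K) (m : nat) :
  0 <= u -> 0 <= z -> u * z <= 2^-1 ->
  expR (- (m%:R * u * z) - 2 * (m%:R * u * u * z ^+ 2)) <= (1 - u * z) ^+ m
  /\ (1 - u * z) ^+ m <= expR (- (m%:R * u * z)).
Proof.
move=> u0 z0 uz; have uz0 : 0 <= u * z by rewrite mulr_ge0.
split.
  have -> : - (m%:R * u * z) - 2 * (m%:R * u * u * z ^+ 2)
     = m%:R * (- (u * z) - 2 * (u * z) ^+ 2) by ring.
  rewrite expRM_natl lerXn2r ?nnegrE ?expR_ge0//; first lra.
  by apply: expR_le_1Bx; rewrite uz0.
have -> : - (m%:R * u * z) = m%:R * (- (u * z)) by ring.
by rewrite expRM_natl lerXn2r ?nnegrE ?expR_ge0 ?expR_ge1Dx//; lra.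
Qed.

Definition edge_scale (K : realType) (n m : nat) : K :=
  n%:R ^+ (2 * m) / (2 ^+ m * m`!%:R).

(** The sum [p1] equals [n ^ 2 qform x / 2] times [1 - u z], where [u = 1 / n]
    and [u z] is the proportion of loops. Raised to the power [m = c n], this
    factor tends to the exponential of the first trace, and
    [- m ^ 2 p2 / (2 p1 ^ 2)] tends to the second one. All errors are [O (1 / n)],
    uniformly as long as [qform x] stays away from [0]. *)
Lemma edge_sum_asym (K : realType) (q : nat) (R : 'M[K]_q) (delta b : K) :
  R^T = R -> (forall i j, 0 <= R i j) -> 0 < delta -> 0 <= b ->
  exists2 C, 0 <= C & exists N : nat, forall n m (t : {ffun 'I_n -> 'I_q}),
    (N <= n)%N -> (0 < n)%N -> m%:R <= b * n%:R ->
    delta <= qform R (freq K t) ->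
    let X := edge_scale K n m * qform R (freq K t) ^+ m
             * edge_corr R (m%:R / n%:R) (freq K t) in
    X * expR (- (C / n%:R)) <= elsym (edge_wt R t) m
    /\ elsym (edge_wt R t) m <= X * expR (C / n%:R).
Proof.
move=> Rs R0 d0 b0; have [W W1 RW] := mx_le_bound R0.
pose w := W / delta.
have w0 : 0 <= w by rewrite divr_ge0// ?ltW//; lra.
have w2 := exprn_ge0 2 w0; have w3 := exprn_ge0 3 w0; have w4 := exprn_ge0 4 w0.
have b2 := exprn_ge0 2 b0; have b3 := exprn_ge0 3 b0.
have k1 := mulr_ge0 b0 w2; have k2 := mulr_ge0 b3 w4; have k3 := mulr_ge0 b2 w3.
have k4 := mulr_ge0 b3 w3; have k5 := mulr_ge0 b2 w2.
(* [C] collects the errors of both bounds, once [c <= b], [z <= w] and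
   [S <= 4 w ^ 2] are inserted. *)
have [C CE] : exists C : K, C = ((2 * b * w ^+ 2 + 768 * b ^+ 3 * w ^+ 4 + 8 * b ^+ 2 * w ^+ 3)
   + (8 * b * w ^+ 2 + 128 * b ^+ 3 * w ^+ 3 + b ^+ 2 * w ^+ 2)) by eexists.
exists C; first by rewrite CE; lra.
exists (Num.truncn (2 * w + 32 * b * w ^+ 2)).+1 => n m t Nn n0 mb Qd.
set x := freq K t; set Q := qform R x in Qd *.
pose u : K := n%:R^-1.
have nn : n%:R != 0 :> K by rewrite pnatr_eq0 -lt0n.
have np : 0 < n%:R :> K by rewrite ltr0n.
have u0 : 0 <= u by rewrite invr_ge0.
have up : 0 < u by rewrite invr_gt0.
have un : u * n%:R = 1 by rewrite mulVf.
have x0 i : 0 <= x i 0 := freq_ge0 K t i.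
have x1 : \sum_i x i 0 = 1 := sum_freq K t n0.
have nbig : 2 * w + 32 * b * w ^+ 2 <= n%:R.
  apply: ltW; apply: lt_le_trans (truncnS_gt _) _; first by rewrite ler_nat.
pose T1 := \sum_i x i 0 * R i i.
pose T2 := \sum_i \sum_j x i 0 * x j 0 * R i j ^+ 2.
pose T2' := \sum_i x i 0 * R i i ^+ 2.
have RjW j i k : R i k ^+ j <= W ^+ j by rewrite lerXn2r ?nnegrE//; lra.
have T1b : 0 <= T1 <= W.
  by rewrite sumr_ge0 ?lin_avg_le// => i _; rewrite mulr_ge0.
have T2b : 0 <= T2 <= W ^+ 2.
  rewrite sumr_ge0 ?quad_avg_le// => i _; apply: sumr_ge0 => j _.
  by rewrite !mulr_ge0// exprn_ge0.
have T2'b : 0 <= T2' <= W ^+ 2.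
  by rewrite sumr_ge0 ?lin_avg_le// => i _; rewrite mulr_ge0 ?exprn_ge0.
have wgt0 e : 0 <= edge_wt R t e by rewrite /edge_wt; case: ifP.
have Q0 : 0 < Q by exact: lt_le_trans d0 Qd.
have p1E : psum (edge_wt R t) 1 = n%:R ^+ 2 / 2 * (Q - u * T1).
  by rewrite psum_freq// /Q qformE /T1; congr (_ * (_ - _ * _)).
have p2E : psum (edge_wt R t) 2 = n%:R ^+ 2 / 2 * (T2 - u * T2') by rewrite psum_freq.
have p3le : psum (edge_wt R t) 3 <= n%:R ^+ 2 / 2 * W ^+ 3.
  rewrite psum_freq// ler_wpM2l ?divr_ge0 ?sqr_ge0//.
  apply: (@le_trans _ _ (\sum_i \sum_k x i 0 * x k 0 * R i k ^+ 3)).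
    by rewrite gerDl oppr_le0 mulr_ge0// sumr_ge0// => i _; rewrite mulr_ge0 ?exprn_ge0.
  exact: quad_avg_le.
have uw2 : u * (2 * w) <= 1.
  by rewrite -[leRHS]un ler_wpM2l//; have := mulr_ge0 b0 (sqr_ge0 w); clear -nbig; lra.
have uw3 : u * (32 * (b * w ^+ 2)) <= 1.
  by rewrite -[leRHS]un ler_wpM2l//; clear -nbig w0; lra.
have wd : w * delta = W by rewrite /w mulfVK// gt_eqF.
have uW : u * W <= delta / 2 by rewrite -wd; have := ler_wpM2r (ltW d0) uw2; lra.
have p2ge : 0 <= T2 - u * T2'.
  by have := psum_ge0 2 wgt0; rewrite p2E pmulr_rge0// divr_gt0// exprn_gt0.
have [S0 SW Sge Sle] := collision_shift d0 Qd W1 T1b T2b T2'b u0 uW p2ge.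
move: S0 SW Sge Sle; set S := (T2 - u * T2') / _ => S0 SW Sge Sle.
rewrite -/w in SW Sge Sle.
have uT1 : u * T1 <= u * W by rewrite ler_wpM2l//; case/andP: T1b.
have Qp : 0 < Q - u * T1 by clear -uT1 uW Qd d0; lra.
have p1p : 0 < psum (edge_wt R t) 1 by rewrite p1E !mulr_gt0// exprn_gt0.
pose beta := psum (edge_wt R t) 2 / psum (edge_wt R t) 1 ^+ 2.
pose gamma := psum (edge_wt R t) 3 / psum (edge_wt R t) 1 ^+ 3.
have betaE : beta = 2 * u ^+ 2 * S.
  rewrite /beta p1E p2E /S /u; field; rewrite nn/=.
  have -> : Q * n%:R - T1 = n%:R * (Q - u * T1) by rewrite /u; field.
  by rewrite mulf_neq0// gt_eqF.
have g0 : 0 <= gamma by rewrite divr_ge0 ?exprn_ge0 ?psum_ge0 ?ltW.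
have gammaW : gamma <= 32 * w ^+ 3 * u ^+ 4.
  have Qd2 : delta / 2 <= Q - u * T1 by clear -uT1 uW Qd d0; lra.
  have h : n%:R ^+ 2 / 2 * (delta / 2) <= psum (edge_wt R t) 1.
    by rewrite p1E ler_wpM2l// divr_ge0 ?sqr_ge0.
  have -> : 32 * w ^+ 3 * u ^+ 4
     = n%:R ^+ 2 / 2 * W ^+ 3 / (n%:R ^+ 2 / 2 * (delta / 2)) ^+ 3.
    by rewrite /w /u; field; rewrite nn gt_eqF.
  have hp : 0 < n%:R ^+ 2 / 2 * (delta / 2) by rewrite mulr_gt0 ?divr_gt0 ?exprn_gt0.
  apply: ler_pM => //; first exact: psum_ge0.
    by rewrite invr_ge0 exprn_ge0// ltW.
  have hX : (n%:R ^+ 2 / 2 * (delta / 2)) ^+ 3 <= psum (edge_wt R t) 1 ^+ 3.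
    by rewrite lerXn2r ?nnegrE//; exact: ltW.
  by rewrite lef_pV2 ?posrE ?exprn_gt0//.
pose c := m%:R / n%:R : K.
have c0 : 0 <= c by rewrite divr_ge0.
have cb : c <= b by rewrite ler_pdivrMr.
have mE : m%:R = c * n%:R by rewrite mulfVK.
have mu : m%:R * u = c by [].
have mbeta : m%:R * beta <= 4^-1.
  rewrite betaE; have -> : m%:R * (2 * u ^+ 2 * S) = 2 * (c * u * S) by rewrite -mu; ring.
  have : c * u * S <= b * u * (4 * w ^+ 2) by exact: ler_pM (mulr_ge0 c0 u0) S0 (ler_wpM2r u0 cb) SW.
  by lra.
have [lo hi] := elsym_bounds wgt0 p1p mbeta.
rewrite -/beta -/gamma in lo hi.
pose z := T1 / Q.
have z0 : 0 <= z by apply: divr_ge0 (ltW Q0); case/andP: T1b.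
have zw : z <= w.
  rewrite /z /w; case/andP: T1b => T10 T1W; apply: ler_pM => //.
    by rewrite invr_ge0 ltW.
  by rewrite lef_pV2.
have uz : u * z <= 2^-1 by have := ler_wpM2l u0 zw; clear -uw2; lra.
have [zlo zhi] := pow_shift m u0 z0 uz.
have p1m : psum (edge_wt R t) 1 ^+ m / m`!%:R
    = edge_scale K n m * Q ^+ m * (1 - u * z) ^+ m.
  have -> : psum (edge_wt R t) 1 = n%:R ^+ 2 / 2 * Q * (1 - u * z).
    by rewrite p1E /z; field; rewrite gt_eqF.
  rewrite /edge_scale exprM invfM; move: (n%:R ^+ 2) => N2.
  rewrite !exprMn exprVn.
  move: (N2 ^+ m) (2 ^+ m)^-1 (Q ^+ m) ((1 - u * z) ^+ m) (m`!%:R^-1) => A1 A2 A3 A4 A5.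
  by ring.
have LQ0 : 0 <= edge_scale K n m * Q ^+ m.
  by rewrite mulr_ge0 ?exprn_ge0 ?ltW// /edge_scale divr_gt0 ?mulr_gt0 ?exprn_gt0// ltr0n fact_gt0.
have corrE : edge_corr R c x = expR (- (c * z) - c ^+ 2 * (T2 / Q ^+ 2)).
  rewrite /edge_corr tr_diagM tr_diagM2// -/Q -/T1 -/T2; congr expR.
  by rewrite /z; field; rewrite gt_eqF.
have c2 : c ^+ 2 <= b ^+ 2 by rewrite lerXn2r ?nnegrE.
have c3 : c ^+ 3 <= b ^+ 3 by rewrite lerXn2r ?nnegrE.
have c20 : 0 <= c ^+ 2 := sqr_ge0 _.
have c30 : 0 <= c ^+ 3 by rewrite exprn_ge0.
have m3b : m%:R ^+ 3 * beta ^+ 2 = 4 * (u * (c ^+ 3 * S ^+ 2)).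
  by rewrite betaE mE; move: un; rewrite /u => _; field; rewrite nn.
have m2b : m%:R ^+ 2 * beta / 2 = c ^+ 2 * S.
  by rewrite betaE mE /u; field; rewrite nn.
have CnE : C / n%:R = u * C by rewrite mulrC.
have z2 : z ^+ 2 <= w ^+ 2 by rewrite lerXn2r ?nnegrE.
have S2 : S ^+ 2 <= 16 * w ^+ 4.
  have : S ^+ 2 <= (4 * w ^+ 2) ^+ 2 by rewrite lerXn2r ?nnegrE// mulr_ge0.
  by lra.
rewrite -/c corrE; split.
- apply: le_trans lo; rewrite p1m -[leLHS]mulrA -[leRHS]mulrA ler_wpM2l//.
  apply: le_trans (ler_wpM2r (expR_ge0 _) zlo).
  rewrite -!expRD ler_expR mu m2b m3b CnE.
  have e1 : u * (c * z ^+ 2) <= u * (b * w ^+ 2) by rewrite ler_wpM2l// ler_pM// sqr_ge0.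
  have e2 : u * (c ^+ 3 * S ^+ 2) <= u * (b ^+ 3 * (16 * w ^+ 4)).
    by rewrite ler_wpM2l// ler_pM// sqr_ge0.
  have e3 := ler_wpM2l c20 Sle.
  have e4 : u * (c ^+ 2 * w ^+ 3) <= u * (b ^+ 2 * w ^+ 3).
    by rewrite ler_wpM2l// ler_wpM2r.
  have f1 : 0 <= u * (8 * b * w ^+ 2 + 128 * b ^+ 3 * w ^+ 3 + b ^+ 2 * w ^+ 2).
    by apply: mulr_ge0 u0 _; clear -k1 k2 k3 k4 k5; lra.
  by rewrite CE; lra.
- apply: (le_trans hi); rewrite p1m -[leLHS]mulrA -[leRHS]mulrA ler_wpM2l//.
  apply: (le_trans (ler_wpM2r (expR_ge0 _) zhi)).
  rewrite -!expRD ler_expR mu m2b CnE.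
  have e1 : c * (u * S) <= b * (u * (4 * w ^+ 2)).
    exact: ler_pM c0 (mulr_ge0 u0 S0) cb (ler_wpM2l u0 SW).
  have mb1 : m%:R * beta = 2 * (c * (u * S)) by rewrite betaE -mu; ring.
  have e2 : m%:R ^+ 3 * gamma <= m%:R ^+ 3 * (32 * w ^+ 3 * u ^+ 4).
    by rewrite ler_wpM2l ?exprn_ge0.
  have e2' : m%:R ^+ 3 * (32 * w ^+ 3 * u ^+ 4) = 32 * (u * (c ^+ 3 * w ^+ 3)).
    by rewrite -mu; ring.
  have e2'' : u * (c ^+ 3 * w ^+ 3) <= u * (b ^+ 3 * w ^+ 3).
    by rewrite ler_wpM2l// ler_wpM2r.
  have e3 := ler_wpM2l c20 Sge.
  have e4 : u * (c ^+ 2 * w ^+ 2) <= u * (b ^+ 2 * w ^+ 2).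
    by rewrite ler_wpM2l// ler_wpM2r.
  have f1 : 0 <= u * (2 * b * w ^+ 2 + 768 * b ^+ 3 * w ^+ 4 + 8 * b ^+ 2 * w ^+ 3).
    by apply: mulr_ge0 u0 _; clear -k1 k2 k3 k4 k5; lra.
  by rewrite CE; lra.
Qed.

(** * Gaussian sums on a line *)

Definition gaussian (K : realType) (kappa s x : K) : K :=
  expR (- (kappa / 2 * (x - s) ^+ 2)).

Lemma gaussian_ge0 (K : realType) (kappa s x : K) : 0 <= gaussian kappa s x.
Proof. exact: expR_ge0. Qed.

Lemma gaussian_le1 (K : realType) (kappa s x : K) :
  0 <= kappa -> gaussian kappa s x <= 1.
Proof.
move=> k0; rewrite -expR0 ler_expR oppr_le0 mulr_ge0 ?sqr_ge0//.
by rewrite divr_ge0.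
Qed.

Lemma gaussianE (K : realType) (kappa s x : K) : 0 < kappa ->
  gaussian kappa s x
  = Num.sqrt (2 * pi / kappa) * normal_pdf s (Num.sqrt kappa^-1) x.
Proof.
move=> k0; have ki : 0 < kappa^-1 by rewrite invr_gt0.
rewrite normal_pdfE ?gt_eqF ?sqrtr_gt0// /normal_peak /normal_fun sqr_sqrtr ?ltW//.
have -> : 2 * pi / kappa = (kappa^-1 * pi) *+ 2 by rewrite -mulr_natl; ring.
rewrite mulrA divff ?mul1r ?gt_eqF ?sqrtr_gt0 ?mulrn_wgt0 ?mulr_gt0 ?pi_gt0//.
congr expR; rewrite -mulr_natl mulNr; congr (- _).
by field; rewrite gt_eqF.
Qed.

Lemma measurable_gaussian (K : realType) (kappa s : K) :
  0 < kappa -> measurable_fun [set: K] (gaussian kappa s).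
Proof.
move=> k0.
rewrite (_ : gaussian kappa s = (fun x => Num.sqrt (2 * pi / kappa)
   * normal_pdf s (Num.sqrt kappa^-1) x)); last first.
  by apply/funext => x; rewrite gaussianE.
by apply: measurable_funM => //; exact: measurable_normal_pdf.
Qed.

Lemma integral_gaussian (K : realType) (kappa s : K) : 0 < kappa ->
  (\int[lebesgue_measure]_x (gaussian kappa s x)%:E
   = (Num.sqrt (2 * pi / kappa))%:E)%E.
Proof.
move=> k0; under eq_integral do rewrite gaussianE// EFinM.
rewrite ge0_integralZl_EFin//=.
- by rewrite integral_normal_pdf mule1.
- by move=> x _; rewrite lee_fin normal_pdf_ge0.
- by apply/measurable_EFinP; exact: measurable_normal_pdf.
Qed.

(** A nondecreasing function whose increments bound the oscillation of the
    Gaussian. Its total increase is at most [2], so a sum over unit cells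
    differs from the integral by at most [2]. *)
Definition gauss_var (K : realType) (kappa s x : K) : K :=
  if x <= s then gaussian kappa s x else 2 - gaussian kappa s x.

Lemma gaussian_le (K : realType) (kappa s x y : K) : 0 <= kappa ->
  `|y - s| <= `|x - s| -> gaussian kappa s x <= gaussian kappa s y.
Proof.
move=> k0 h; rewrite ler_expR lerN2 ler_wpM2l ?divr_ge0//.
by rewrite -[leLHS]real_normK ?num_real// -[leRHS]real_normK ?num_real// lerXn2r ?nnegrE.
Qed.

Lemma gauss_var_bnd (K : realType) (kappa s x : K) : 0 <= kappa ->
  0 <= gauss_var kappa s x <= 2.
Proof.
move=> k0; have := gaussian_le1 s x k0; have := gaussian_ge0 kappa s x.
by rewrite /gauss_var; case: ifP => _; lra.
Qed.

Lemma gauss_varP (K : realType) (kappa s x y : K) : 0 <= kappa -> x <= y ->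
  `|gaussian kappa s y - gaussian kappa s x|
    <= gauss_var kappa s y - gauss_var kappa s x.
Proof.
move=> k0 xy; have := gaussian_le1 s x k0; have := gaussian_le1 s y k0.
rewrite /gauss_var ler_norml => y1 x1.
have [ys|sy] := leP y s; have [xs|sx] := leP x s.
- have : gaussian kappa s x <= gaussian kappa s y.
    by apply: gaussian_le => //; rewrite !ler0_norm; lra.
  by lra.
- lra.
- by lra.
- have : gaussian kappa s y <= gaussian kappa s x.
    by apply: gaussian_le => //; rewrite !ger0_norm; lra.
  by lra.
Qed.

Lemma sum_gauss_var (K : realType) (kappa s : K) N : 0 <= kappa ->
  \sum_(j < N) (gauss_var kappa s j.+1%:R - gauss_var kappa s j%:R) <= 2.
Proof.
move=> k0; rewrite -(big_mkord xpredT (fun j => gauss_var kappa s j.+1%:R - gauss_var kappa s j%:R)) telescope_sumr//.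
have /andP[_ h1] := gauss_var_bnd s N%:R k0.
have /andP[h2 _] := gauss_var_bnd s 0%:R k0.
by lra.
Qed.

Lemma nat_cell (K : realType) (N : nat) (x : K) : 0 <= x -> x < N%:R ->
  exists2 j : 'I_N, j%:R <= x < j.+1%:R &
    forall i : 'I_N, i%:R <= x < i.+1%:R -> i = j.
Proof.
move=> x0 xN; have := truncn_itv x0; set k := Num.truncn x => /andP[kx xk].
have kN : (k < N)%N by rewrite -(ltr_nat K) (le_lt_trans kx).
exists (Ordinal kN); rewrite /= ?kx//= => i /andP[ix xi].
apply/val_inj => /=; apply/eqP; rewrite eqn_leq -(ltnS i) -(ltnS k) -!(ltr_nat K).
by rewrite (le_lt_trans ix xk) (le_lt_trans kx xi).
Qed.

Definition steps (K : realType) (N : nat) (h : nat -> K) (x : K) : K :=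
  \sum_(j < N) h j * \1_(`[j%:R, j.+1%:R[%classic) x.

Lemma steps_in (K : realType) (N : nat) (h : nat -> K) (x : K) (j : 'I_N) :
  j%:R <= x < j.+1%:R -> steps N h x = h j.
Proof.
move=> jx; have /andP[jx1 jx2] := jx.
have x0 : 0 <= x := le_trans (ler0n K j) jx1.
have xN : x < N%:R by apply: lt_le_trans jx2 _; rewrite ler_nat.
have [j' _ ju] := nat_cell x0 xN.
rewrite /steps (bigD1 j)//= big1 ?addr0 => [|i ij].
  by rewrite indicE mem_set ?mulr1//= in_itv.
rewrite indicE memNset ?mulr0//= in_itv/= => ix.
by move: ij; rewrite (ju i ix) (ju j jx) eqxx.
Qed.

Lemma steps_out (K : realType) (N : nat) (h : nat -> K) (x : K) :
  (x < 0) || (N%:R <= x) -> steps N h x = 0.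
Proof.
move=> xo; rewrite /steps big1// => i _.
rewrite indicE memNset ?mulr0//= in_itv/= => /andP[ix xi].
have : 0 <= x < N%:R.
  by rewrite (le_trans _ ix)//= (lt_le_trans xi)// ler_nat.
by lra.
Qed.

Lemma integral_steps (K : realType) (N : nat) (h : nat -> K) :
  (forall j, 0 <= h j) ->
  (\int[lebesgue_measure]_x (steps N h x)%:E = (\sum_(j < N) h j)%:E)%E.
Proof.
move=> h0; rewrite /steps; under eq_integral do rewrite -sumEFin.
rewrite ge0_integral_sum//=; last 2 first.
- move=> j; apply/measurable_EFinP; apply: measurable_funM => //.
- by move=> j x _; rewrite lee_fin mulr_ge0.
rewrite -sumEFin; apply: eq_bigr => j _.
under eq_integral do rewrite EFinM.
rewrite ge0_integralZl_EFin//=; last first.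
  by apply/measurable_EFinP.
rewrite integral_indic//= setIT lebesgue_measure_itv/= lte_fin ltr_nat ltnSn.
by rewrite -EFinB -natr1 addrAC subrr add0r mule1.
Qed.

Lemma measurable_steps (K : realType) (N : nat) (h : nat -> K) :
  measurable_fun [set: K] (steps N h).
Proof.
rewrite /steps.
by apply: measurable_sum => j; apply: measurable_funM.
Qed.

Lemma gauss_cell (K : realType) (kappa s x : K) (j : nat) : 0 <= kappa ->
  j%:R <= x < j.+1%:R ->
  `|gaussian kappa s x - gaussian kappa s j%:R|
    <= gauss_var kappa s j.+1%:R - gauss_var kappa s j%:R.
Proof.
move=> k0 /andP[jx xj]; apply: le_trans (gauss_varP s k0 jx) _.
rewrite lerB//; have := gauss_varP s k0 (ltW xj).
by move=> /(le_trans (normr_ge0 _)); rewrite subr_ge0.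
Qed.

Lemma cellP (K : realType) (N : nat) (x : K) :
  (exists j : 'I_N, j%:R <= x < j.+1%:R) \/ (x < 0) || (N%:R <= x).
Proof.
have [x0|x0] := ltP x 0; first by right.
have [xN|xN] := leP N%:R x; first by right.
by left; have [j jx _] := nat_cell x0 xN; exists j.
Qed.

(** On each cell the integrand is at least its value at the left end minus the
    increment of [gauss_var], truncated at [0] to be integrated as a
    nonnegative function. *)
Lemma gauss_sum_le (K : realType) (kappa s : K) (N : nat) : 0 < kappa ->
  \sum_(j < N) gaussian kappa s j%:R <= Num.sqrt (2 * pi / kappa) + 2.
Proof.
move=> k0; have k0' := ltW k0.
pose dV (j : nat) := gauss_var kappa s j.+1%:R - gauss_var kappa s j%:R.
pose h (j : nat) := Num.max 0 (gaussian kappa s j%:R - dV j).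
have h0 j : 0 <= h j by rewrite /h le_max lexx.
have hI : \sum_(j < N) h j <= Num.sqrt (2 * pi / kappa).
  rewrite -lee_fin -integral_steps// -(integral_gaussian s k0).
  apply: ge0_le_integral => //.
  - by move=> x _; rewrite lee_fin /steps sumr_ge0// => j _; rewrite mulr_ge0.
  - by apply/measurable_EFinP; exact: measurable_steps.
  - by apply/measurable_EFinP; exact: measurable_gaussian.
  move=> x _; rewrite lee_fin; have [[j jx]|xo] := cellP N x; last first.
    by rewrite steps_out// gaussian_ge0.
  rewrite (steps_in _ jx) /h ge_max gaussian_ge0/= /dV.
  by have := gauss_cell s k0' jx; rewrite ler_norml; lra.
have hV := sum_gauss_var s N k0'.
suff : \sum_(j < N) gaussian kappa s j%:R <= \sum_(j < N) h j + \sum_(j < N) dV j.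
  by rewrite /dV; lra.
rewrite -big_split/=; apply: ler_sum => j _; rewrite -lerBlDr.
by rewrite /h le_max lexx orbT.
Qed.

(** Half of the exponent turns into a small constant factor, the other half keeps
    the tail summable. *)
Lemma gauss_tail (K : realType) (kappa s x D : K) : 0 < kappa -> 0 <= D ->
  D <= `|x - s| ->
  gaussian kappa s x <= expR (- (kappa / 4 * D ^+ 2)) * gaussian (kappa / 2) s x.
Proof.
move=> k0 D0 Dx; rewrite /gaussian -expRD ler_expR.
have h : D ^+ 2 <= (x - s) ^+ 2.
  by rewrite -[leRHS]real_normK ?num_real// lerXn2r ?nnegrE.
have := ler_wpM2l (ltW k0) h; lra.
Qed.

(** Outside the summation range the integrand is bounded by [gauss_tail]. *)
Lemma gauss_sum_ge (K : realType) (kappa s D : K) (N : nat) :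
  0 < kappa -> 0 <= D -> D <= s -> s + D <= N%:R ->
  Num.sqrt (2 * pi / kappa) <=
  \sum_(j < N) gaussian kappa s j%:R + 2
  + expR (- (kappa / 4 * D ^+ 2)) * Num.sqrt (2 * pi / (kappa / 2)).
Proof.
move=> k0 D0 Ds DN; have k0' := ltW k0; have k20 : 0 < kappa / 2 by lra.
pose dV (j : nat) := gauss_var kappa s j.+1%:R - gauss_var kappa s j%:R.
have dV0 j : 0 <= dV j.
  rewrite /dV; have jj : j%:R <= j.+1%:R :> K by rewrite ler_nat.
  exact: le_trans (normr_ge0 _) (gauss_varP s k0' jj).
pose h (j : nat) := gaussian kappa s j%:R + dV j.
have h0 j : 0 <= h j by rewrite addr_ge0// gaussian_ge0.
have hV := sum_gauss_var s N k0'.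
suff : Num.sqrt (2 * pi / kappa) <= \sum_(j < N) h j
  + expR (- (kappa / 4 * D ^+ 2)) * Num.sqrt (2 * pi / (kappa / 2)).
  by rewrite /h big_split/=; move: hV; rewrite -/(dV _) /dV; lra.
rewrite -lee_fin EFinD EFinM -integral_steps// -(integral_gaussian s k0).
rewrite -(integral_gaussian s k20) -ge0_integralZl_EFin//=; last 2 first.
- by move=> x _; rewrite lee_fin gaussian_ge0.
- by apply/measurable_EFinP; exact: measurable_gaussian.
have st0 x : 0 <= steps N h x by rewrite /steps sumr_ge0// => j _; rewrite mulr_ge0.
rewrite -ge0_integralD//=; last 4 first.
- by move=> x _; rewrite lee_fin.
- by apply/measurable_EFinP; exact: measurable_steps.
- by move=> x _; rewrite -EFinM lee_fin mulr_ge0 ?expR_ge0 ?gaussian_ge0.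
- apply/measurable_EFinP; apply: measurable_funM => //.
  exact: measurable_gaussian.
apply: ge0_le_integral => //.
- by move=> x _; rewrite lee_fin gaussian_ge0.
- by apply/measurable_EFinP; exact: measurable_gaussian.
- apply/measurable_EFinP; apply: measurable_funD; first exact: measurable_steps.
  by apply: measurable_funM => //; exact: measurable_gaussian.
move=> x _; rewrite -EFinM -EFinD lee_fin.
have t0 : 0 <= expR (- (kappa / 4 * D ^+ 2)) * gaussian (kappa / 2) s x.
  by rewrite mulr_ge0 ?expR_ge0 ?gaussian_ge0.
have [[j jx]|xo] := cellP N x.
  rewrite (steps_in _ jx) /h /dV.
  by have := gauss_cell s k0' jx; rewrite ler_norml; lra.
rewrite (le_trans (gauss_tail k0 D0 _)) ?lerDr//.
by case/orP: xo => xo; [rewrite ler0_norm|rewrite ger0_norm]; lra.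
Qed.

Lemma gauss_window (K : realType) (kappa s D : K) (N : nat) :
  0 < kappa -> 0 <= D -> D <= s -> s + D <= N%:R ->
  Num.sqrt (2 * pi / kappa) - 2 - expR (- (kappa / 4 * D ^+ 2)) *
     (2 * Num.sqrt (2 * pi / (kappa / 2)) + 2) <=
  \sum_(j < N | `|j%:R - s| <= D) gaussian kappa s j%:R.
Proof.
move=> k0 D0 Ds DN; have k20 : 0 < kappa / 2 by lra.
have := gauss_sum_ge k0 D0 Ds DN.
rewrite (bigID (fun j : 'I_N => `|j%:R - s| <= D))/=.
have : \sum_(i < N | ~~ (`|i%:R - s| <= D)) gaussian kappa s i%:R
   <= expR (- (kappa / 4 * D ^+ 2)) * (Num.sqrt (2 * pi / (kappa / 2)) + 2).
  apply: le_trans (ler_wpM2l (expR_ge0 _) (gauss_sum_le s N k20)).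
  rewrite big_distrr/= big_mkcond/=; apply: ler_sum => j _.
  case: ifP => [|_]; last by rewrite mulr_ge0 ?expR_ge0 ?gaussian_ge0.
  by rewrite -ltNge => /ltW; exact: gauss_tail.
by lra.
Qed.

(** * Positive definite forms and Schur complements *)

Definition posdef (K : realType) (d : nat) (H : 'M[K]_d) : Prop :=
  H^T = H /\ forall y : 'cV[K]_d, y != 0 -> 0 < qform H y.

(** The Schur complement of the top left entry: what completing the square in
    the first variable leaves on the others. *)
Definition schur (K : realType) (d : nat) (H : 'M[K]_(1 + d)) : 'M[K]_d :=
  drsubmx H - (H 0 0)^-1 *: ((ursubmx H)^T *m ursubmx H).

Lemma mx11_mul (K : realType) (A B : 'M[K]_1) : (A *m B) 0 0 = A 0 0 * B 0 0.
Proof. by rewrite mxE big_ord1. Qed.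

Lemma qform_schur (K : realType) (d : nat) (H : 'M[K]_(1 + d)) (t : K) (v : 'cV[K]_d) :
  H^T = H -> H 0 0 != 0 ->
  qform H (col_mx (const_mx t) v) =
  H 0 0 * (t + (ursubmx H *m v) 0 0 / H 0 0) ^+ 2 + qform (schur H) v.
Proof.
move=> Hs H0; rewrite /qform.
have sub0 : (ulsubmx H) 0 0 = H 0 0.
  by rewrite !mxE; congr (H _ _); apply/val_inj.
have dlE : dlsubmx H = (ursubmx H)^T by rewrite trmx_ursub Hs.
rewrite -[in LHS](submxK H) tr_col_mx mul_row_block mul_row_col.
rewrite !mulmxDl !mulmxBr !mulmxBl dlE -!scalemxAr -!scalemxAl.
set b := ursubmx H.
have e1 : ((const_mx t)^T *m ulsubmx H *m const_mx t : 'M[K]_1) 0 0 = t * H 0 0 * t.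
  by rewrite !mx11_mul !mxE -sub0 !mxE.
have e2 : (v^T *m b^T *m const_mx t : 'M[K]_1) 0 0 = (b *m v) 0 0 * t.
  by rewrite -trmx_mul mx11_mul !mxE.
have e3 : ((const_mx t)^T *m b *m v : 'M[K]_1) 0 0 = t * (b *m v) 0 0.
  by rewrite -mulmxA mx11_mul !mxE.
have e4 : (v^T *m (b^T *m b) *m v) 0 0 = (b *m v) 0 0 ^+ 2.
  by rewrite !mulmxA -trmx_mul -mulmxA mx11_mul !mxE expr2.
have add11 (A B : 'M[K]_1) : (A + B) 0 0 = A 0 0 + B 0 0 by rewrite mxE.
have sub11 (A B : 'M[K]_1) : (A - B) 0 0 = A 0 0 - B 0 0 by rewrite !mxE.
have sca11 x (A : 'M[K]_1) : (x *: A) 0 0 = x * A 0 0 by rewrite !mxE.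
rewrite sub11 sca11 e4 !add11 e1 e2 e3.
by move: ((b *m v) 0 0) => w; field.
Qed.

(** Completing the square is a unipotent change of variables. *)
Lemma det_schur (K : realType) (d : nat) (H : 'M[K]_(1 + d)) :
  H^T = H -> H 0 0 != 0 -> \det H = H 0 0 * \det (schur H).
Proof.
move=> Hs H0.
have ulE : ulsubmx H = (H 0 0)%:M.
  apply/matrixP => i j; rewrite !ord1 !mxE eqxx mulr1n; congr (H _ _); exact/val_inj.
have dlE : dlsubmx H = (ursubmx H)^T by rewrite trmx_ursub Hs.
have HE : H = block_mx 1%:M 0 ((H 0 0)^-1 *: (ursubmx H)^T) 1%:M
   *m block_mx (H 0 0)%:M (ursubmx H) 0 (schur H).
  rewrite mulmx_block !mul1mx !mul0mx !addr0 /schur.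
  rewrite -{1}(submxK H) ulE dlE; congr block_mx.
    by rewrite mul_mx_scalar scalerA divff// scale1r.
  by rewrite -scalemxAl addrC subrK.
rewrite {1}HE det_mulmx det_lblock det_ublock !det1 !mul1r.
by rewrite det_scalar expr1.
Qed.

Lemma posdef_diag0 (K : realType) (d : nat) (H : 'M[K]_(1 + d)) :
  posdef H -> 0 < H 0 0.
Proof.
move=> [Hs Hp]; have := Hp (delta_mx 0 0).
rewrite /qform trmx_delta -rowE -colE !mxE; apply.
by apply/eqP => /matrixP/(_ 0 0); rewrite !mxE !eqxx => /eqP; rewrite oner_eq0.
Qed.

Lemma posdef_schur (K : realType) (d : nat) (H : 'M[K]_(1 + d)) :
  posdef H -> posdef (schur H).
Proof.
move=> Hpd; have H0 := posdef_diag0 Hpd; have [Hs Hp] := Hpd; split.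
  rewrite /schur linearB/= linearZ/= trmx_mul trmxK; congr (_ - _).
  by rewrite trmx_drsub Hs.
move=> y y0; have := Hp (col_mx (const_mx (- ((ursubmx H *m y) 0 0 / H 0 0))) y).
rewrite qform_schur ?gt_eqF// addNr expr0n/= mulr0 add0r; apply.
by apply: contra y0; rewrite col_mx_eq0 => /andP[].
Qed.

Lemma posdef_det_gt0 (K : realType) (d : nat) (H : 'M[K]_d) :
  posdef H -> 0 < \det H.
Proof.
elim: d H => [|d IH] H Hp; first by rewrite det_mx00.
have H0 := posdef_diag0 (H := H) Hp.
rewrite (@det_schur _ d H) ?gt_eqF//; last by case: Hp.
by rewrite mulr_gt0// IH//; exact: posdef_schur.
Qed.

Definition vnat (K : realType) (N d : nat) (k : 'cV['I_N]_d) : 'cV[K]_d :=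
  \col_i (k i 0)%:R.

Lemma vnat_col (K : realType) (N d : nat) (j : 'I_N) (k : 'cV['I_N]_d) :
  vnat K (col_mx (const_mx j : 'cV_1) k) = col_mx (const_mx j%:R) (vnat K k).
Proof.
apply/colP => i; rewrite !mxE; by case: fintype.split => i'; rewrite !mxE.
Qed.

Lemma sum_cV_split (K : realType) (N d : nat) (F : 'cV['I_N]_(1 + d) -> K) :
  \sum_k F k = \sum_(k : 'cV['I_N]_d) \sum_(j : 'I_N) F (col_mx (const_mx j) k).
Proof.
rewrite pair_big/= (reindex (fun p : 'cV['I_N]_d * 'I_N => col_mx (const_mx p.2) p.1))//.
exists (fun k => (dsubmx k, k (lshift d ord0) ord0)) => [[k j]|k] _ /=.
  by rewrite col_mxKd col_mxEu mxE.
rewrite -[RHS]vsubmxK; congr col_mx; apply/matrixP => i j; rewrite !mxE.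
by rewrite (ord1 i) (ord1 j).
Qed.

Definition lgauss (K : realType) (N d : nat) (H : 'M[K]_d) (kappa : K)
    (s : 'cV[K]_d) (k : 'cV['I_N]_d) : K :=
  expR (- (kappa / 2 * qform H (vnat K k - s))).

(** Completing the square in the first coordinate factors the lattice Gaussian:
    the Schur complement governs the other coordinates, and only the centre of
    the first factor depends on them. *)
Lemma lgauss_split (K : realType) (N d : nat) (H : 'M[K]_(1 + d)) (kappa : K)
    (s : 'cV[K]_(1 + d)) (k : 'cV['I_N]_d) (j : 'I_N) :
  H^T = H -> H 0 0 != 0 ->
  lgauss H kappa s (col_mx (const_mx j) k) =
  gaussian (kappa * H 0 0)
    (s 0 0 - (ursubmx H *m (vnat K k - dsubmx s)) 0 0 / H 0 0) j%:R
  * lgauss (schur H) kappa (dsubmx s) k.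
Proof.
move=> Hs H0; rewrite /lgauss /gaussian -expRD; congr expR.
rewrite vnat_col -{1}(vsubmxK s) opp_col_mx add_col_mx.
have -> : const_mx j%:R - usubmx s = const_mx (j%:R - s 0 0) :> 'cV_1.
  apply/matrixP => i i'; rewrite !ord1 !mxE; congr (_ - s _ _); exact/val_inj.
rewrite qform_schur//; move: ((ursubmx H *m _) 0 0) (qform _ _) => w Q.
by ring.
Qed.

(** * Gaussian sums on a lattice *)

Lemma gauss_norm_big (K : realType) (h M : K) : 0 < h ->
  exists2 k0 : K, 0 < k0 & forall kappa : K, 0 < kappa -> kappa <= k0 ->
    M <= Num.sqrt (2 * pi / (kappa * h)).
Proof.
move=> h0; have M1 : 0 < (1 + `|M|) by have := normr_ge0 M; lra.
exists (2 * pi / (h * (1 + `|M|) ^+ 2)).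
  by rewrite divr_gt0 ?mulr_gt0 ?pi_gt0 ?exprn_gt0.
move=> kappa k0 kle; apply: (@le_trans _ _ (1 + `|M|)).
  by have := ler_norm M; lra.
rewrite -(@ler_pXn2r _ 2) ?nnegrE ?sqrtr_ge0 ?(ltW M1)//.
rewrite sqr_sqrtr; last by rewrite divr_ge0 ?mulr_ge0 ?pi_ge0 ?ltW.
rewrite ler_pdivlMr ?mulr_gt0//.
have : 0 < h * (1 + `|M|) ^+ 2 by rewrite mulr_gt0// exprn_gt0.
by move: kle => + D0; rewrite ler_pdivlMr//; lra.
Qed.

Lemma gauss_norm_factor (K : realType) (kappa h D : K) (d : nat) :
  0 < kappa -> 0 < h -> 0 < D ->
  Num.sqrt (2 * pi / kappa) ^+ d.+1 / Num.sqrt (h * D) =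
  Num.sqrt (2 * pi / (kappa * h)) * (Num.sqrt (2 * pi / kappa) ^+ d / Num.sqrt D).
Proof.
move=> k0 h0 D0; have X0 : 0 <= 2 * pi / kappa by rewrite divr_ge0 ?mulr_ge0 ?pi_ge0// ltW.
have -> : 2 * pi / (kappa * h) = (2 * pi / kappa) * h^-1 by rewrite invfM mulrA.
rewrite (sqrtrM h^-1 X0) sqrtrV ?ltW// (sqrtrM D (ltW h0)) exprS invfM.
by move: (_ ^-1) (_^-1) (Num.sqrt _) (_ ^+ d) => *; ring.
Qed.

Lemma lgauss0 (K : realType) (N : nat) (H : 'M[K]_0) kappa (s : 'cV[K]_0) (k : 'cV['I_N]_0) :
  lgauss H kappa s k = 1.
Proof. by rewrite /lgauss qformE big_ord0 mulr0 oppr0 expR0. Qed.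

Lemma lgauss_ge0 (K : realType) (N d : nat) (H : 'M[K]_d) kappa s (k : 'cV['I_N]_d) :
  0 <= lgauss H kappa s k.
Proof. exact: expR_ge0. Qed.

(** Induction on the dimension: summing over the first coordinate costs
    [sqrt (2 pi / (kappa h)) + 2] whatever the centre, and the [2] is negligible
    for small [kappa]. *)
Lemma lattice_gauss_le (K : realType) (d : nat) (H : 'M[K]_d) (eps : K) :
  posdef H -> 0 < eps ->
  exists2 k0 : K, 0 < k0 & forall (kappa : K) N (s : 'cV[K]_d),
    0 < kappa -> kappa <= k0 ->
    \sum_(k : 'cV['I_N]_d) lgauss H kappa s k
    <= (1 + eps) * (Num.sqrt (2 * pi / kappa) ^+ d / Num.sqrt (\det H)).
Proof.
elim: d H eps => [|d IH] H eps Hp e0.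
  exists 1 => // kappa N s k0 _.
  under eq_bigr do rewrite lgauss0.
  rewrite sumr_const card_mx card_ord muln1 expn0 det_mx00 sqrtr1 divr1 expr0.
  by rewrite mulr1 lerDl ltW.
have H0 : 0 < H 0 0 := posdef_diag0 (H := H) Hp.
have [Hs _] := Hp.
have Sp := posdef_schur (H := H) Hp; have Sd := posdef_det_gt0 Sp.
rewrite (@det_schur _ d H)// ?gt_eqF//.
pose e := Num.min 1 eps / 3.
have [e1 e2 e3] : [/\ 0 < e, e <= 1 & 3 * e <= eps].
  have m0 : 0 < Num.min 1 eps by rewrite lt_min ltr01.
  have m1 : Num.min 1 eps <= 1 by rewrite ge_min lexx.
  have m2 : Num.min 1 eps <= eps by rewrite ge_min lexx orbT.
  by rewrite /e; split; lra.
have [k1 k10 H1] := IH _ _ Sp e1.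
have [k2 k20 H2] := gauss_norm_big (2 / e) H0.
exists (Num.min k1 k2); first by rewrite lt_min k10.
move=> kappa N s k0; rewrite le_min => /andP[kk1 kk2].
have kh : 0 < kappa * H 0 0 by rewrite mulr_gt0.
rewrite gauss_norm_factor//.
set X := Num.sqrt (2 * pi / (kappa * _)); set Y := _ / _.
have XM := H2 _ k0 kk2; rewrite -/X ler_pdivrMr// in XM.
have {}H1 := H1 _ N (@dsubmx _ 1 d 1 s) k0 kk1; rewrite -/Y in H1.
rewrite (@sum_cV_split _ N d).
have X0 : 0 <= X := sqrtr_ge0 _.
have Y0 : 0 <= Y by rewrite divr_ge0 ?exprn_ge0 ?sqrtr_ge0.
apply: (@le_trans _ _ (\sum_k (1 + e) * X * lgauss (schur H) kappa (@dsubmx _ 1 d 1 s) k)).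
  apply: ler_sum => k _; under eq_bigr do rewrite lgauss_split// ?gt_eqF//.
  rewrite -big_distrl/= ler_wpM2r ?lgauss_ge0//.
  by apply: (le_trans (gauss_sum_le _ _ kh)); rewrite -/X; lra.
rewrite -big_distrr/=.
apply: (@le_trans _ _ ((1 + e) * X * ((1 + e) * Y))).
  by rewrite ler_wpM2l// mulr_ge0//; lra.
have -> : (1 + e) * X * ((1 + e) * Y) = (1 + e) ^+ 2 * (X * Y) by ring.
by rewrite ler_wpM2r ?mulr_ge0//; nra.
Qed.

(** With half-width [delta / kappa] the exponent at the edge of the window is of
    order [1 / kappa], so the tails vanish faster than any power of [kappa]. *)
Lemma gauss_window_asym (K : realType) (h eps delta : K) :
  0 < h -> 0 < eps -> 0 < delta ->
  exists2 k0 : K, 0 < k0 & forall (kappa : K) N s,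
    0 < kappa -> kappa <= k0 -> delta / kappa <= s -> s + delta / kappa <= N%:R ->
    (1 - eps) * Num.sqrt (2 * pi / (kappa * h)) <=
    \sum_(j < N | `|j%:R - s| <= delta / kappa) gaussian (kappa * h) s j%:R.
Proof.
move=> h0 e0 d0.
have [k1 k10 H1] := gauss_norm_big (16 / eps) h0.
pose q := h * delta ^+ 2 / 4.
have q0 : 0 < q by rewrite /q divr_gt0// mulr_gt0// exprn_gt0.
exists (Num.min k1 (Num.min (q * (eps / 16)) q)).
  by rewrite !lt_min k10 q0 mulr_gt0//; lra.
move=> kappa N s k0; rewrite !le_min => /and3P[kk1 kk2 kk3] ds dN.
have kh : 0 < kappa * h by rewrite mulr_gt0.
have D0 : 0 <= delta / kappa by rewrite divr_ge0// ltW.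
have XM := H1 _ k0 kk1.
apply: le_trans (gauss_window kh D0 ds dN).
have X0 : 0 <= Num.sqrt (2 * pi / (kappa * h)) := sqrtr_ge0 _.
have X2 : Num.sqrt (2 * pi / (kappa * h / 2)) <= 2 * Num.sqrt (2 * pi / (kappa * h)).
  have -> : 2 * pi / (kappa * h / 2) = 2 * (2 * pi / (kappa * h)).
    by field; rewrite !gt_eqF.
  rewrite sqrtrM// ler_wpM2r//.
  rewrite -(@ler_pXn2r _ 2) ?nnegrE ?sqrtr_ge0// sqr_sqrtr//; lra.
move: (Num.sqrt _) (Num.sqrt _) XM X0 X2 => Y X XM X0 X2.
rewrite ler_pdivrMr// in XM.
have E0 : expR (- (kappa * h / 4 * (delta / kappa) ^+ 2)) <= kappa / q.
  have -> : kappa * h / 4 * (delta / kappa) ^+ 2 = q / kappa.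
    by rewrite /q; field; rewrite gt_eqF.
  have kq : 0 < kappa / q by exact: divr_gt0.
  rewrite expRN -[leRHS]invrK lef_pV2 ?posrE ?expR_gt0 ?invr_gt0//.
  by rewrite invf_div; apply: le_trans (expR_ge1Dx _); lra.
have E1 : kappa / q <= eps / 16 by rewrite ler_pdivrMr//; lra.
have E2 : kappa / q <= 1 by rewrite ler_pdivrMr//; lra.
have E3 := expR_ge0 (- (kappa * h / 4 * (delta / kappa) ^+ 2)).
move: (expR _) E0 E3 => E E0 E3.
have F1 : E * (2 * Y + 2) <= E * (4 * X + 2) by rewrite ler_wpM2l//; lra.
have F2 : E * X <= eps / 16 * X by rewrite ler_wpM2r//; lra.
by lra.
Qed.

Definition in_window (K : realType) (N d : nat) (s : 'cV[K]_d) (D : K)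
    (k : 'cV['I_N]_d) : bool :=
  [forall i, `|(k i 0)%:R - s i 0| <= D].

Lemma in_window_col (K : realType) (N d : nat) (s : 'cV[K]_(1 + d)) (D : K)
    (k : 'cV['I_N]_d) (j : 'I_N) :
  `|j%:R - s 0 0| <= D -> in_window (dsubmx s) D k ->
  in_window s D (col_mx (const_mx j) k).
Proof.
move=> js /forallP ks; apply/forallP => i.
rewrite -(splitK i); case: (fintype.split i) => i'.
  rewrite [unsplit _]/= col_mxEu mxE.
  have -> : s (lshift d i') 0 = s 0 0 by congr (s _ _); apply/val_inj; rewrite (ord1 i').
  exact: js.
by rewrite [unsplit _]/= col_mxEd; have := ks i'; rewrite mxE.
Qed.

(** The centre of the first factor moves with the other coordinates, by at most
    a constant multiple of their distance to [s]. Restricting them to a window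
    smaller by a suitable factor keeps the moving window inside the given one. *)
Lemma lattice_gauss_ge (K : realType) (d : nat) (H : 'M[K]_d) (eps delta : K) :
  posdef H -> 0 < eps -> 0 < delta ->
  exists2 k0 : K, 0 < k0 & forall (kappa : K) N (s : 'cV[K]_d),
    0 < kappa -> kappa <= k0 ->
    (forall i, delta / kappa <= s i 0 /\ s i 0 + delta / kappa <= N%:R) ->
    (1 - eps) * (Num.sqrt (2 * pi / kappa) ^+ d / Num.sqrt (\det H)) <=
    \sum_(k : 'cV['I_N]_d | in_window s (delta / kappa) k) lgauss H kappa s k.
Proof.
elim: d H eps delta => [|d IH] H eps delta Hp e0 d0.
  exists 1 => // kappa N s k0 _ _.
  under eq_bigr do rewrite lgauss0.
  rewrite (eq_bigl xpredT) => [|k]; last by apply/forallP => -[].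
  rewrite sumr_const card_mx card_ord muln1 expn0 det_mx00 sqrtr1 divr1 expr0.
  by rewrite mulr1; lra.
have H0 : 0 < H 0 0 := posdef_diag0 (H := H) Hp.
have [Hs _] := Hp.
have Sp := posdef_schur (H := H) Hp; have Sd := posdef_det_gt0 Sp.
rewrite (@det_schur _ d H)// ?gt_eqF//.
pose e := Num.min 1 (eps / 2).
have [e1 e2 e3] : [/\ 0 < e, e <= 1 & 2 * e <= eps].
  have m0 : 0 < e by rewrite lt_min ltr01; lra.
  have m1 : e <= 1 by rewrite ge_min lexx.
  have m2 : e <= eps / 2 by rewrite ge_min lexx orbT.
  by split => //; lra.
pose b := @ursubmx _ 1 d 1 d H.
pose B := \sum_i `|b 0 i|.
have B0 : 0 <= B by apply: sumr_ge0.
pose d' := Num.min delta (delta * H 0 0 / (2 * (B + 1))).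
have d'0 : 0 < d' by rewrite lt_min d0/= divr_gt0 ?mulr_gt0//; lra.
have d'd : d' <= delta by rewrite ge_min lexx.
have d'B : B * d' <= delta * H 0 0 / 2.
  apply: (@le_trans _ _ ((B + 1) * (delta * H 0 0 / (2 * (B + 1))))).
    by apply: ler_pM => //; [exact: ltW|lra|rewrite ge_min lexx orbT].
  by rewrite le_eqVlt; apply/orP; left; apply/eqP; field; lra.
have d20 : 0 < delta / 2 by lra.
have [k1 k10 H1] := IH _ _ _ Sp e1 d'0.
have [k2 k20 H2] := gauss_window_asym H0 e1 d20.
exists (Num.min k1 k2); first by rewrite lt_min k10.
move=> kappa N s k0; rewrite le_min => /andP[kk1 kk2] sb.
have kh : 0 < kappa * H 0 0 by rewrite mulr_gt0.
rewrite gauss_norm_factor//.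
set X := Num.sqrt (2 * pi / (kappa * _)); set Y := _ / _.
have ki : 0 < kappa^-1 by rewrite invr_gt0.
have dk : d' / kappa <= delta / kappa by rewrite ler_wpM2r// ltW.
have {}H1 := H1 _ N (@dsubmx _ 1 d 1 s) k0 kk1; rewrite -/Y in H1.
have /H1 {}H1 : forall i, d' / kappa <= @dsubmx _ 1 d 1 s i 0 /\ @dsubmx _ 1 d 1 s i 0 + d' / kappa <= N%:R.
  by move=> i; rewrite mxE; have [s1 s2] := sb (rshift 1 i); split; lra.
rewrite big_mkcond (@sum_cV_split _ N d).
have X0 : 0 <= X := sqrtr_ge0 _.
have Y0 : 0 <= Y by rewrite divr_ge0 ?exprn_ge0 ?sqrtr_ge0.
apply: (@le_trans _ _ (\sum_(k | in_window (@dsubmx _ 1 d 1 s) (d' / kappa) k)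
    (1 - e) * X * lgauss (schur H) kappa (@dsubmx _ 1 d 1 s) k)).
  rewrite -big_distrr/=.
  apply: (@le_trans _ _ ((1 - e) * X * ((1 - e) * Y))); last first.
    by apply: ler_wpM2l H1; rewrite mulr_ge0//; lra.
  have -> : (1 - e) * X * ((1 - e) * Y) = (1 - e) ^+ 2 * (X * Y) by ring.
  by rewrite ler_wpM2r ?mulr_ge0//; nra.
rewrite [leLHS]big_mkcond/=; apply: ler_sum => k _; case: ifP => [kw|_]; last first.
  by apply: sumr_ge0 => j _; case: ifP => // _; exact: lgauss_ge0.
pose w := (b *m (vnat K k - @dsubmx _ 1 d 1 s)) 0 0.
have wB : `|w / H 0 0| <= delta / 2 / kappa.
  rewrite normrM normfV (gtr0_norm H0) ler_pdivrMr//.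
  have : `|w| <= B * (d' / kappa).
    rewrite /w mxE (le_trans (ler_norm_sum _ _ _))// /B big_distrl/=.
    apply: ler_sum => i _; rewrite normrM ler_wpM2l//.
    by move/forallP: kw => /(_ i); rewrite !mxE.
  move/le_trans; apply; rewrite mulrA.
  have -> : delta / 2 / kappa * H 0 0 = delta * H 0 0 / 2 / kappa by ring.
  by rewrite ler_wpM2r// ltW.
have [s1 s2] := sb 0.
have hd : delta / kappa = delta / 2 / kappa + delta / 2 / kappa by field; rewrite gt_eqF.
have wB' := wB; rewrite ler_norml in wB'; case/andP: wB' => wB1 wB2.
have {}H2 := H2 kappa N (s 0 0 - w / H 0 0) k0 kk2.
have := H2 _ _; rewrite -/X => {}H2.
apply: (@le_trans _ _ (\sum_(j < N | `|j%:R - (s 0 0 - w / H 0 0)| <= delta / 2 / kappa)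
   gaussian (kappa * H 0 0) (s 0 0 - w / H 0 0) j%:R * lgauss (schur H) kappa (@dsubmx _ 1 d 1 s) k)).
  rewrite -big_distrl/= ler_wpM2r ?lgauss_ge0//; apply: H2; lra.
rewrite [leLHS]big_mkcond/=; apply: ler_sum => j _; case: ifP => [jw|_]; last first.
  by case: ifP => // _; exact: lgauss_ge0.
rewrite ifT; first by rewrite lgauss_split// gt_eqF.
apply: (@in_window_col _ _ d).
  have -> : j%:R - s 0 0 = (j%:R - (s 0 0 - w / H 0 0)) - w / H 0 0 by ring.
  by rewrite (le_trans (ler_normB _ _))// hd lerD.
apply/forallP => i; move/forallP: kw => /(_ i) h; exact: le_trans h dk.
Qed.

(** * Grouping type assignments by their counts *)

Lemma cntE (q n : nat) (t : {ffun 'I_n -> 'I_q}) i :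
  cnt t i = (\sum_(u < n) (t u == i))%N.
Proof.
rewrite /cnt -sum1_card [LHS]big_mkcond /=.
by apply: eq_bigr => u _; rewrite unfold_in; case: eqP.
Qed.

Definition fcons (q n : nat) (i : 'I_q) (t : {ffun 'I_n -> 'I_q})
    : {ffun 'I_n.+1 -> 'I_q} :=
  [ffun u => if unlift ord0 u is Some v then t v else i].

Lemma cnt_fcons (q n : nat) (i : 'I_q) (t : {ffun 'I_n -> 'I_q}) j :
  cnt (fcons i t) j = ((i == j) + cnt t j)%N.
Proof.
rewrite !cntE big_ord_recl ffunE unlift_none; congr (_ + _)%N.
by apply: eq_bigr => u _; rewrite ffunE liftK.
Qed.

Lemma sum_fcons (q n : nat) (F : {ffun 'I_n.+1 -> 'I_q} -> nat) :
  (\sum_t F t = \sum_(i < q) \sum_(t : {ffun 'I_n -> 'I_q}) F (fcons i t))%N.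
Proof.
rewrite pair_big/= (reindex (fun p : 'I_q * {ffun 'I_n -> 'I_q} => fcons p.1 p.2))//.
exists (fun t : {ffun 'I_n.+1 -> 'I_q} => (t ord0, [ffun v => t (lift ord0 v)])) => [[i t]|t] _ /=.
  congr (_, _); first by rewrite ffunE unlift_none.
  by apply/ffunP => v; rewrite !ffunE liftK.
apply/ffunP => u; rewrite ffunE.
by case: unliftP => [v|] ->; rewrite ?ffunE.
Qed.

Definition multicard (q n : nat) (k : 'I_q -> nat) : nat :=
  (\sum_(t : {ffun 'I_n -> 'I_q}) [forall i, cnt t i == k i])%N.

(** Colourings with prescribed class sizes are counted by the multinomial
    coefficient: removing the first vertex, of colour [i], is the recursion
    [n! / prod k! = sum_i (n-1)! / prod (k - e_i)!]. *)
Lemma multicardP (q n : nat) (k : 'I_q -> nat) : (\sum_i k i = n)%N ->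
  (multicard n k * \prod_i (k i)`! = n`!)%N.
Proof.
elim: n k => [|n IH] k ks.
  have k0 i : k i = 0%N.
    by move/eqP: ks; rewrite sum_nat_eq0 => /forallP/(_ i)/eqP.
  rewrite big1 => [|i _]; last by rewrite k0.
  rewrite muln1 /multicard (eq_bigr (fun=> 1%N)) => [|t _]; last first.
    apply/eqP; rewrite eqb1; apply/forallP => i.
    by rewrite cntE big_ord0 k0.
  by rewrite sum1_card card_ffun !card_ord expn0.
rewrite /multicard sum_fcons big_distrl/= factS -[X in (X * _)%N]ks big_distrl/=.
apply: eq_bigr => i _; have [ki0|ki] := posnP (k i).
  rewrite ki0 mul0n big1 ?mul0n// => t _.
  apply/eqP; rewrite eqb0; apply/negP => /forallP/(_ i).
  by rewrite cnt_fcons eqxx ki0.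
pose k' j := (k j - (i == j))%N.
have k's : (\sum_j k' j = n)%N.
  have hs : (\sum_(j | j != i) k' j = \sum_(j | j != i) k j)%N.
    by apply: eq_bigr => j ji; rewrite /k' eq_sym (negbTE ji) subn0.
  move: ks; rewrite (bigD1 i)//= [(\sum_j k' j)%N](bigD1 i)//= hs /k' eqxx subn1.
  by case: (k i) ki => // m _ /=; rewrite addSn => -[].
have kE : (\prod_j (k j)`! = k i * \prod_j (k' j)`!)%N.
  rewrite (bigD1 i)//= [in RHS](bigD1 i)//= mulnA /k' eqxx subn1.
  congr (_ * _)%N; first by case: (k i) ki => // m _; rewrite factS.
  by apply: eq_bigr => j ji; rewrite eq_sym (negbTE ji) subn0.
rewrite kE mulnCA -(IH _ k's); congr (_ * (_ * _))%N.
apply: eq_bigr => t _; congr (nat_of_bool _).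
apply: eq_forallb => j; rewrite cnt_fcons /k'.
have [<-|ij] := eqVneq i j; last by rewrite add0n subn0.
by rewrite add1n subn1; case: (k i) ki => // m _; rewrite eqSS.
Qed.

Definition multinom (K : realType) (q n : nat) (k : 'I_q -> nat) : K :=
  n`!%:R / \prod_i (k i)`!%:R.

Lemma multicardE (K : realType) (q n : nat) (k : 'I_q -> nat) :
  (\sum_i k i = n)%N -> (multicard n k)%:R = multinom K n k.
Proof.
move=> /multicardP h; rewrite /multinom -h natrM natr_prod mulfK//.
by apply/prodf_neq0 => i _; rewrite pnatr_eq0 -lt0n fact_gt0.
Qed.

(** The counts of all types, recovered from those of all types but the first. *)
Definition full_cnt (d n : nat) (k : 'cV['I_n.+1]_d) (i : 'I_d.+1) : nat :=
  if unlift ord0 i is Some j then k j ord0 else (n - \sum_j k j ord0)%N.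

Lemma sum_full_cnt (d n : nat) (k : 'cV['I_n.+1]_d) :
  (\sum_j k j ord0 <= n)%N -> (\sum_i full_cnt k i = n)%N.
Proof.
move=> kn; rewrite big_ord_recl.
have -> : (\sum_j full_cnt k (lift ord0 j) = \sum_j k j ord0)%N.
  by apply: eq_bigr => j _; rewrite /full_cnt liftK.
by rewrite /full_cnt unlift_none subnK.
Qed.

Lemma sum_by_cnt (K : realType) (d n : nat) (G : ('I_d.+1 -> nat) -> K) :
  \sum_(t : {ffun 'I_n -> 'I_d.+1}) G (cnt t) =
  \sum_(k : 'cV['I_n.+1]_d | (\sum_j k j ord0 <= n)%N)
    multinom K n (full_cnt k) * G (full_cnt k).
Proof.
have cle (t : {ffun 'I_n -> 'I_d.+1}) i : (cnt t i <= n)%N.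
  by rewrite -[leqRHS](sum_cnt_nat t) (bigD1 i)//= leq_addr.
pose kap (t : {ffun 'I_n -> 'I_d.+1}) : 'cV['I_n.+1]_d :=
  \col_j inord (cnt t (lift ord0 j)).
have csum (t : {ffun 'I_n -> 'I_d.+1}) :
    (cnt t ord0 + \sum_j cnt t (lift ord0 j) = n)%N.
  by rewrite -[RHS](sum_cnt_nat t) big_ord_recl.
have kapE t j : kap t j ord0 = cnt t (lift ord0 j) :> nat.
  by rewrite mxE inordK// ltnS.
have kapn t : (\sum_j kap t j ord0 <= n)%N.
  by rewrite -[leqRHS](csum t) (eq_bigr _ (fun j _ => kapE t j)) leq_addl.
have fkap t : full_cnt (kap t) =1 cnt t.
  move=> i; rewrite /full_cnt; case: unliftP => [j|] ->; first exact: kapE.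
  rewrite (eq_bigr _ (fun j _ => kapE t j)) -[X in (X - _)%N](csum t).
  by rewrite addnK.
rewrite (partition_big kap (fun k => (\sum_j k j ord0 <= n)%N))//=.
apply: eq_bigr => k kn.
rewrite (eq_bigr (fun=> G (full_cnt k))) => [|t /eqP <-]; last first.
  by congr G; apply/funext => i; rewrite fkap.
rewrite sumr_const -mulr_natl; congr (_ * _).
rewrite -(multicardE K (sum_full_cnt kn)); congr (_%:R).
rewrite /multicard -sum1_card big_mkcond/=; apply: eq_bigr => t _.
rewrite -[t \in _]/(kap t == k); case: eqP => [<-|kk].
  by apply/esym/eqP; rewrite eqb1; apply/forallP => i; rewrite fkap.
apply/esym/eqP; rewrite eqb0; apply/negP => /forallP h; apply: kk.
apply/colP => j; apply/val_inj; have /eqP hj := h (lift ord0 j).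
by rewrite /= -[LHS]/(nat_of_ord (kap t j ord0)) kapE hj /full_cnt liftK.
Qed.

(** * One-variable calculus *)

(** Hiding the class keeps instance resolution from choosing the shape of
    the derivative. *)
Definition hasderiv (K : realType) (f : K -> K) (t a : K) : Prop :=
  is_derive t 1 f a.

Lemma isdC (K : realType) (t a : K) : hasderiv (fun=> a) t 0.
Proof. exact: is_derive_cst. Qed.

Lemma isdI (K : realType) (t : K) : hasderiv (fun s => s) t 1.
Proof. exact: is_derive_id. Qed.

Lemma isdD (K : realType) (f g : K -> K) (t a b : K) :
  hasderiv f t a -> hasderiv g t b ->
  hasderiv (fun s => f s + g s) t (a + b).
Proof. by move=> *; exact: is_deriveD. Qed.

Lemma isdB (K : realType) (f g : K -> K) (t a b : K) :
  hasderiv f t a -> hasderiv g t b ->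
  hasderiv (fun s => f s - g s) t (a - b).
Proof. by move=> *; exact: is_deriveB. Qed.

Lemma isdM (K : realType) (f g : K -> K) (t a b : K) :
  hasderiv f t a -> hasderiv g t b ->
  hasderiv (fun s => f s * g s) t (f t * b + g t * a).
Proof. by move=> *; exact: is_deriveM. Qed.

Lemma isdV (K : realType) (f : K -> K) (t a : K) : f t != 0 ->
  hasderiv f t a -> hasderiv (fun s => (f s)^-1) t (- (f t) ^- 2 * a).
Proof. by move=> *; exact: is_deriveV. Qed.

Lemma isdln (K : realType) (f : K -> K) (t a : K) : 0 < f t ->
  hasderiv f t a -> hasderiv (fun s => ln (f s)) t ((f t)^-1 * a).
Proof.
by move=> f0 df; apply: (is_derive1_comp (is_derive1_ln f0) df).
Qed.

Lemma isdsum (K : realType) (q : nat) (f : 'I_q -> K -> K) (t : K) (a : 'I_q -> K) :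
  (forall i, hasderiv (f i) t (a i)) ->
  hasderiv (fun s => \sum_i f i s) t (\sum_i a i).
Proof.
move=> h; rewrite /hasderiv (_ : (fun s => _) = \sum_i f i); first exact: is_derive_sum.
by apply/funext => s; rewrite fct_sumE.
Qed.

Lemma isd_eq (K : realType) (f : K -> K) (t a b : K) :
  hasderiv f t a -> a = b -> hasderiv f t b.
Proof. by move=> + <-. Qed.

Lemma MVT_closed (K : realType) (f df : K -> K) (a b : K) : a < b ->
  (forall t : K, a <= t <= b -> hasderiv f t (df t)) ->
  exists2 c, a < c < b & f b - f a = df c * (b - a).
Proof.
move=> ab fd.
have fd' x : x \in `]a, b[%R -> is_derive x 1 f (df x).
  by rewrite in_itv/= => /andP[ax xb]; apply: fd; rewrite !ltW.
have fc : {within `[a, b], continuous f}.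
  apply: derivable_within_continuous => x; rewrite in_itv/= => xab.
  by have [] := fd x xab.
have [c + ->] := MVT ab fd' fc.
by rewrite in_itv/=; exists c.
Qed.

Lemma taylor2_ge (K : realType) (g g1 g2 : K -> K) (lam : K) :
  (forall t : K, 0 <= t <= 1 -> hasderiv g t (g1 t)) ->
  (forall t : K, 0 <= t <= 1 -> hasderiv g1 t (g2 t)) ->
  (forall t : K, 0 <= t <= 1 -> lam <= g2 t) ->
  g 0 + g1 0 + lam / 2 <= g 1.
Proof.
move=> d1 d2 h2.
have hd (t : K) : 0 <= t <= 1 -> hasderiv (fun s => g s - (g1 0 * s + lam / 2 * (s * s))) t (g1 t - (g1 0 + lam * t)).
  move=> t01; apply: isd_eq.
    apply: isdB; first exact: d1.
    apply: isdD; first by apply: isdM; [exact: isdC|exact: isdI].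
    by apply: isdM; [exact: isdC|apply: isdM; exact: isdI].
  by rewrite /=; field.
have [c /andP[c0 c1]] := MVT_closed ltr01 hd.
have hd2 (t : K) : 0 <= t <= c -> hasderiv g1 t (g2 t).
  by move=> /andP[t0 tc]; apply: d2; rewrite t0 (le_trans tc)// ltW.
have [e /andP[e0 e1]] := MVT_closed c0 hd2.
have : lam <= g2 e by apply: h2; rewrite ltW//= ltW// (lt_trans e1).
move=> le2 eq1 eq2.
have : 0 <= (g2 e - lam) * c by rewrite mulr_ge0 ?subr_ge0// ltW.
lra.
Qed.

Lemma taylor2_le (K : realType) (g g1 g2 : K -> K) (lam : K) :
  (forall t : K, 0 <= t <= 1 -> hasderiv g t (g1 t)) ->
  (forall t : K, 0 <= t <= 1 -> hasderiv g1 t (g2 t)) ->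
  (forall t : K, 0 <= t <= 1 -> g2 t <= lam) ->
  g 1 <= g 0 + g1 0 + lam / 2.
Proof.
move=> d1 d2 h2.
have N (f : K -> K) (t a : K) : hasderiv f t a -> hasderiv (fun s => - f s) t (- a).
  by move=> *; exact: is_deriveN.
have := @taylor2_ge K (fun s => - g s) (fun s => - g1 s) (fun s => - g2 s) (- lam).
move=> /(_ (fun t h => N _ _ _ (d1 t h)) (fun t h => N _ _ _ (d2 t h))) h.
suff : - g 0 + - g1 0 + - lam / 2 <= - g 1 by lra.
by apply: h => t t01; rewrite lerN2 h2.
Qed.

Lemma ln1Dx_bounds (K : realType) (x : K) : 0 <= x ->
  0 <= ln (1 + x) - x + x ^+ 2 / 2 <= x ^+ 3.
Proof.
rewrite le_eqVlt => /predU1P[<-|x0].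
  by rewrite addr0 ln1 subrr !expr0n/= mul0r addr0 lexx.
have fd (t : K) : 0 <= t <= x -> hasderiv (fun s => ln (1 + s) - s + s * s / 2) t ((1 + t)^-1 - 1 + t).
  move=> /andP[t0 tx]; have t1 : 0 < 1 + t by lra.
  apply: isd_eq.
    apply: isdD; last by apply: isdM; [apply: isdM; exact: isdI|exact: isdC].
    apply: isdB; last exact: isdI.
    apply: isdln; first exact: t1.
    by apply: isdD; [exact: isdC|exact: isdI].
  by rewrite /=; field; rewrite gt_eqF.
have [c /andP[c0 cx] /=] := MVT_closed x0 fd.
rewrite addr0 ln1 subrr mulr0 mul0r addr0 !subr0 -expr2 => ->.
have -> : (1 + c)^-1 - 1 + c = c ^+ 2 / (1 + c) by field; rewrite gt_eqF//; lra.
have c1 : 0 <= c ^+ 2 / (1 + c) by rewrite divr_ge0 ?sqr_ge0//; lra.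
have x0' := ltW x0; have c0' := ltW c0.
have h : c ^+ 2 / (1 + c) <= c ^+ 2 by rewrite ler_pdivrMr; [nra|lra].
apply/andP; split; first exact: mulr_ge0.
have -> : x ^+ 3 = x ^+ 2 * x by rewrite [LHS]exprSr.
rewrite ler_wpM2r//; apply: (le_trans h).
by rewrite lerXn2r ?nnegrE// ltW.
Qed.

(** * Multinomial coefficients *)

(** The quantity is a probability: it is one term of the multinomial expansion
    of [(\sum_i k_i / n) ^ n = 1]. *)
Lemma multinom_le1 (K : realType) (q n : nat) (k : 'I_q -> nat) :
  (0 < n)%N -> (\sum_i k i = n)%N ->
  multinom K n k * \prod_i ((k i)%:R / n%:R) ^+ k i <= 1.
Proof.
move=> n0 ks; pose x i : K := (k i)%:R / n%:R.
have x0 i : 0 <= x i by rewrite divr_ge0.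
have x1 : \sum_i x i = 1.
  by rewrite -big_distrl/= -natr_sum ks divff// pnatr_eq0 -lt0n.
have e1 : \prod_(u < n) \sum_i x i = 1 by rewrite big1.
rewrite -[leRHS]e1 bigA_distr_bigA/= -multicardE// /multicard natr_sum big_distrl/=.
apply: ler_sum => t _.
have [/forallP tk|_] := boolP [forall i, cnt t i == k i]; last first.
  by rewrite mul0r prodr_ge0.
have -> : \prod_(u < n) x (t u) = \prod_i x i ^+ k i.
  by rewrite (prod_cnt t x); apply: eq_bigr => i _; rewrite (eqP (tk i)).
by rewrite mul1r.
Qed.

Definition stirling_rem (K : realType) (n : nat) : K :=
  ln n`!%:R - ((n%:R + 2^-1) * ln n%:R - n%:R).

(** Summable increments, by the expansion of [ln (1 + 1 / n)] to second order. *)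
Lemma stirling_step (K : realType) (n : nat) : (0 < n)%N ->
  `|stirling_rem K n.+1 - stirling_rem K n| <= 2 * n%:R^-1 ^+ 2.
Proof.
move=> n0; have np : 0 < n%:R :> K by rewrite ltr0n.
have ip : 0 < n%:R^-1 :> K by rewrite invr_gt0.
have ln1 : ln n.+1%:R = ln n%:R + ln (1 + n%:R^-1) :> K.
  have p1 : 0 < 1 + n%:R^-1 :> K by rewrite addr_gt0.
  rewrite -lnM ?posrE//.
  by congr ln; rewrite mulrDr mulr1 divff ?gt_eqF// natr1.
have /andP[h0 h1] := ln1Dx_bounds (ltW ip).
have -> : stirling_rem K n.+1 - stirling_rem K n
    = 1 - (n%:R + 2^-1) * ln (1 + n%:R^-1).
  rewrite /stirling_rem factS natrM lnM ?posrE ?ltr0n ?fact_gt0// ln1 -natr1; ring.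
move: (ln _) h0 h1 => L h0 h1.
have n1 : 1 <= n%:R :> K by rewrite ler1n.
move: ip h0 h1; set x := n%:R^-1 => ip h0 h1.
have xn : x * n%:R = 1 by rewrite mulVf ?gt_eqF.
have x1 : x <= 1 by rewrite invf_le1.
clearbody x; move: np n1 xn; move: (n%:R) => y np n1 xn.
pose E := L - x + x ^+ 2 / 2; rewrite -/E in h0 h1.
have -> : L = x - x ^+ 2 / 2 + E by rewrite /E; ring.
clearbody E; have -> : 1 - (y + 2^-1) * (x - x ^+ 2 / 2 + E)
    = x ^+ 2 / 4 - y * E - E / 2.
  transitivity (1 - (x * y) + (x * y) * x / 2 - x / 2 + x ^+ 2 / 4 - y * E - E / 2); first by field.
  by rewrite xn; field.
have e1 : y * E <= x ^+ 2.
  apply: (@le_trans _ _ (y * x ^+ 3)); first by rewrite ler_wpM2l// ltW.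
  by rewrite exprS mulrA (mulrC y) xn mul1r.
have e2 : 0 <= y * E by rewrite mulr_ge0 ?(ltW np).
have x2 : 0 <= x ^+ 2 := sqr_ge0 x.
have e3 : x ^+ 3 <= x ^+ 2 by rewrite exprS ler_piMl.
rewrite ler_norml; apply/andP; split; lra.
Qed.

(** A telescoping majorant of [stirling_step] encloses the sequence between two
    monotone ones. The value of the limit is not computed: [graph_const] replaces
    it. *)
Lemma stirling_limit (K : realType) : exists sigma : K,
  forall eps : K, 0 < eps -> exists N : nat, forall n, (N <= n)%N ->
    `|stirling_rem K n - sigma| <= eps.
Proof.
pose w n : K := stirling_rem K n.+1 - 4 / n.+1%:R.
pose v n : K := stirling_rem K n.+1 + 4 / n.+1%:R.
have step n : 2 * n.+1%:R^-1 ^+ 2 <= 4 / n.+1%:R - 4 / n.+2%:R :> K.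
  have n1 : 0 < n.+1%:R :> K by rewrite ltr0n.
  have n2 : 0 < n.+2%:R :> K by rewrite ltr0n.
  have -> : 4 / n.+1%:R - 4 / n.+2%:R = 4 * (n.+1%:R^-1 * n.+2%:R^-1) :> K.
    move: n1 n2; rewrite -[n.+2%:R]natr1; move: n.+1%:R => y n1 n2.
    by field; rewrite !gt_eqF.
  have h : n.+1%:R^-1 <= 2 * n.+2%:R^-1 :> K.
    have -> : 2 * n.+2%:R^-1 = (n.+2%:R / 2)^-1 :> K by rewrite invf_div.
    rewrite lef_pV2 ?posrE ?divr_gt0// ler_pdivrMr//.
    by rewrite -natrM ler_nat muln2 -addnn !addSn addnS !ltnS leq_addr.
  have ip : 0 <= n.+1%:R^-1 :> K by rewrite invr_ge0 ltW.
  move: (ler_wpM2l ip h); move: (n.+1%:R^-1) (n.+2%:R^-1) => x y; lra.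
have nd : nondecreasing_seq w.
  apply/nondecreasing_seqP => n; have := stirling_step K (ltn0Sn n); have := step n.
  rewrite /w; move: (n.+1%:R^-1) (n.+2%:R^-1) (stirling_rem _ _) (stirling_rem _ _).
  by move=> a1 a2 b1 b2 h; rewrite ler_norml => /andP[? ?]; lra.
have ni : nonincreasing_seq v.
  apply/nonincreasing_seqP => n; have := stirling_step K (ltn0Sn n); have := step n.
  rewrite /v; move: (n.+1%:R^-1) (n.+2%:R^-1) (stirling_rem _ _) (stirling_rem _ _).
  by move=> a1 a2 b1 b2 h; rewrite ler_norml => /andP[? ?]; lra.
have wv n : w n <= v n by rewrite /w /v lerD2l; apply: (@le_trans _ _ 0); rewrite ?oppr_le0.
have wub : has_ubound (range w).
  exists (v 0%N) => _ [n _ <-]; apply: le_trans (wv n) _; exact: ni.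
have wc := nondecreasing_is_cvgn nd wub.
exists (limn w) => eps e0.
have e2 : 0 < eps / 2 by lra.
have /cvgrPdist_le /(_ _ e2) [N _ HN] := wc.
exists (maxn N (Num.truncn (8 / eps)).+1).+1 => -[//|n]; rewrite ltnS geq_max => /andP[Nn en].
have := HN n Nn; rewrite /= distrC -[w n]/(stirling_rem K n.+1 - 4 / n.+1%:R).
have h : 4 / n.+1%:R <= eps / 2.
  rewrite ler_pdivrMr// mulrC -ler_pdivrMr//.
  have -> : 4 / (eps / 2) = 8 / eps by field; rewrite gt_eqF.
  apply: ltW; apply: lt_le_trans (truncnS_gt _) _; rewrite ler_nat.
  exact: leq_trans en (leqnSn n).
have h0 : 0 <= 4 / n.+1%:R :> K by [].
move: (4 / n.+1%:R) (stirling_rem K n.+1) (limn w) h h0 => z y l h h0.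
rewrite !ler_norml => /andP[? ?]; apply/andP; split; lra.
Qed.

Lemma ln_prod (K : realType) (q : nat) (F : 'I_q -> K) :
  (forall i, 0 < F i) -> ln (\prod_i F i) = \sum_i ln (F i).
Proof.
move=> F0; have : 0 < \prod_i F i /\ ln (\prod_i F i) = \sum_i ln (F i).
  elim/big_ind2: _ => [|x y u v [? <-] [? <-]|i _]; first by rewrite ln1.
    by rewrite mulr_gt0// lnM.
  by [].
by case.
Qed.

(** The terms [n ln n] and [n] cancel as the counts add up to [n]; of the
    constants, [d] copies remain. *)
Lemma multinom_local (K : realType) (d : nat) : exists sigma : K,
  forall eps delta : K, 0 < eps -> 0 < delta -> exists N : nat,
  forall n (k : 'I_d.+1 -> nat), (N <= n)%N -> (0 < n)%N -> (\sum_i k i = n)%N ->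
    (forall i, delta <= (k i)%:R / n%:R) ->
    `|ln (multinom K n k) - (- (d%:R * sigma) - d%:R / 2 * ln n%:R
       - n%:R * \sum_i (k i)%:R / n%:R * ln ((k i)%:R / n%:R)
       - 2^-1 * \sum_i ln ((k i)%:R / n%:R))| <= eps.
Proof.
have [sigma Hs] := stirling_limit K; exists sigma => eps delta e0 d0.
have e1 : 0 < eps / (d%:R + 2) by rewrite divr_gt0// ltr_wpDl.
have [N HN] := Hs _ e1.
exists (maxn N (Num.truncn (N%:R / delta)).+1) => n k; rewrite geq_max => /andP[Nn dn] n0 ks kd.
have np : 0 < n%:R :> K by rewrite ltr0n.
have kN i : (N <= k i)%N.
  rewrite -(ler_nat K); have := kd i; rewrite ler_pdivlMr// => /(le_trans _); apply.
  rewrite mulrC -ler_pdivrMr//.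
  by apply: ltW; apply: lt_le_trans (truncnS_gt _) _; rewrite ler_nat.
have xp i : 0 < (k i)%:R / n%:R :> K := lt_le_trans d0 (kd i).
have kp i : 0 < (k i)%:R :> K.
  by have := mulr_gt0 (xp i) np; rewrite mulfVK// gt_eqF.
have lk i : ln (k i)%:R = ln n%:R + ln ((k i)%:R / n%:R) :> K.
  by rewrite -lnM ?posrE// mulrCA divff ?mulr1// gt_eqF.
pose u m : K := stirling_rem K m.
have lf m : ln m`!%:R = u m + ((m%:R + 2^-1) * ln m%:R - m%:R).
  by rewrite /u /stirling_rem addrNK.
have {}HN m : (N <= m)%N -> `|u m - sigma| <= eps / (d%:R + 2) := HN m.
clearbody u.
have lM : ln (multinom K n k) = ln n`!%:R - \sum_i ln (k i)`!%:R.
  have kf i : 0 < (k i)`!%:R :> K by rewrite ltr0n fact_gt0.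
  have pp : 0 < \prod_i (k i)`!%:R :> K by apply: prodr_gt0.
  rewrite /multinom lnM ?posrE ?invr_gt0 ?ltr0n ?fact_gt0//.
  by rewrite lnV ?posrE// ln_prod.
have sk : \sum_i (k i)%:R = n%:R :> K by rewrite -natr_sum ks.
have sx : \sum_i (k i)%:R * ln ((k i)%:R / n%:R)
    = n%:R * \sum_i (k i)%:R / n%:R * ln ((k i)%:R / n%:R) :> K.
  rewrite big_distrr; apply: eq_bigr => i _ /=.
  by rewrite mulrA mulrCA divff ?mulr1// gt_eqF.
have sl : \sum_i ln (k i)`!%:R = \sum_i u (k i) + n%:R * ln n%:R
    + d.+1%:R / 2 * ln n%:R
    + n%:R * \sum_i (k i)%:R / n%:R * ln ((k i)%:R / n%:R)
    + 2^-1 * \sum_i ln ((k i)%:R / n%:R) - n%:R :> K.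
  rewrite -sx.
  transitivity (\sum_i (u (k i) + ((k i)%:R * ln n%:R + (2^-1 * ln n%:R
    + ((k i)%:R * ln ((k i)%:R / n%:R) + (2^-1 * ln ((k i)%:R / n%:R) - (k i)%:R)))))).
    apply: eq_bigr => i _; rewrite lf lk.
    by move: (u (k i)) ((k i)%:R) (ln n%:R) (ln ((k i)%:R / n%:R)) => *; ring.
  rewrite !big_split/= -!big_distrr/= -!big_distrl/= sumrN sk.
  rewrite sumr_const card_ord -[ln n%:R *+ _]mulr_natl.
  by field.
rewrite lM sl lf; set A := \sum_i _ * _; set B := \sum_i ln _.
have -> : u n + ((n%:R + 2^-1) * ln n%:R - n%:R) -
   (\sum_i u (k i) + n%:R * ln n%:R + d.+1%:R / 2 * ln n%:R + n%:R * A + 2^-1 * B - n%:R) -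
   (- (d%:R * sigma) - d%:R / 2 * ln n%:R - n%:R * A - 2^-1 * B)
   = (u n - sigma) - \sum_i (u (k i) - sigma).
  by rewrite sumrB sumr_const card_ord -[sigma *+ _]mulr_natl -natr1; field.
apply: le_trans (ler_normB _ _) _.
have h1 := HN _ Nn.
have h2 : `|\sum_i (u (k i) - sigma)| <= d.+1%:R * (eps / (d%:R + 2)).
  apply: le_trans (ler_norm_sum _ _ _) _.
  apply: (@le_trans _ _ (\sum_(i < d.+1) (eps / (d%:R + 2)))).
    by apply: ler_sum => i _; exact: HN.
  by rewrite sumr_const card_ord mulr_natl.
have dp : 0 < d%:R + 2 :> K by rewrite ltr_wpDl.
have -> : eps = eps / (d%:R + 2) + d.+1%:R * (eps / (d%:R + 2)).
  by rewrite -natr1; field; rewrite gt_eqF.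
exact: lerD.
Qed.

(** * The Hessian as a quadratic form on tangent vectors *)

Lemma sqr_normr (K : realType) (x : K) : `|x| ^+ 2 = x ^+ 2.
Proof. by rewrite real_normK ?num_real. Qed.

Definition bil (K : realType) (q : nat) (R : 'M[K]_q) (x y : 'cV[K]_q) : K :=
  (x^T *m R *m y) 0 0.

Lemma bilE (K : realType) (q : nat) (R : 'M[K]_q) (x y : 'cV[K]_q) :
  bil R x y = \sum_i \sum_j x i 0 * R i j * y j 0.
Proof.
rewrite /bil mxE exchange_big/=; apply: eq_bigr => j _.
by rewrite mxE big_distrl/=; apply: eq_bigr => i _; rewrite mxE.
Qed.

Lemma bilC (K : realType) (q : nat) (R : 'M[K]_q) (x y : 'cV[K]_q) :
  R^T = R -> bil R x y = bil R y x.
Proof.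
move=> Rs; rewrite !bilE exchange_big/=; apply: eq_bigr => i _; apply: eq_bigr => j _.
by rewrite -[in LHS]Rs mxE; ring.
Qed.

Lemma bilDr (K : realType) (q : nat) (R : 'M[K]_q) (x y z : 'cV[K]_q) (t : K) :
  bil R x (y + t *: z) = bil R x y + t * bil R x z.
Proof. by rewrite /bil mulmxDr -scalemxAr !mxE. Qed.

Lemma qform_path (K : realType) (q : nat) (R : 'M[K]_q) (x v : 'cV[K]_q) (t : K) :
  R^T = R ->
  qform R (x + t *: v) = qform R x + t * (2 * bil R v x) + t * t * qform R v.
Proof.
move=> Rs; rewrite -[LHS]/(bil R _ _) bilDr (bilC _ _ Rs) bilDr.
rewrite (bilC (_ + _) v Rs) bilDr -[qform R x]/(bil R x x) -[qform R v]/(bil R v v).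
by rewrite (bilC x v Rs); ring.
Qed.

Definition hess_mx (K : realType) (q : nat) (R : 'M[K]_q) (c : K) (x : 'cV[K]_q)
    : 'M[K]_q :=
  invmx (diag_mx x^T)
    + (2 * c / qform R x) *:
        ((2 / qform R x) *: (R *m x *m x^T *m R) - R).

Lemma invmx_diag (K : realType) (q : nat) (x : 'cV[K]_q) :
  (forall i, 0 < x i 0) -> invmx (diag_mx x^T) = diag_mx (\row_i (x i 0)^-1).
Proof.
move=> x0; have mm : diag_mx (\row_i (x i 0)^-1) *m diag_mx x^T = 1%:M.
  apply/matrixP => i j; rewrite mul_diag_mx !mxE.
  by case: (i == j); rewrite ?mulr1n ?mulr0n ?mulr0// mulVf ?gt_eqF.
have u : diag_mx x^T \in unitmx by case: (mulmx1_unit mm).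
by rewrite -[LHS]mul1mx -mm mulmxK.
Qed.

(** The second derivative of [Phi_c] at [x] in the direction [v]. *)
Definition hess_form (K : realType) (q : nat) (R : 'M[K]_q) (c : K)
    (x v : 'cV[K]_q) : K :=
  \sum_i v i 0 ^+ 2 / x i 0
  + 2 * c / qform R x * (2 / qform R x * bil R v x ^+ 2 - qform R v).

Lemma qformD (K : realType) (q : nat) (A B : 'M[K]_q) (x : 'cV[K]_q) :
  qform (A + B) x = qform A x + qform B x.
Proof. by rewrite /qform mulmxDr mulmxDl mxE. Qed.

Lemma qformZ (K : realType) (q : nat) (a : K) (A : 'M[K]_q) (x : 'cV[K]_q) :
  qform (a *: A) x = a * qform A x.
Proof. by rewrite /qform -scalemxAr -scalemxAl mxE. Qed.

Lemma qformN (K : realType) (q : nat) (A : 'M[K]_q) (x : 'cV[K]_q) :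
  qform (- A) x = - qform A x.
Proof. by rewrite -scaleN1r qformZ mulN1r. Qed.

Lemma qform_congr (K : realType) (q d : nat) (A : 'M[K]_q) (F : 'M[K]_(q, d)) (y : 'cV[K]_d) :
  qform (F^T *m A *m F) y = qform A (F *m y).
Proof. by rewrite /qform trmx_mul !mulmxA. Qed.

Lemma qform_hess_mx (K : realType) (q : nat) (R : 'M[K]_q) (c : K) (x v : 'cV[K]_q) :
  R^T = R -> (forall i, 0 < x i 0) ->
  qform (hess_mx R c x) v = hess_form R c x v.
Proof.
move=> Rs x0; rewrite /hess_mx !(qformD, qformZ, qformN) /hess_form.
congr (_ + _ * (_ * _ - _)).
  rewrite invmx_diag// qformE; apply: eq_bigr => i _.
  rewrite (bigD1 i)//= big1 ?addr0 => [|j ji].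
    by rewrite !mxE eqxx mulr1n expr2.
  by rewrite !mxE eq_sym (negbTE ji) mulr0n mulr0.
rewrite /qform; have -> : v^T *m (R *m x *m x^T *m R) *m v
    = (v^T *m R *m x) *m (x^T *m R *m v) by rewrite !mulmxA.
by rewrite mx11_mul -/(bil R v x) -/(bil R x v) (bilC x v Rs) expr2.
Qed.

Lemma hess_mx_sym (K : realType) (q : nat) (R : 'M[K]_q) (c : K) (x : 'cV[K]_q) :
  R^T = R -> (forall i, 0 < x i 0) -> (hess_mx R c x)^T = hess_mx R c x.
Proof.
move=> Rs x0; rewrite /hess_mx invmx_diag// raddfD/= linearZ/= raddfB/= linearZ/=.
rewrite tr_diag_mx Rs; congr (_ + _ *: (_ *: _ - _)).
by rewrite !trmx_mul trmxK Rs !mulmxA.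
Qed.

(** The frame of tangent vectors with the last [d] coordinates as parameters. *)
Definition frame0 (K : realType) (d : nat) : 'M[K]_(d.+1, d) :=
  \matrix_(i, j) if unlift ord0 i is Some k then (k == j)%:R else -1.

Lemma mul_frame0 (K : realType) (d n : nat) (V : 'M[K]_(d.+1, n)) :
  (const_mx 1 : 'rV[K]_d.+1) *m V = 0 -> V = frame0 K d *m row' ord0 V.
Proof.
move=> V0; apply/matrixP => i j; rewrite mxE.
case: (unliftP ord0 i) => [k|] ->.
  rewrite (bigD1 k)//= big1 ?addr0 => [|l lk].
    by rewrite !mxE liftK eqxx mul1r.
  by rewrite !mxE liftK eq_sym (negbTE lk) mul0r.
move/matrixP: V0 => /(_ 0 j); rewrite !mxE.
under eq_bigr do rewrite mxE mul1r.
rewrite big_ord_recl => /eqP; rewrite addr_eq0 => /eqP ->.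
rewrite -sumrN; apply: eq_bigr => k _.
by rewrite !mxE unlift_none mulN1r.
Qed.

Lemma const_frame0 (K : realType) (d : nat) :
  (const_mx 1 : 'rV[K]_d.+1) *m frame0 K d = 0.
Proof.
apply/matrixP => i j; rewrite !mxE big_ord_recl !mxE unlift_none mul1r.
rewrite (bigD1 j)//= big1 ?addr0 => [|k kj].
  by rewrite !mxE liftK eqxx mul1r addNr.
by rewrite !mxE liftK (negbTE kj) mulr0.
Qed.

Lemma row'_frame0 (K : realType) (d : nat) : row' ord0 (frame0 K d) = 1%:M.
Proof. by apply/matrixP => i j; rewrite !mxE liftK. Qed.

Lemma const_mul (K : realType) (q : nat) (v : 'cV[K]_q) :
  ((const_mx 1 : 'rV[K]_q) *m v = 0) <-> (\sum_i v i 0 = 0).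
Proof.
split=> [/matrixP/(_ 0 0)|h].
  by rewrite !mxE => h; rewrite -[RHS]h; apply: eq_bigr => i _; rewrite !mxE mul1r.
apply/matrixP => i j; rewrite !ord1 !mxE -[RHS]h.
by apply: eq_bigr => k _; rewrite !mxE mul1r.
Qed.

(** The Hessian in the coordinates of [frame0]; every other admissible frame
    yields the same determinant. *)
Definition hess0 (K : realType) (d : nat) (R : 'M[K]_d.+1) (c : K) (x : 'cV[K]_d.+1) : 'M[K]_d :=
  (frame0 K d)^T *m hess_mx R c x *m frame0 K d.

(** All admissible tangent frames differ from the standard one by an
    invertible factor of determinant [1] or [-1]. *)
Lemma frame_factor (K : realType) (d : nat) (E : 'M[K]_(d.+1, d)) :
  @tangent_frame K d.+1 E ->
  exists2 B : 'M[K]_d, `|\det B| = 1 & E = frame0 K d *m B.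
Proof.
move=> [_ E0 Ed]; exists (row' ord0 E); first exact: (Ed ord0).
exact: mul_frame0.
Qed.

Lemma det_hess_frame (K : realType) (d : nat) (E : 'M[K]_(d.+1, d)) (R : 'M[K]_d.+1) (c : K) (x : 'cV[K]_d.+1) :
  @tangent_frame K d.+1 E ->
  \det (@hess_Phi K d.+1 E R c x) = \det (hess0 R c x).
Proof.
move=> /frame_factor[B dB ->]; rewrite /hess_Phi -/(hess_mx R c x) /hess0.
rewrite trmx_mul -!mulmxA det_mulmx det_tr !mulmxA det_mulmx mulrCA.
by rewrite -expr2 -sqr_normr dB expr1n mulr1.
Qed.

Lemma hess0_form (K : realType) (d : nat) (R : 'M[K]_d.+1) (c : K) (x v : 'cV[K]_d.+1) :
  R^T = R -> (forall i, 0 < x i 0) -> \sum_i v i 0 = 0 ->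
  qform (hess0 R c x) (row' ord0 v) = hess_form R c x v.
Proof.
move=> Rs x0 /const_mul v0; rewrite /hess0 qform_congr -mul_frame0//.
exact: qform_hess_mx.
Qed.

Lemma hess0_sym (K : realType) (d : nat) (R : 'M[K]_d.+1) (c : K) (x : 'cV[K]_d.+1) :
  R^T = R -> (forall i, 0 < x i 0) -> (hess0 R c x)^T = hess0 R c x.
Proof.
by move=> Rs x0; rewrite /hess0 !trmx_mul trmxK hess_mx_sym// !mulmxA.
Qed.

(** A null vector of a semidefinite form is orthogonal to every vector, hence in
    the kernel of the matrix. *)
Lemma psd_det_posdef (K : realType) (d : nat) (H : 'M[K]_d) :
  H^T = H -> (forall y, 0 <= qform H y) -> \det H != 0 -> posdef H.
Proof.
move=> Hs Hp Hd; split=> // y y0; rewrite lt_neqAle Hp andbT eq_sym.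
apply/negP => /eqP Hy; move/negP: y0; apply.
have bz z : bil H z y = 0.
  set w := bil H z y; set Q := qform H z.
  have path t : 0 <= t * (2 * w) + t * t * Q.
    by have := Hp (y + t *: z); rewrite qform_path// Hy add0r.
  have Q0 : 0 <= Q := Hp z.
  have Q1 : 0 < Q + 1 by lra.
  (* This minimises [path] up to the shift by [1], which avoids dividing by [0]. *)
  have := path (- w / (Q + 1)).
  have -> : - w / (Q + 1) * (2 * w) + - w / (Q + 1) * (- w / (Q + 1)) * Q
     = - ((Q + 2) * (w / (Q + 1)) ^+ 2) by field; rewrite gt_eqF.
  rewrite oppr_ge0 pmulr_rle0; last lra.
  move=> w2; have := sqr_ge0 (w / (Q + 1)) => w3.
  have /eqP : (w / (Q + 1)) ^+ 2 = 0 by apply/eqP; rewrite eq_le w2.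
  by rewrite sqrf_eq0 mulf_eq0 invr_eq0 (gt_eqF Q1) orbF => /eqP.
have Hy0 : H *m y = 0.
  apply/colP => i; rewrite [RHS]mxE; have := bz (delta_mx i 0).
  by rewrite /bil trmx_delta -rowE -row_mul mxE.
have Hu : H \in unitmx by rewrite unitmxE unitfE.
by rewrite -(mulKmx Hu y) Hy0 mulmx0.
Qed.

(** Compactness of the sphere is avoided: completing the square reduces the
    dimension, and the constant is explicit. *)
Lemma posdef_coercive (K : realType) (d : nat) (H : 'M[K]_d) : posdef H ->
  exists2 lam : K, 0 < lam & forall y : 'cV[K]_d, lam * \sum_k y k 0 ^+ 2 <= qform H y.
Proof.
elim: d H => [|d IH] H Hp.
  by exists 1 => // y; rewrite qformE !big_ord0 mulr0.
have H0 : 0 < H 0 0 := posdef_diag0 (H := H) Hp.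
have [Hs _] := Hp.
have [l l0 Hl] := IH _ (posdef_schur (H := H) Hp).
pose b := @ursubmx _ 1 d 1 d H.
pose B := (\sum_i `|b 0 i|) ^+ 2.
have B0 : 0 <= B by rewrite sqr_ge0.
pose a := H 0 0.
pose C := 2 / a + (2 * B / a ^+ 2 + 1) / l.
have a0 : 0 < a := H0.
have c1 : 0 < 2 / a by rewrite divr_gt0.
have G0 : 0 <= 2 * B / a ^+ 2 + 1.
  by apply: addr_ge0 => //; apply: divr_ge0; [exact: mulr_ge0|exact: sqr_ge0].
have c2 : 0 <= (2 * B / a ^+ 2 + 1) / l by apply: divr_ge0 G0 (ltW l0).
have C0 : 0 < C by exact: ltr_wpDr c2 c1.
exists C^-1; first by rewrite invr_gt0.
move=> y; rewrite -(@vsubmxK _ 1 d 1 y).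
set v := dsubmx _; have -> : @usubmx _ 1 d 1 y = const_mx (y ord0 0).
  apply/matrixP => i j; rewrite !mxE !ord1; congr (y _ _); exact/val_inj.
set t := y ord0 0.
rewrite (qform_schur _ _ Hs) ?gt_eqF// -/b; set w := (b *m v) 0 0.
have -> : \sum_k (@col_mx _ 1 d 1 (const_mx t) v) k 0 ^+ 2
    = t ^+ 2 + \sum_k v k 0 ^+ 2.
  rewrite (@big_split_ord _ _ _ 1 d) big_ord1 col_mxEu mxE; congr (_ + _).
  by apply: eq_bigr => k _; rewrite col_mxEd.
have Hv := Hl v; set V := \sum_k v k 0 ^+ 2 in Hv *.
have V0 : 0 <= V by apply: sumr_ge0 => k _; exact: sqr_ge0.
have wB : w ^+ 2 <= B * V.
  have vV k : `|v k 0| <= Num.sqrt V.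
    rewrite -sqrtr_sqr ler_wsqrtr// /V (bigD1 k)//= lerDl.
    by apply: sumr_ge0 => l' _; exact: sqr_ge0.
  have wn : `|w| <= (\sum_i `|b 0 i|) * Num.sqrt V.
    rewrite /w mxE (le_trans (ler_norm_sum _ _ _))// big_distrl/=.
    by apply: ler_sum => i _; rewrite normrM ler_wpM2l.
  rewrite -sqr_normr /B -[V](sqr_sqrtr V0) -exprMn lerXn2r ?nnegrE//.
  exact: le_trans wn.
rewrite -/a mulrC ler_pdivrMr//.
set S := qform _ v in Hv *.
have S0 : 0 <= S by rewrite (le_trans _ Hv)// mulr_ge0// ltW.
have VS : V <= S / l by rewrite ler_pdivlMr// mulrC.
have e1 : t ^+ 2 <= 2 * (t + w / a) ^+ 2 + 2 * (w / a) ^+ 2.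
  by have := sqr_ge0 (t + 2 * (w / a)); nra.
have e2 : (w / a) ^+ 2 <= B / a ^+ 2 * V.
  by rewrite expr_div_n [leRHS]mulrAC ler_wpM2r// invr_ge0 exprn_ge0// ltW.
have e3 := ler_wpM2l G0 VS.
have e4 : 0 <= a * (t + w / a) ^+ 2 * ((2 * B / a ^+ 2 + 1) / l).
  by apply: mulr_ge0 c2; apply: mulr_ge0 (ltW a0) (sqr_ge0 _).
have e5 : 0 <= S * (2 / a) by rewrite mulr_ge0// divr_ge0// ltW.
have e6 : a * (t + w / a) ^+ 2 * (2 / a) = 2 * (t + w / a) ^+ 2.
  by field; rewrite gt_eqF.
rewrite /C mulrDl !mulrDr e6.
have e7 : (2 * B / a ^+ 2 + 1) * (S / l) = S * ((2 * B / a ^+ 2 + 1) / l) by ring.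
rewrite e7 in e3; clear -e1 e2 e3 e4 e5; lra.
Qed.

(** * Derivatives along a line *)

Definition dPhi (K : realType) (q : nat) (R : 'M[K]_q) (r : 'cV[K]_q) (c : K)
    (x v : 'cV[K]_q) : K :=
  \sum_i v i 0 * (ln (x i 0) - ln (r i 0) + 1) - c * (2 * bil R v x / qform R x).

Lemma Phi_path_deriv (K : realType) (q : nat) (R : 'M[K]_q) (r : 'cV[K]_q)
    (c : K) (x v : 'cV[K]_q) (t : K) : R^T = R ->
  (forall i, 0 < (x + t *: v) i 0) -> 0 < qform R (x + t *: v) ->
  hasderiv (fun s => Phi R r c (x + s *: v)) t (dPhi R r c (x + t *: v) v).
Proof.
move=> Rs x0 Q0; rewrite (_ : (fun s => _) = (fun s =>
   \sum_i (x i 0 + s * v i 0) * (ln (x i 0 + s * v i 0) - ln (r i 0))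
   - c * ln (qform R x + s * (2 * bil R v x) + s * s * qform R v))); last first.
  apply/funext => s; rewrite /Phi qform_path//; congr (_ - _).
  by apply: eq_bigr => i _; rewrite !mxE.
have x0' i : 0 < x i 0 + t * v i 0 by have := x0 i; rewrite !mxE.
rewrite qform_path// in Q0.
have aff (a b : K) : hasderiv (fun s => a + s * b) t (0 + (t * 0 + b * 1)).
  by apply: isdD; [exact: isdC|apply: isdM; [exact: isdI|exact: isdC]].
have affln (a b : K) : 0 < a + t * b ->
    hasderiv (fun s => ln (a + s * b)) t ((a + t * b)^-1 * (0 + (t * 0 + b * 1))).
  by move=> ab; apply: isdln => //; exact: aff.
apply: isd_eq.
  apply: isdB.
    apply: isdsum => i; apply: isdM; first exact: aff.
    by apply: isdB; [exact: affln|exact: isdC].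
  apply: isdM; first exact: isdC.
  apply: isdln; first exact: Q0.
  apply: isdD; first exact: aff.
  by apply: isdM; [apply: isdM; exact: isdI|exact: isdC].
rewrite /= /dPhi bilDr qform_path// -[qform R v]/(bil R v v); congr (_ - _).
  by apply: eq_bigr => i _; rewrite !mxE; field; rewrite gt_eqF.
rewrite -[bil R v v]/(qform R v).
move: (qform R x + _ + _) Q0 => Q Q0.
by field; rewrite gt_eqF.
Qed.

Lemma dPhi_path_deriv (K : realType) (q : nat) (R : 'M[K]_q) (r : 'cV[K]_q)
    (c : K) (x v : 'cV[K]_q) (t : K) : R^T = R ->
  (forall i, 0 < (x + t *: v) i 0) -> 0 < qform R (x + t *: v) ->
  hasderiv (fun s => dPhi R r c (x + s *: v) v) t (hess_form R c (x + t *: v) v).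
Proof.
move=> Rs x0 Q0; rewrite (_ : (fun s => _) = (fun s =>
   \sum_i v i 0 * (ln (x i 0 + s * v i 0) - ln (r i 0) + 1)
   - c * (2 * (bil R v x + s * qform R v)
       * (qform R x + s * (2 * bil R v x) + s * s * qform R v)^-1))); last first.
  apply/funext => s; rewrite /dPhi qform_path// bilDr; congr (_ - _).
  by apply: eq_bigr => i _; rewrite !mxE.
have x0' i : 0 < x i 0 + t * v i 0 by have := x0 i; rewrite !mxE.
rewrite qform_path// in Q0.
have aff (a b : K) : hasderiv (fun s => a + s * b) t (0 + (t * 0 + b * 1)).
  by apply: isdD; [exact: isdC|apply: isdM; [exact: isdI|exact: isdC]].
have affln (a b : K) : 0 < a + t * b ->
    hasderiv (fun s => ln (a + s * b)) t ((a + t * b)^-1 * (0 + (t * 0 + b * 1))).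
  by move=> ab; apply: isdln => //; exact: aff.
apply: isd_eq.
  apply: isdB.
    apply: isdsum => i; apply: isdM; first exact: isdC.
    apply: isdD; last exact: isdC.
    by apply: isdB; [exact: affln|exact: isdC].
  apply: isdM; first exact: isdC.
  apply: isdM; first by apply: isdM; [exact: isdC|exact: aff].
  apply: isdV; first by rewrite gt_eqF.
  apply: isdD; first exact: aff.
  by apply: isdM; [apply: isdM; exact: isdI|exact: isdC].
rewrite /= /hess_form bilDr qform_path// -[bil R v v]/(qform R v).
set S := \sum_i _; set S' := \sum_i _.
have -> : S = S' by apply: eq_bigr => i _; rewrite !mxE; field; rewrite gt_eqF.
move: S' => S'; move: Q0; set Q := qform R x + _ + _ => Q0.
clearbody Q.
by field; rewrite gt_eqF.
Qed.

(** * Continuity in the ratio and the point *)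

(** Continuity in [c] and [x] jointly, so that all bounds near a critical point
    are uniform in the ratio. *)
Definition cont2 (K : realType) (q : nat) (F : K * 'cV[K]_q -> K)
    (p : K * 'cV[K]_q) : Prop := {for p, continuous F}.

Lemma cont2_cst (K : realType) (q : nat) (a : K) (p : K * 'cV[K]_q) :
  cont2 (fun=> a) p.
Proof. exact: cvg_cst. Qed.

Lemma cont2_fst (K : realType) (q : nat) (p : K * 'cV[K]_q) :
  cont2 (fun p => p.1) p.
Proof. exact: cvg_fst. Qed.

Lemma cont2_coord (K : realType) (q : nat) i (p : K * 'cV[K]_q) :
  cont2 (fun p => p.2 i 0) p.
Proof.
apply: (@cvg_comp _ _ _ snd (fun M : 'cV[K]_q => M i 0)); first exact: cvg_snd.
exact: coord_continuous.
Qed.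

Lemma cont2D (K : realType) (q : nat) F G (p : K * 'cV[K]_q) :
  cont2 F p -> cont2 G p -> cont2 (fun p => F p + G p) p.
Proof. by move=> hF hG; apply: cvgD. Qed.

Lemma cont2N (K : realType) (q : nat) F (p : K * 'cV[K]_q) :
  cont2 F p -> cont2 (fun p => - F p) p.
Proof. by move=> hF; apply: cvgN. Qed.

Lemma cont2M (K : realType) (q : nat) F G (p : K * 'cV[K]_q) :
  cont2 F p -> cont2 G p -> cont2 (fun p => F p * G p) p.
Proof. by move=> hF hG; apply: cvgM. Qed.

Lemma cont2V (K : realType) (q : nat) F (p : K * 'cV[K]_q) :
  F p != 0 -> cont2 F p -> cont2 (fun p => (F p)^-1) p.
Proof. by move=> F0 hF; apply: cvgV. Qed.

Lemma cont2_sum (K : realType) (q : nat) (I : Type) (s : seq I) (P : pred I)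
    (F : I -> K * 'cV[K]_q -> K) (p : K * 'cV[K]_q) :
  (forall i, cont2 (F i) p) -> cont2 (fun p => \sum_(i <- s | P i) F i p) p.
Proof.
move=> hF; elim: s => [|i s IH].
  rewrite (_ : (fun p => _) = (fun=> 0)); first exact: cont2_cst.
  by apply/funext => p'; rewrite big_nil.
rewrite (_ : (fun p => _) = (fun p => (if P i then F i p else 0) + \sum_(i <- s | P i) F i p)).
  by apply: cont2D => //; case: (P i) => //; exact: cont2_cst.
by apply/funext => p'; rewrite big_cons; case: (P i); rewrite ?add0r.
Qed.

Lemma cont2_prod (K : realType) (q : nat) (I : Type) (s : seq I) (P : pred I)
    (F : I -> K * 'cV[K]_q -> K) (p : K * 'cV[K]_q) :
  (forall i, cont2 (F i) p) -> cont2 (fun p => \prod_(i <- s | P i) F i p) p.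
Proof.
move=> hF; elim: s => [|i s IH].
  rewrite (_ : (fun p => _) = (fun=> 1)); first exact: cont2_cst.
  by apply/funext => p'; rewrite big_nil.
rewrite (_ : (fun p => _) = (fun p => (if P i then F i p else 1) * \prod_(i <- s | P i) F i p)).
  by apply: cont2M => //; case: (P i) => //; exact: cont2_cst.
by apply/funext => p'; rewrite big_cons; case: (P i); rewrite ?mul1r.
Qed.

Lemma cont2_comp (K : realType) (q : nat) (f : K -> K) F (p : K * 'cV[K]_q) :
  {for F p, continuous f} -> cont2 F p -> cont2 (fun p => f (F p)) p.
Proof. by move=> hf hF; apply: (@cvg_comp _ _ _ F f) hF hf. Qed.

Lemma cont2_ln (K : realType) (q : nat) F (p : K * 'cV[K]_q) :
  0 < F p -> cont2 F p -> cont2 (fun p => ln (F p)) p.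
Proof. by move=> F0 hF; apply: cont2_comp hF; exact: continuous_ln. Qed.

Lemma cont2_near (K : realType) (q : nat) F (c0 : K) (x0 : 'cV[K]_q) (eta : K) :
  cont2 F (c0, x0) -> 0 < eta ->
  exists2 delta : K, 0 < delta & forall (c : K) (x : 'cV[K]_q), `|c - c0| <= delta ->
    (forall i, `|x i 0 - x0 i 0| <= delta) -> `|F (c, x) - F (c0, x0)| <= eta.
Proof.
move=> hF e0; have /cvgrPdist_le /(_ _ e0) := hF.
move=> [[A B] /= [/nbhs_ballP[d1 /= d10 h1] /nbhs_ballP[d2 /= d20 h2]] h].
exists (Num.min d1 d2 / 2); first by rewrite divr_gt0// lt_min d10.
have m0 : 0 < Num.min d1 d2 by rewrite lt_min d10.
have m1 : Num.min d1 d2 <= d1 by rewrite ge_min lexx.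
have m2 : Num.min d1 d2 <= d2 by rewrite ge_min lexx orbT.
move: (Num.min d1 d2) m0 m1 m2 => m m0 m1 m2.
have {}m1 : m / 2 < d1 by lra.
have {}m2 : m / 2 < d2 by lra.
move=> c x cc xx; rewrite distrC; apply: (h (c, x)); split => /=.
  by apply: h1; rewrite /ball/= distrC; exact: le_lt_trans m1.
apply: h2; split => // i j; rewrite (ord1 j) /ball/= distrC.
exact: le_lt_trans (xx i) m2.
Qed.

Lemma cont2_qform (K : realType) (q : nat) (R : 'M[K]_q) (p : K * 'cV[K]_q) :
  cont2 (fun p => qform R p.2) p.
Proof.
rewrite (_ : (fun p => _) = (fun p : K * 'cV[K]_q =>
  \sum_i \sum_j p.2 i 0 * p.2 j 0 * R i j)); last first.
  by apply/funext => p'; rewrite qformE.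
apply: cont2_sum => i; apply: cont2_sum => j.
apply: cont2M; last exact: cont2_cst.
by apply: cont2M; exact: cont2_coord.
Qed.

Lemma fin_delta (K : realType) (I : finType) (P : I -> K -> Prop) :
  (forall i (d d' : K), P i d -> 0 < d' -> d' <= d -> P i d') ->
  (forall i, exists2 d : K, 0 < d & P i d) ->
  exists2 d : K, 0 < d & forall i, P i d.
Proof.
move=> Pm h0; have h i := cid2 (h0 i).
pose f i := s2val (h i).
have f0 i : 0 < f i := s2valP (h i).
have S0 : 0 <= \sum_i (f i)^-1 by apply: sumr_ge0 => i _; rewrite invr_ge0 ltW.
have S1 : 0 < 1 + \sum_i (f i)^-1 by lra.
exists (1 + \sum_i (f i)^-1)^-1; first by rewrite invr_gt0.
move=> i; apply: Pm (s2valP' (h i)) _ _; first by rewrite invr_gt0.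
rewrite -[leRHS]invrK lef_pV2 ?posrE ?invr_gt0//; last exact: f0.
rewrite (bigD1 i)//= addrCA lerDl addr_ge0//.
by apply: sumr_ge0 => j _; rewrite invr_ge0 ltW.
Qed.

Definition hess_coef (K : realType) (q : nat) (R : 'M[K]_q) (c : K)
    (x : 'cV[K]_q) (i j : 'I_q) : K :=
  (x i 0)^-1 *+ (i == j) + 2 * c / qform R x *
    (2 / qform R x * ((\sum_k R i k * x k 0) * (\sum_k R j k * x k 0)) - R i j).

Lemma hess_formE (K : realType) (q : nat) (R : 'M[K]_q) (c : K) (x v : 'cV[K]_q) :
  hess_form R c x v = \sum_i \sum_j v i 0 * v j 0 * hess_coef R c x i j.
Proof.
pose u i := \sum_k R i k * x k 0.
have bE : bil R v x = \sum_i v i 0 * u i.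
  rewrite bilE; apply: eq_bigr => i _; rewrite /u big_distrr/=.
  by apply: eq_bigr => j _; rewrite mulrA.
transitivity (\sum_i \sum_j (v i 0 * v j 0 * ((x i 0)^-1 *+ (i == j))
   + (2 * c / qform R x * (2 / qform R x) * ((v i 0 * u i) * (v j 0 * u j))
   + - (2 * c / qform R x) * (v i 0 * v j 0 * R i j)))); last first.
  apply: eq_bigr => i _; apply: eq_bigr => j _; rewrite /hess_coef -/(u i) -/(u j).
  by move: (_ *+ _) => z; ring.
under eq_bigr do rewrite !big_split/= -!big_distrr/=.
rewrite !big_split/= -!big_distrr/= -big_distrl/= -qformE /hess_form bE.
have -> : \sum_(i < q) \sum_(j < q) v i 0 * v j 0 * ((x i 0)^-1 *+ (i == j))
   = \sum_i v i 0 ^+ 2 / x i 0.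
  apply: eq_bigr => i _; rewrite (bigD1 i)//= big1 ?addr0 => [|j ji].
    by rewrite eqxx mulr1n expr2.
  by rewrite eq_sym (negbTE ji) mulr0n mulr0.
by ring.
Qed.

Lemma cont2_hess_coef (K : realType) (q : nat) (R : 'M[K]_q) i j (p : K * 'cV[K]_q) :
  (forall i, 0 < p.2 i 0) -> 0 < qform R p.2 ->
  cont2 (fun p => hess_coef R p.1 p.2 i j) p.
Proof.
move=> x0 Q0; have Qn : qform R p.2 != 0 by rewrite gt_eqF.
have iQ : cont2 (fun p => (qform R p.2)^-1) p.
  by apply: cont2V => //; exact: cont2_qform.
have lin k : cont2 (fun p => \sum_l R k l * p.2 l 0) p.
  by apply: cont2_sum => l; apply: cont2M; [exact: cont2_cst|exact: cont2_coord].
rewrite /hess_coef; apply: cont2D.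
  have [_|_] := eqVneq i j; last by rewrite /=; exact: cont2_cst.
  by apply: cont2V; [rewrite gt_eqF|exact: cont2_coord].
apply: cont2M.
  apply: cont2M => //; apply: cont2M; [exact: cont2_cst|exact: cont2_fst].
apply: cont2D; last by apply: cont2N; exact: cont2_cst.
apply: cont2M; first by apply: cont2M => //; exact: cont2_cst.
by apply: cont2M.
Qed.

Lemma sum_sq_bound (K : realType) (d : nat) (y : 'cV[K]_d) i j :
  `|y i 0| * `|y j 0| <= \sum_k y k 0 ^+ 2.
Proof.
have h k : y k 0 ^+ 2 <= \sum_k y k 0 ^+ 2.
  by rewrite (bigD1 k)//= lerDl sumr_ge0// => l _; exact: sqr_ge0.
have hi := h i; have hj := h j; rewrite -[y i 0 ^+ 2]sqr_normr in hi.
rewrite -[y j 0 ^+ 2]sqr_normr in hj.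
have a0 := normr_ge0 (y i 0); have b0 := normr_ge0 (y j 0).
move: (\sum_k _) (`|_|) (`|_|) hi hj a0 b0 => S a b hi hj a0 b0.
by have := sqr_ge0 (a - b); lra.
Qed.

(** The coefficients of the form are continuous, and a form is bounded by the
    sum of the absolute values of its coefficients times the squared norm. *)
Lemma hess_form_near (K : realType) (q : nat) (R : 'M[K]_q) (c0 : K)
    (x0 : 'cV[K]_q) (eta : K) :
  (forall i, 0 < x0 i 0) -> 0 < qform R x0 -> 0 < eta ->
  exists2 delta : K, 0 < delta & forall (c : K) (x : 'cV[K]_q),
    `|c - c0| <= delta -> (forall i, `|x i 0 - x0 i 0| <= delta) ->
    forall v, `|hess_form R c x v - hess_form R c0 x0 v|
              <= eta * \sum_i v i 0 ^+ 2.
Proof.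
move=> x00 Q0 e0.
pose N : K := (q * q)%:R + 1.
have N0 : 0 < N by rewrite ltr_wpDl.
have eN : 0 < eta / N by rewrite divr_gt0.
have [d d0 hd] : exists2 d : K, 0 < d & forall ij : 'I_q * 'I_q,
    forall (c : K) (x : 'cV[K]_q), `|c - c0| <= d ->
    (forall i, `|x i 0 - x0 i 0| <= d) ->
    `|hess_coef R c x ij.1 ij.2 - hess_coef R c0 x0 ij.1 ij.2| <= eta / N.
  apply: fin_delta => [ij d d' h d'0 d'd c x cc xx|[i j]].
    by apply: h => [|k]; [apply: le_trans d'd|apply: le_trans (xx k) d'd].
  have h := @cont2_hess_coef K q R i j (c0, x0) x00 Q0.
  exact: cont2_near h eN.
exists d => // c x cc xx v.
rewrite !hess_formE -sumrB; set V := \sum_i v i 0 ^+ 2.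
have V0 : 0 <= V by apply: sumr_ge0 => i _; exact: sqr_ge0.
apply: (@le_trans _ _ (\sum_(i < q) \sum_(j < q) V * (eta / N))).
  apply: (le_trans (ler_norm_sum _ _ _)); apply: ler_sum => i _.
  rewrite -sumrB; apply: (le_trans (ler_norm_sum _ _ _)); apply: ler_sum => j _.
  rewrite -mulrBr !normrM ler_pM ?mulr_ge0//; first exact: sum_sq_bound.
  exact: hd (i, j) c x cc xx.
rewrite !sumr_const card_ord -mulrnA -mulr_natl mulrCA.
rewrite -subr_ge0 (_ : _ - _ = V * (eta / N)); first by rewrite mulr_ge0// ltW.
by rewrite /N; field; rewrite gt_eqF.
Qed.

(** * Propagation of positive definiteness *)

Definition tangent (K : realType) (q : nat) (v : 'cV[K]_q) : Prop :=
  \sum_i v i 0 = 0.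

Definition posmx (K : realType) (q : nat) (R : 'M[K]_q) : Prop :=
  forall x : 'cV[K]_q, (forall i, 0 < x i 0) -> 0 < qform R x.

(** On tangent vectors the first coordinate is determined by the others. *)
Lemma tangent_sq_le (K : realType) (d : nat) (v : 'cV[K]_d.+1) : tangent v ->
  \sum_i v i 0 ^+ 2 <= d.+2%:R ^+ 2 * \sum_(k < d) row' ord0 v k 0 ^+ 2.
Proof.
move=> v0; have vE := mul_frame0 (proj2 (const_mul v) v0).
set V := \sum_(k < d) _; have V0 : 0 <= V by apply: sumr_ge0 => k _; exact: sqr_ge0.
have bnd k : `|row' ord0 v k 0| <= Num.sqrt V.
  rewrite -sqrtr_sqr ler_wsqrtr// /V (bigD1 k)//= lerDl.
  by apply: sumr_ge0 => l _; exact: sqr_ge0.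
have s0 := sqrtr_ge0 V.
have v0E : v ord0 0 = - \sum_(k < d) row' ord0 v k 0.
  move: v0; rewrite /tangent big_ord_recl => /eqP; rewrite addr_eq0 => /eqP ->.
  by congr (- _); apply: eq_bigr => k _; rewrite mxE.
have h0 : v ord0 0 ^+ 2 <= d%:R ^+ 2 * V.
  rewrite -sqr_normr v0E normrN -[V](sqr_sqrtr V0) -exprMn lerXn2r ?nnegrE ?mulr_ge0//.
  apply: (le_trans (ler_norm_sum _ _ _)).
  apply: (@le_trans _ _ (\sum_(k < d) Num.sqrt V)); first exact: ler_sum.
  by rewrite sumr_const card_ord mulr_natl.
rewrite big_ord_recl; have -> : \sum_(i < d) v (lift ord0 i) 0 ^+ 2 = V.
  by apply: eq_bigr => k _; rewrite mxE.
have h2 : d%:R ^+ 2 + 1 <= d.+2%:R ^+ 2 :> K.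
  rewrite -[d.+2%:R]natr1 -[d.+1%:R]natr1.
  have : 0 <= d%:R :> K by [].
  by move: (d%:R) => y y0; rewrite -subr_ge0 (_ : _ - _ = 4 * y + 3); [lra|ring].
have := ler_wpM2r V0 h2; lra.
Qed.

Lemma hess_coercive (K : realType) (d : nat) (R : 'M[K]_d.+1) (c : K) (x : 'cV[K]_d.+1) :
  R^T = R -> (forall i, 0 < x i 0) -> posdef (hess0 R c x) ->
  exists2 lam : K, 0 < lam & forall v, tangent v ->
    lam * \sum_i v i 0 ^+ 2 <= hess_form R c x v.
Proof.
move=> Rs x0 /posdef_coercive[l l0 hl].
have D0 : 0 < d.+2%:R ^+ 2 :> K by rewrite exprn_gt0.
exists (l / d.+2%:R ^+ 2); first by rewrite divr_gt0.
move=> v vt; rewrite -(hess0_form c Rs x0 vt); apply: le_trans (hl _).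
by rewrite -mulrA ler_wpM2l ?(ltW l0)// ler_pdivrMl// tangent_sq_le.
Qed.

Lemma sum_sq_gt0 (K : realType) (q : nat) (v : 'cV[K]_q) : v != 0 ->
  0 < \sum_i v i 0 ^+ 2.
Proof.
move=> v0; have [i vi] : exists i, v i 0 != 0.
  apply/existsP; apply: contra_neqT v0 => /existsPn h.
  by apply/colP => i; rewrite mxE; apply/eqP; rewrite -[_ == _]negbK h.
rewrite (bigD1 i)//= ltr_wpDr// ?exprn_even_gt0//.
by apply: sumr_ge0 => j _; exact: sqr_ge0.
Qed.

Lemma frame0_tangent (K : realType) (d : nat) (y : 'cV[K]_d) :
  tangent (frame0 K d *m y).
Proof. by apply/const_mul; rewrite mulmxA const_frame0 mul0mx. Qed.

Lemma row'_frame0M (K : realType) (d : nat) (y : 'cV[K]_d) :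
  row' ord0 (frame0 K d *m y) = y.
Proof.
rewrite -[RHS]mul1mx -row'_frame0; apply/matrixP => i j; rewrite !mxE.
by apply: eq_bigr => k _; rewrite !mxE.
Qed.

Lemma posdef_hess0 (K : realType) (d : nat) (R : 'M[K]_d.+1) (c : K) (x : 'cV[K]_d.+1) :
  R^T = R -> (forall i, 0 < x i 0) ->
  (forall v, tangent v -> v != 0 -> 0 < hess_form R c x v) ->
  posdef (hess0 R c x).
Proof.
move=> Rs x0 h; split; first exact: hess0_sym.
move=> y y0; rewrite -(row'_frame0M y) hess0_form//; last exact: frame0_tangent.
apply: h; first exact: frame0_tangent.
apply: contra_neq y0 => h0; rewrite -(row'_frame0M y) h0.
by apply/matrixP => i j; rewrite !mxE.
Qed.

Lemma posdef_hess0_psd (K : realType) (d : nat) (R : 'M[K]_d.+1) (c : K) (x : 'cV[K]_d.+1) :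
  R^T = R -> (forall i, 0 < x i 0) ->
  (forall v, tangent v -> 0 <= hess_form R c x v) ->
  \det (hess0 R c x) != 0 -> posdef (hess0 R c x).
Proof.
move=> Rs x0 h hd; apply: psd_det_posdef hd; first exact: hess0_sym.
by move=> y; rewrite -(row'_frame0M y) hess0_form//; [apply: h|]; exact: frame0_tangent.
Qed.

(** Positive definiteness is an open condition, because it is coercive. *)
Lemma hess_near_pd (K : realType) (d : nat) (R : 'M[K]_d.+1) (c0 : K) (x0 : 'cV[K]_d.+1) :
  R^T = R -> (forall i, 0 < x0 i 0) -> 0 < qform R x0 -> posdef (hess0 R c0 x0) ->
  exists2 delta : K, 0 < delta & forall (c : K) (x : 'cV[K]_d.+1),
    (forall i, 0 < x i 0) ->
    `|c - c0| <= delta -> (forall i, `|x i 0 - x0 i 0| <= delta) ->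
    posdef (hess0 R c x).
Proof.
move=> Rs x00 Q0 pd; have [l l0 hl] := hess_coercive Rs x00 pd.
have l2 : 0 < l / 2 by lra.
have [dl dl0 hd] := hess_form_near c0 x00 Q0 l2.
exists dl; [exact: dl0|move=> c x xp cc xx]; apply: (posdef_hess0 Rs xp) => v vt v0.
have := hd c x cc xx v; rewrite ler_norml => /andP[h _].
have := hl v vt; have := mulr_gt0 l2 (sum_sq_gt0 v0); lra.
Qed.

Lemma segment_open (K : realType) (q : nat) (x y : 'cV[K]_q) (t : K) :
  open_simplex x -> open_simplex y -> 0 <= t <= 1 ->
  open_simplex (x + t *: (y - x)).
Proof.
move=> [x0 x1] [y0 y1] /andP[t0 t1]; split=> [i|].
  rewrite !mxE; have -> : x i 0 + t * (y i 0 - x i 0) = (1 - t) * x i 0 + t * y i 0 by ring.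
  have [->|tn] := eqVneq t 0; first by rewrite mul0r addr0 subr0 mul1r.
  have tp : 0 < t by rewrite lt_neqAle eq_sym tn.
  apply: ltr_wpDl; last exact: mulr_gt0.
  by apply: mulr_ge0; [rewrite subr_ge0|exact: ltW].
under eq_bigr do rewrite !mxE.
by rewrite big_split/= -big_distrr/= sumrB x1 y1 subrr mulr0 addr0.
Qed.

Lemma tangent_diff (K : realType) (q : nat) (x y : 'cV[K]_q) :
  \sum_i x i 0 = 1 -> \sum_i y i 0 = 1 -> tangent (y - x).
Proof.
by move=> x1 y1; rewrite /tangent; under eq_bigr do rewrite !mxE; rewrite sumrB x1 y1 subrr.
Qed.

Lemma simplex_le1 (K : realType) (q : nat) (x : 'cV[K]_q) i :
  (forall i, 0 <= x i 0) -> \sum_i x i 0 = 1 -> x i 0 <= 1.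
Proof. by move=> x0 <-; rewrite (bigD1 i)//= lerDl sumr_ge0. Qed.

Lemma simplex_diff_le1 (K : realType) (q : nat) (x y : 'cV[K]_q) i :
  open_simplex x -> open_simplex y -> `|(y - x) i 0| <= 1.
Proof.
move=> [x0 x1] [y0 y1]; rewrite !mxE.
have x0' j := ltW (x0 j); have y0' j := ltW (y0 j).
have := simplex_le1 i x0' x1; have := simplex_le1 i y0' y1.
have := x0' i; have := y0' i; rewrite ler_norml; lra.
Qed.

(** The signature of a nonsingular symmetric form cannot change along a
    segment: at the last time up to which the Hessian is positive definite it
    is positive semidefinite and nonsingular, hence still positive definite,
    and so it stays for a while. *)
Lemma posdef_propagate (K : realType) (d : nat) (R : 'M[K]_d.+1) (c : K)
    (x y : 'cV[K]_d.+1) :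
  R^T = R -> posmx R ->
  (forall z, open_simplex z -> \det (hess0 R c z) != 0) ->
  open_simplex x -> open_simplex y ->
  posdef (hess0 R c x) -> posdef (hess0 R c y).
Proof.
move=> Rs Rp hd xo yo pdx.
pose z (t : K) := x + t *: (y - x).
have zo (t : K) : 0 <= t <= 1 -> open_simplex (z t) by exact: segment_open.
have zd (s t : K) i : `|z s i 0 - z t i 0| <= `|s - t|.
  have -> : z s i 0 - z t i 0 = (s - t) * (y - x) i 0 by rewrite /z !mxE; ring.
  by rewrite normrM ler_piMr// simplex_diff_le1.
pose S : set K := [set t | 0 <= t <= 1 /\ forall s, 0 <= s <= t -> posdef (hess0 R c (z s))].
have S0 : S 0.
  split; first by rewrite lexx ler01.
  by move=> s s0; have -> : s = 0 by [lra]; rewrite /z scale0r addr0.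
have Sub : has_ubound S by exists 1 => t [/andP[_ t1] _].
set T := sup S.
have T0 : 0 <= T := ub_le_sup Sub S0.
have T1 : T <= 1.
  by apply: (ge_sup (ex_intro _ _ S0)) => t [/andP[_ t1] _].
have pdlt (s : K) : 0 <= s < T -> posdef (hess0 R c (z s)).
  move=> /andP[s0 sT]; have [t [_ ht] st] := sup_gt (ex_intro _ _ S0) sT.
  by apply: ht; rewrite s0 ltW.
have T01 : 0 <= T <= 1 by rewrite T0.
have [zT0 zT1] := zo T T01.
have QT := Rp _ zT0.
have pdT : posdef (hess0 R c (z T)).
  have [T00|Tn] := eqVneq T 0; first by rewrite T00 /z scale0r addr0.
  have Tp : 0 < T by rewrite lt_neqAle eq_sym Tn.
  apply: (posdef_hess0_psd Rs zT0 _ (hd _ (zo T T01))) => v vt; rewrite leNgt; apply/negP => hv.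
  have V0 : 0 <= \sum_i v i 0 ^+ 2 by apply: sumr_ge0 => i _; exact: sqr_ge0.
  set V := \sum_i _ in V0.
  have V1 : 0 < V + 1 by lra.
  have e0 : 0 < - hess_form R c (z T) v / (V + 1) by rewrite divr_gt0// oppr_gt0.
  have [dl dl0 hdl] := hess_form_near c zT0 QT e0.
  pose s := Num.max 0 (T - dl).
  have s0 : 0 <= s by rewrite le_max lexx.
  have sT : s < T by rewrite gt_max Tp/= gtrBl.
  have sd : `|s - T| <= dl.
    have : T - dl <= s by rewrite le_max lexx orbT.
    by rewrite distrC ger0_norm ?subr_ge0 ?(ltW sT)// => h; clear -h; lra.
  have s01 : 0 <= s <= 1 by rewrite s0 (le_trans (ltW sT)).
  have [zs0 _] := zo s s01.
  have pds := pdlt s; rewrite s0 sT in pds; have {}pds := pds isT.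
  have [l l0 hl] := hess_coercive Rs zs0 pds.
  have h1 := le_trans (mulr_ge0 (ltW l0) V0) (hl v vt).
  have cc : `|c - c| <= dl by rewrite subrr normr0 ltW.
  have h2 := hdl c (z s) cc (fun i => le_trans (zd s T i) sd) v.
  have h3 : - hess_form R c (z T) v / (V + 1) * V < - hess_form R c (z T) v.
    rewrite -mulrA gtr_pMr ?oppr_gt0// mulrC ltr_pdivrMr//; lra.
  move: h2; rewrite -/V ler_norml => /andP[_]; rewrite lerBlDr => h2.
  by move: (le_trans h1 h2); apply/negP; rewrite -ltNge -ltrBrDr sub0r; exact: h3.
have [dl dl0 hdl] := hess_near_pd Rs zT0 QT pdT.
have cc : `|c - c| <= dl by rewrite subrr normr0 ltW.
have near (s : K) : 0 <= s <= 1 -> `|s - T| <= dl -> posdef (hess0 R c (z s)).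
  move=> s01 sT; have [zs0 _] := zo s s01; exact: hdl c (z s) zs0 cc (fun i => le_trans (zd s T i) sT).
suff T11 : T = 1 by move: pdT; rewrite T11 /z scale1r addrC subrK.
apply/eqP; rewrite eq_le T1 leNgt; apply/negP => Tlt.
pose u := Num.min 1 (T + dl).
have Tu : T < u by rewrite lt_min Tlt ltrDl.
have u1 : u <= 1 by rewrite ge_min lexx.
have ud : u <= T + dl by rewrite ge_min lexx orbT.
have : u <= T.
  apply: (ub_le_sup Sub); split; first by rewrite u1 andbT (le_trans T0)// ltW.
  move=> s /andP[s0 su]; have [sT|Ts] := ltP s T; first by apply: pdlt; rewrite s0.
  apply: near; first by rewrite s0 (le_trans su).
  have h : s - T <= dl by rewrite lerBlDl (le_trans su).
  by rewrite ger0_norm ?subr_ge0.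
by rewrite leNgt Tu.
Qed.

(** * Convexity and critical points *)

Lemma deriv_neg_decr (K : realType) (f : K -> K) (t a : K) :
  hasderiv f t a -> a < 0 ->
  exists2 delta : K, 0 < delta & forall s, 0 < s < delta -> f (t + s) < f t.
Proof.
move=> [fd fa] a0; have := fd; rewrite /derivable /= => /cvg_ex[l hl].
have la : l = a by rewrite -fa; apply/esym/cvg_lim.
rewrite la in hl.
have a20 : 0 < - a / 2 by lra.
have /cvgrPdist_lt/(_ _ a20)/nbhs_ballP[e /= e0 he] := hl.
exists e => // s /andP[s0 se].
have := he s; rewrite /ball/= sub0r normrN gtr0_norm// => /(_ se).
rewrite gt_eqF// => /(_ isT); rewrite /shift/= [s%:A]mulr1 -[_ *: _]/(s^-1 * (f (s + t) - f t)).
rewrite ltr_norml => /andP[h1 h2].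
have : s^-1 * (f (s + t) - f t) < 0 by move: (s^-1 * _) h1 h2 => u h1 h2; lra.
by rewrite pmulr_rlt0 ?invr_gt0// subr_lt0 addrC.
Qed.

Lemma dPhi_tangent (K : realType) (q : nat) (R : 'M[K]_q) (r : 'cV[K]_q) (c : K)
    (x v : 'cV[K]_q) : tangent v ->
  dPhi R r c x v = \sum_i v i 0 * (ln (x i 0) - ln (r i 0))
     - c * (2 * bil R v x / qform R x).
Proof.
move=> v0; rewrite /dPhi; congr (_ - _).
under eq_bigr do rewrite mulrDr mulr1.
by rewrite big_split/= v0 addr0.
Qed.

Lemma Phi_taylor (K : realType) (q : nat) (R : 'M[K]_q) (r : 'cV[K]_q)
    (c : K) (x y : 'cV[K]_q) (lam Lam : K) : R^T = R -> posmx R ->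
  open_simplex x -> open_simplex y ->
  (forall t : K, 0 <= t <= 1 ->
     lam <= hess_form R c (x + t *: (y - x)) (y - x) <= Lam) ->
  Phi R r c x + dPhi R r c x (y - x) + lam / 2 <= Phi R r c y
  /\ Phi R r c y <= Phi R r c x + dPhi R r c x (y - x) + Lam / 2.
Proof.
move=> Rs Rp xo yo h.
have d1 (t : K) : 0 <= t <= 1 -> hasderiv (fun s => Phi R r c (x + s *: (y - x))) t
    (dPhi R r c (x + t *: (y - x)) (y - x)).
  move=> t01; have [z0 _] := segment_open xo yo t01.
  by apply: Phi_path_deriv => //; exact: Rp.
have d2 (t : K) : 0 <= t <= 1 ->
    hasderiv (fun s => dPhi R r c (x + s *: (y - x)) (y - x)) t
      (hess_form R c (x + t *: (y - x)) (y - x)).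
  move=> t01; have [z0 _] := segment_open xo yo t01.
  by apply: dPhi_path_deriv => //; exact: Rp.
have l1 (t : K) : 0 <= t <= 1 -> lam <= hess_form R c (x + t *: (y - x)) (y - x).
  by move=> /h/andP[].
have l2 (t : K) : 0 <= t <= 1 -> hess_form R c (x + t *: (y - x)) (y - x) <= Lam.
  by move=> /h/andP[].
have := taylor2_ge d1 d2 l1; have := taylor2_le d1 d2 l2.
by rewrite !scale0r !addr0 scale1r (addrC x) subrK.
Qed.

(** Strict convexity of [Phi_c], expressed through Hessians. *)
Definition convex_at (K : realType) (d : nat) (R : 'M[K]_d.+1) (c : K) : Prop :=
  forall x, open_simplex x -> posdef (hess0 R c x).

Lemma Phi_convex (K : realType) (d : nat) (R : 'M[K]_d.+1) (r : 'cV[K]_d.+1)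
    (c : K) (x y : 'cV[K]_d.+1) : R^T = R -> posmx R -> convex_at R c ->
  open_simplex x -> open_simplex y ->
  Phi R r c x + dPhi R r c x (y - x) <= Phi R r c y.
Proof.
move=> Rs Rp cv xo yo.
have d1 (t : K) : 0 <= t <= 1 -> hasderiv (fun s => Phi R r c (x + s *: (y - x))) t
    (dPhi R r c (x + t *: (y - x)) (y - x)).
  move=> t01; have [z0 _] := segment_open xo yo t01.
  by apply: Phi_path_deriv => //; exact: Rp.
have d2 (t : K) : 0 <= t <= 1 ->
    hasderiv (fun s => dPhi R r c (x + s *: (y - x)) (y - x)) t
      (hess_form R c (x + t *: (y - x)) (y - x)).
  move=> t01; have [z0 _] := segment_open xo yo t01.
  by apply: dPhi_path_deriv => //; exact: Rp.
have l1 (t : K) : 0 <= t <= 1 -> 0 <= hess_form R c (x + t *: (y - x)) (y - x).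
  move=> t01; have zo := segment_open xo yo t01; have [z0 _] := zo.
  have [l l0 hl] := hess_coercive Rs z0 (cv _ zo).
  apply: le_trans (hl _ (tangent_diff (proj2 xo) (proj2 yo))).
  by apply: mulr_ge0 (ltW l0) _; apply: sumr_ge0 => i _; exact: sqr_ge0.
have := taylor2_ge d1 d2 l1.
by rewrite !scale0r !addr0 scale1r (addrC x) subrK mul0r addr0.
Qed.

Definition critical (K : realType) (q : nat) (R : 'M[K]_q) (r : 'cV[K]_q) (c : K)
    (x : 'cV[K]_q) : Prop := forall v, tangent v -> dPhi R r c x v = 0.

(** Along the segment joining two critical points the derivative of [Phi_c]
    would vanish twice, although it is strictly increasing. *)
Lemma critical_unique (K : realType) (d : nat) (R : 'M[K]_d.+1) (r : 'cV[K]_d.+1)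
    (c : K) (x y : 'cV[K]_d.+1) : R^T = R -> posmx R -> convex_at R c ->
  open_simplex x -> open_simplex y ->
  critical R r c x -> critical R r c y -> x = y.
Proof.
move=> Rs Rp cv xo yo cx cy; apply/eqP; rewrite -subr_eq0 -oppr_eq0 opprB.
apply/negPn/negP => vn0; have vt := tangent_diff (proj2 xo) (proj2 yo).
have d2 (t : K) : 0 <= t <= 1 ->
    hasderiv (fun s => dPhi R r c (x + s *: (y - x)) (y - x)) t
      (hess_form R c (x + t *: (y - x)) (y - x)).
  move=> t01; have [z0 _] := segment_open xo yo t01.
  by apply: dPhi_path_deriv => //; exact: Rp.
have [s /andP[s0 s1]] := MVT_closed ltr01 d2.
rewrite scale0r addr0 scale1r (addrC x) subrK cx// cy// subrr subr0 mulr1.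
have s01 : 0 <= s <= 1 by rewrite !ltW.
have zo := segment_open xo yo s01; have [z0 _] := zo.
have [l l0 hl] := hess_coercive Rs z0 (cv _ zo).
move=> h; have := hl _ vt; rewrite -h leNgt.
by rewrite (mulr_gt0 l0 (sum_sq_gt0 vn0)).
Qed.

(** A frame spans the tangent space, so the gradient in its coordinates vanishes
    exactly when all tangential derivatives do. *)
Lemma grad_critical (K : realType) (d : nat) (E : 'M[K]_(d.+1, d)) (R : 'M[K]_d.+1)
    (r : 'cV[K]_d.+1) (c : K) (x : 'cV[K]_d.+1) :
  R^T = R -> @tangent_frame K d.+1 E ->
  @grad_Phi K d.+1 E R r c x = 0 <-> critical R r c x.
Proof.
move=> Rs Ef; have [B dB EB] := frame_factor Ef.
pose g := (map_mx (@ln K) x)^T - (map_mx (@ln K) r)^T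
     - (2 * c / qform R x) *: (x^T *m R).
have gE v : tangent v -> (g *m v) 0 0 = dPhi R r c x v.
  move=> vt; rewrite dPhi_tangent// /g !mulmxBl -scalemxAl.
  have sub11 (A C : 'M[K]_1) : (A - C) 0 0 = A 0 0 - C 0 0 by rewrite !mxE.
  have sca11 a (A : 'M[K]_1) : (a *: A) 0 0 = a * A 0 0 by rewrite !mxE.
  rewrite !sub11 sca11 -/(bil R x v) (bilC x v Rs) !mxE.
  congr (_ - _); last by ring.
  by rewrite -sumrB; apply: eq_bigr => i _; rewrite !mxE; ring.
rewrite /grad_Phi -/g; split=> [gE0 v vt|cr].
  have Bu : B \in unitmx by rewrite unitmxE unitfE -normr_eq0 dB oner_eq0.
  have g0 : g *m frame0 K d = 0.
    have h : g *m frame0 K d *m B = 0 by rewrite -mulmxA -EB.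
    by rewrite -(mulmxK Bu (g *m frame0 K d)) h mul0mx.
  by rewrite -gE// (mul_frame0 (proj2 (const_mul v) vt)) mulmxA g0 mul0mx mxE.
apply/rowP => j; rewrite [RHS]mxE.
have -> : (g *m E) 0 j = (g *m col j E) 0 0.
  by rewrite [LHS]mxE [RHS]mxE; apply: eq_bigr => i _; rewrite [col _ _ _ _]mxE.
have ct : tangent (col j E).
  apply/const_mul; have [_ /matrixP E0 _] := Ef.
  apply/matrixP => i k; have := E0 i j; rewrite !mxE => h; rewrite -[RHS]h.
  by apply: eq_bigr => l _; rewrite !mxE.
by rewrite gE// cr.
Qed.

(** A convex function lies above its tangent plane, so a critical point is a
    global minimiser. *)
Lemma local_minima_convex (K : realType) (d : nat) (E : 'M[K]_(d.+1, d))
    (R : 'M[K]_d.+1) (r : 'cV[K]_d.+1) (c : K) (phi : 'cV[K]_d.+1) :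
  R^T = R -> posmx R -> @tangent_frame K d.+1 E -> convex_at R c ->
  open_simplex phi -> critical R r c phi ->
  @local_minima K d.+1 E R r c = [set phi].
Proof.
move=> Rs Rp Ef cv po pc; apply/seteqP; split=> [x [xo xg _]|x ->] /=.
  apply: (critical_unique Rs Rp cv xo po _ pc).
  exact: (proj1 (grad_critical r c _ Rs Ef) xg).
split=> //; first exact/(grad_critical r c _ Rs Ef).
rewrite /within/=.
have : \forall x \near nbhs phi, forall i : 'I_d.+1, 0 < (x : 'cV[K]_d.+1) i 0.
  have [p0 _] := po; apply: filter_forall => i.
  have := @coord_continuous K d.+1 1 i 0 phi.
  by move/(cvgr_gt (phi i 0)); apply; exact: p0.
apply: filterS => y y0 [_ y1].
have yo : open_simplex y by [].
have := Phi_convex r Rs Rp cv po yo.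
by rewrite pc ?addr0//; exact: tangent_diff (proj2 po) y1.
Qed.

(** * Existence of an interior minimiser *)

Lemma cont2_slice (K : realType) (q : nat) (F : K * 'cV[K]_q -> K) (c : K)
    (x : 'cV[K]_q) : cont2 F (c, x) -> {for x, continuous (fun y => F (c, y))}.
Proof.
move=> hF; apply: (@cvg_comp _ _ _ (fun y => (c, y)) F) hF.
have h1 : (fun y : 'cV[K]_q => c) @ nbhs x --> nbhs c by exact: cst_continuous.
have h2 : (fun y : 'cV[K]_q => y) @ nbhs x --> nbhs x by exact: cvg_id.
by have := cvg_pair h1 h2; apply.
Qed.

Lemma cont2_Phi (K : realType) (q : nat) (R : 'M[K]_q) (r : 'cV[K]_q)
    (p : K * 'cV[K]_q) : (forall i, 0 < p.2 i 0) -> 0 < qform R p.2 ->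
  cont2 (fun p => Phi R r p.1 p.2) p.
Proof.
move=> x0 Q0; rewrite /Phi; apply: cont2D.
  apply: cont2_sum => i; apply: cont2M; first exact: cont2_coord.
  apply: cont2D; last by apply: cont2N; exact: cont2_cst.
  by apply: cont2_ln => //; exact: cont2_coord.
apply: cont2N; apply: cont2M; first exact: cont2_fst.
by apply: cont2_ln => //; exact: cont2_qform.
Qed.

Definition trunc_simplex (K : realType) (q : nat) (tau : K) : set 'cV[K]_q :=
  [set x | (forall i, tau <= x i 0) /\ \sum_i x i 0 = 1].

Lemma trmx_continuous (K : realType) (m n : nat) :
  continuous (@trmx K m n).
Proof.
move=> v A /nbhs_ballP[e /= e0 h]; apply/nbhs_ballP; exists e => //= w vw.
apply: h; case: vw => e0' vw; split => // i j.
by rewrite !mxE; exact: vw.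
Qed.

Lemma trunc_simplex_compact (K : realType) (q : nat) (tau : K) : 0 <= tau ->
  compact (@trunc_simplex K q tau).
Proof.
move=> t0.
have cbox : compact [set x : 'cV[K]_q | forall i, tau <= x i 0 <= 1].
  have crv := @rV_compact K q (fun=> `[tau, 1]%classic) (fun=> @segment_compact K _ _).
  have ci : {within [set v : 'rV[K]_q | forall i, `[tau, 1]%classic (v ord0 i)],
      continuous (@trmx K 1 q)}.
    exact: continuous_subspaceT (@trmx_continuous K 1 q).
  have := continuous_compact ci crv; congr compact; apply/seteqP; split => x /=.
    by move=> [v vb <-] i; have := vb i; rewrite /= in_itv/= mxE.
  move=> xb; exists x^T; last by rewrite trmxK.
  by move=> i; rewrite /= in_itv/= mxE.
have clo : closed [set x : 'cV[K]_q | \sum_i x i 0 = 1].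
  rewrite (_ : [set x : 'cV[K]_q | _] = (fun x : 'cV[K]_q => \sum_i x i 0) @^-1` [set 1])//.
  apply: closed_comp; last exact: closed_eq.
  move=> x _; have := @cont2_sum K q _ (index_enum 'I_q) xpredT
    (fun i p => p.2 i 0) (0, x) (fun i => @cont2_coord K q i (0, x)).
  exact: cont2_slice.
have := compact_closedI cbox clo; congr compact; apply/seteqP; split => x /=.
  by move=> [xb x1]; split => // i; case/andP: (xb i).
move=> [xb x1]; split => // i; rewrite xb/=.
apply: simplex_le1 => // j; exact: le_trans (xb j).
Qed.

Lemma xlnx_le (K : realType) (x u : K) : 0 < x <= 1 -> 0 <= u ->
  (u - x) * ln x <= u * ln x + 1.
Proof.
move=> /andP[x0 x1] u0; rewrite mulrBl lerD2l lerNl.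
have := le_ln1Dx (_ : -1 < x^-1 - 1); rewrite ltrBrDr addNr invr_gt0 => /(_ x0).
rewrite addrC subrK lnV ?posrE// => h.
have := ler_wpM2l (ltW x0) h; rewrite mulrN mulrBr mulr1 divff ?gt_eqF//; lra.
Qed.

(** The one-sided derivative of [x ln x] at [0] is infinite, so a minimiser
    over a slightly truncated simplex cannot lie on its boundary: moving towards
    the barycentre would lower the value. *)
Lemma min_interior (K : realType) (q : nat) (R : 'M[K]_q) (r : 'cV[K]_q) (c : K) :
  (0 < q)%N -> R^T = R -> (forall i j, 0 <= R i j) -> posmx R -> 0 <= c ->
  exists2 tau : K, 0 < tau & exists2 phi : 'cV[K]_q,
    (forall i, tau < phi i 0) /\ \sum_i phi i 0 = 1 &
    forall x, trunc_simplex tau x -> Phi R r c phi <= Phi R r c x.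
Proof.
move=> q0 Rs R0 Rp c0.
pose L := \sum_i `|ln (r i 0)|.
have L0 : 0 <= L by apply: sumr_ge0.
pose B := q%:R * (q%:R + L + 2 * c) + q%:R.
have qp : 0 < q%:R :> K by rewrite ltr0n.
have B0 : 0 <= B by rewrite /B addr_ge0 ?mulr_ge0 ?addr_ge0 ?mulr_ge0.
(* With this [tau], the slope towards the barycentre [u] at a point having a
   coordinate [tau] is dominated by [q^-1 * ln tau], hence negative. *)
pose tau := expR (- B).
have t0 : 0 < tau := expR_gt0 _.
have tq : tau <= q%:R^-1.
  rewrite /tau expRN lef_pV2 ?posrE ?expR_gt0//.
  apply: le_trans (expR_ge1Dx _); rewrite /B.
  by have : 0 <= q%:R * (q%:R + L + 2 * c) by [rewrite mulr_ge0 ?addr_ge0 ?mulr_ge0]; lra.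
pose u : 'cV[K]_q := const_mx q%:R^-1.
have u1 : \sum_i u i 0 = 1.
  under eq_bigr do rewrite mxE.
  by rewrite sumr_const card_ord -[LHS]mulr_natr mulVf// gt_eqF.
have uT : trunc_simplex tau u by split => // i; rewrite mxE.
have cT := @trunc_simplex_compact K q tau (ltW t0).
have Tpos (x : 'cV[K]_q) : trunc_simplex tau x -> forall i, 0 < x i 0.
  by move=> [xt _] i; exact: lt_le_trans (xt i).
have cP : {within trunc_simplex tau, continuous (Phi R r c)}.
  apply: continuous_in_subspaceT => x; rewrite inE => xT.
  apply: (@cont2_slice K q (fun p => Phi R r p.1 p.2) c x).
  apply: cont2_Phi; first exact: Tpos.
  by apply: Rp; exact: Tpos.
have [phi phiT phimin] := compact_EVT_min (ex_intro _ _ uT) cT cP.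
rewrite inE in phiT.
have pmin (x : 'cV[K]_q) : trunc_simplex tau x -> Phi R r c phi <= Phi R r c x.
  by move=> xT; apply: phimin; rewrite inE.
have p0 := Tpos _ phiT; have [pt p1] := phiT.
exists tau => //; exists phi => //; split => // i.
rewrite lt_neqAle pt andbT; apply/negP => /eqP tphi.
pose v := u - phi.
have vt : tangent v := tangent_diff p1 u1.
have Qp : 0 < qform R phi by exact: Rp.
have seg (t : K) : 0 <= t <= 1 -> trunc_simplex tau (phi + t *: v).
  move=> /andP[t00 t1]; split=> [j|].
    rewrite !mxE; have := pt j => h1; have h2 := tq.
    have := ler_wpM2l t00 h2; have := ler_wpM2l (_ : 0 <= 1 - t) h1.
    rewrite subr_ge0 => /(_ t1); lra.
  under eq_bigr do rewrite !mxE.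
  rewrite big_split/= -big_distrr/= sumrB p1.
  have -> : \sum_(i < q) (q%:R^-1 : K) = 1 by rewrite -[RHS]u1; apply: eq_bigr => j _; rewrite mxE.
  by rewrite subrr mulr0 addr0.
have gd : hasderiv (fun s => Phi R r c (phi + s *: v)) 0 (dPhi R r c (phi + 0 *: v) v).
  by apply: Phi_path_deriv => //; rewrite scale0r addr0.
have dge : 0 <= dPhi R r c phi v.
  rewrite leNgt; apply/negP => dlt.
  have dlt' : dPhi R r c (phi + 0 *: v) v < 0 by rewrite scale0r addr0.
  have [d d0 hd] := deriv_neg_decr gd dlt'.
  pose s := Num.min 1 (d / 2).
  have s0 : 0 < s by rewrite lt_min ltr01 divr_gt0.
  have s1 : s <= 1 by rewrite ge_min lexx.
  have sd : s < d by apply: (@le_lt_trans _ _ (d / 2)); [rewrite ge_min lexx orbT|lra].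
  have := hd s; rewrite s0 sd add0r scale0r addr0 => /(_ isT).
  by rewrite ltNge pmin//; apply: seg; rewrite ltW.
have bu : 0 <= bil R u phi.
  rewrite bilE; apply: sumr_ge0 => j _; apply: sumr_ge0 => k _.
  by rewrite !mulr_ge0 ?(ltW (p0 k))// mxE invr_ge0.
have bv : - (c * (2 * bil R v phi / qform R phi)) <= 2 * c.
  have -> : bil R v phi = bil R u phi - qform R phi.
    have vE : v = u + (-1) *: phi by rewrite scaleN1r.
    by rewrite (bilC v phi Rs) vE bilDr mulN1r (bilC phi u Rs).
  have -> : - (c * (2 * (bil R u phi - qform R phi) / qform R phi))
      = 2 * c - 2 * (c * (bil R u phi / qform R phi)) by field; rewrite gt_eqF.
  by rewrite gerBl mulr_ge0// mulr_ge0// divr_ge0// ltW.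
have ple1 j : phi j 0 <= 1 by apply: simplex_le1 => // k; exact: ltW.
have lnp j : ln (phi j 0) <= 0 by apply: ln_le0.
have S1 : \sum_j v j 0 * ln (phi j 0) <= q%:R^-1 * ln tau + q%:R.
  apply: (@le_trans _ _ (\sum_j ((u j 0) * ln (phi j 0) + 1))).
    apply: ler_sum => j _; rewrite /v [(u - phi) j 0]mxE [(- phi) j 0]mxE.
    by apply: xlnx_le; [rewrite p0 ple1|rewrite mxE invr_ge0].
  rewrite big_split/= sumr_const card_ord lerD2r (bigD1 i)//= mxE -tphi gerDl.
  apply: sumr_le0 => j _; rewrite mxE; apply: mulr_ge0_le0 => //.
have S2 : - \sum_j v j 0 * ln (r j 0) <= L.
  apply: le_trans (ler_norm _) _; rewrite normrN.
  apply: (le_trans (ler_norm_sum _ _ _)); apply: ler_sum => j _.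
  rewrite normrM ler_piMl// /v !mxE ler_norml.
  have : q%:R^-1 <= 1 :> K by rewrite invf_le1// ler1n.
  have : 0 <= q%:R^-1 :> K by rewrite invr_ge0.
  have := ple1 j; have := ltW (p0 j); lra.
have lt : ln tau = - B by rewrite /tau expRK.
have qB : q%:R^-1 * ln tau = - (q%:R + L + 2 * c) - 1.
  by rewrite lt /B; field; rewrite gt_eqF.
move: dge; rewrite dPhi_tangent//; under eq_bigr do rewrite mulrBr.
rewrite sumrB; apply/negP; rewrite -ltNge.
rewrite qB in S1; clear -S1 S2 bv; lra.
Qed.

Lemma dPhiN (K : realType) (q : nat) (R : 'M[K]_q) (r : 'cV[K]_q) (c : K)
    (x v : 'cV[K]_q) : dPhi R r c x (- v) = - dPhi R r c x v.
Proof.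
rewrite /dPhi opprB [RHS]addrC -sumrN; congr (_ + _).
  by apply: eq_bigr => i _; rewrite !mxE mulNr.
have -> : bil R (- v) x = - bil R v x.
  by rewrite !bilE -sumrN; apply: eq_bigr => i _; rewrite -sumrN;
    apply: eq_bigr => j _; rewrite !mxE !mulNr.
by ring.
Qed.

(** The minimiser over the truncated simplex is interior to it, so the first and
    second order conditions hold in every tangent direction. *)
Lemma critical_exists (K : realType) (q : nat) (R : 'M[K]_q) (r : 'cV[K]_q) (c : K) :
  (0 < q)%N -> R^T = R -> (forall i j, 0 <= R i j) -> posmx R -> 0 <= c ->
  exists phi : 'cV[K]_q, [/\ open_simplex phi, critical R r c phi
    & forall v, tangent v -> 0 <= hess_form R c phi v].
Proof.
move=> q0 Rs R0 Rp c0.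
have [tau t0 [phi [pt p1] pmin]] := min_interior r q0 Rs R0 Rp c0.
have p0 i : 0 < phi i 0 := lt_trans t0 (pt i).
have dirs (v : 'cV[K]_q) : tangent v -> exists2 d : K, 0 < d &
    forall t, 0 <= t <= d -> trunc_simplex tau (phi + t *: v).
  move=> vt; have [d d0 hd] : exists2 d : K, 0 < d & forall i, forall t, 0 <= t <= d ->
      tau <= phi i 0 + t * v i 0.
    apply: fin_delta => [i d d' h d'0 d'd t /andP[t00 td]|i].
      by apply: h; rewrite t00 (le_trans td).
    have vp : 0 < 1 + `|v i 0| by rewrite ltr_pwDl.
    exists ((phi i 0 - tau) / (1 + `|v i 0|)); first by rewrite divr_gt0// subr_gt0.
    move=> t /andP[t00]; rewrite ler_pdivlMr// => h.
    have h2 := ler_wpM2l t00 (ler_norm (- v i 0)); rewrite normrN in h2.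
    by clear -h h2 t00; lra.
  exists d => // t td; split=> [i|]; first by rewrite !mxE; exact: hd.
  under eq_bigr do rewrite !mxE.
  by rewrite big_split/= -big_distrr/= p1 vt mulr0 addr0.
have pth (v : 'cV[K]_q) : tangent v -> exists2 d : K, 0 < d &
    forall t, 0 <= t <= d -> (forall i, 0 < (phi + t *: v) i 0)
      /\ Phi R r c phi <= Phi R r c (phi + t *: v).
  move=> /dirs[d d0 hd]; exists d => // t td; have xT := hd t td.
  by split; [move=> i; apply: lt_le_trans t0 _; case: xT|exact: pmin].
have dge (v : 'cV[K]_q) : tangent v -> 0 <= dPhi R r c phi v.
  move=> vt; have [d d0 hd] := pth v vt.
  have gd : hasderiv (fun s => Phi R r c (phi + s *: v)) 0 (dPhi R r c (phi + 0 *: v) v).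
    by apply: Phi_path_deriv => //; rewrite scale0r addr0//; exact: Rp.
  rewrite leNgt; apply/negP => dlt.
  have dlt' : dPhi R r c (phi + 0 *: v) v < 0 by rewrite scale0r addr0.
  have [e e0 he] := deriv_neg_decr gd dlt'.
  pose s := Num.min d (e / 2).
  have e2 : 0 < e / 2 by lra.
  have s0 : 0 < s by rewrite lt_min d0.
  have sd : s <= d by rewrite ge_min lexx.
  have se : s < e by apply: (@le_lt_trans _ _ (e / 2)); [rewrite ge_min lexx orbT|lra].
  have := he s; rewrite s0 se add0r scale0r addr0 => /(_ isT).
  have [_ h] : (forall i, 0 < (phi + s *: v) i 0) /\ Phi R r c phi <= Phi R r c (phi + s *: v).
    by apply: hd; rewrite ltW.
  by rewrite ltNge h.
have tN (v : 'cV[K]_q) : tangent v -> tangent (- v).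
  by rewrite /tangent => vt; under eq_bigr do rewrite mxE; rewrite sumrN vt oppr0.
have cr : critical R r c phi.
  move=> v vt; apply/eqP; rewrite eq_le dge// andbT.
  by have := dge _ (tN v vt); rewrite dPhiN oppr_ge0.
exists phi; split => // v vt; rewrite leNgt; apply/negP => hlt.
have [d d0 hd] := pth v vt.
have gd : hasderiv (fun s => dPhi R r c (phi + s *: v) v) 0 (hess_form R c (phi + 0 *: v) v).
  by apply: dPhi_path_deriv => //; rewrite scale0r addr0//; exact: Rp.
have hlt' : hess_form R c (phi + 0 *: v) v < 0 by rewrite scale0r addr0.
have [e e0 he] := deriv_neg_decr gd hlt'.
pose s := Num.min d (e / 2).
have e2 : 0 < e / 2 by lra.
have s0 : 0 < s by rewrite lt_min d0.
have sd : s <= d by rewrite ge_min lexx.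
have se : s < e by apply: (@le_lt_trans _ _ (e / 2)); [rewrite ge_min lexx orbT|lra].
have d1 (t : K) : 0 <= t <= s -> hasderiv (fun s => Phi R r c (phi + s *: v)) t
    (dPhi R r c (phi + t *: v) v).
  move=> /andP[t00 ts]; have [x0 _] : (forall i, 0 < (phi + t *: v) i 0)
      /\ Phi R r c phi <= Phi R r c (phi + t *: v).
    by apply: hd; rewrite t00 (le_trans ts).
  by apply: Phi_path_deriv => //; exact: Rp.
have [u /andP[u0 us]] := MVT_closed s0 d1.
have [_ h] : (forall i, 0 < (phi + s *: v) i 0) /\ Phi R r c phi <= Phi R r c (phi + s *: v).
  by apply: hd; rewrite ltW.
have := he u; rewrite u0 (lt_trans us)// => /(_ isT).
rewrite add0r scale0r addr0 cr// => hu0.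
rewrite subr0 => hE; have : dPhi R r c (phi + u *: v) v * s < 0 by rewrite nmulr_rlt0.
by rewrite -hE subr_lt0 ltNge h.
Qed.

Lemma convex_from_det (K : realType) (d : nat) (R : 'M[K]_d.+1) (r : 'cV[K]_d.+1) (c : K) :
  R^T = R -> (forall i j, 0 <= R i j) -> posmx R -> 0 <= c ->
  (forall x, open_simplex x -> \det (hess0 R c x) != 0) ->
  convex_at R c /\ exists2 phi, open_simplex phi & critical R r c phi.
Proof.
move=> Rs R0 Rp c0 hd.
have [phi [po pc ph]] := critical_exists r (ltn0Sn d) Rs R0 Rp c0.
have pd : posdef (hess0 R c phi) := posdef_hess0_psd Rs (proj1 po) ph (hd _ po).
split; last by exists phi.
move=> x xo; exact: posdef_propagate Rs Rp hd po xo pd.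
Qed.

(** At [c = 0] only the diagonal part of the Hessian survives. *)
Lemma convex_at0 (K : realType) (d : nat) (R : 'M[K]_d.+1) :
  R^T = R -> convex_at R 0.
Proof.
move=> Rs x xo; have [x0 x1] := xo; apply: (posdef_hess0 Rs x0) => v vt v0.
rewrite /hess_form mulr0 mul0r mul0r addr0.
have [i vi] : exists i, v i 0 != 0.
  apply/existsP; apply: contra_neqT v0 => /existsPn h.
  by apply/colP => i; rewrite mxE; apply/eqP; rewrite -[_ == _]negbK h.
rewrite (bigD1 i)//= ltr_wpDr//; last by rewrite divr_gt0// exprn_even_gt0.
by apply: sumr_ge0 => j _; rewrite divr_ge0 ?sqr_ge0// ltW.
Qed.

(** Along a ray issued from a critical point a convex function increases. *)
Lemma convex_far (K : realType) (d : nat) (R : 'M[K]_d.+1) (r : 'cV[K]_d.+1)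
    (c : K) (phi x : 'cV[K]_d.+1) (t : K) :
  R^T = R -> posmx R -> convex_at R c -> 0 < t <= 1 ->
  open_simplex phi -> critical R r c phi -> open_simplex x ->
  Phi R r c (phi + t *: (x - phi)) <= Phi R r c x.
Proof.
move=> Rs Rp cv /andP[t0 t1] po pc xo.
have t01 : 0 <= t <= 1 by rewrite ltW.
have zo := segment_open po xo t01.
have h1 := Phi_convex r Rs Rp cv zo po.
have h2 := Phi_convex r Rs Rp cv zo xo.
have h3 := Phi_convex r Rs Rp cv po zo.
rewrite pc ?addr0 in h3; last exact: tangent_diff (proj2 po) (proj2 zo).
set z := phi + t *: (x - phi) in h1 h2 h3 *.
have vt : tangent (x - phi) := tangent_diff (proj2 po) (proj2 xo).
have dZ (a : K) : dPhi R r c z (a *: (x - phi)) = a * dPhi R r c z (x - phi).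
  rewrite /dPhi mulrBr big_distrr; congr (_ - _).
    by apply: eq_bigr => i _; rewrite /= !mxE; ring.
  have -> : bil R (a *: (x - phi)) z = a * bil R (x - phi) z.
    by rewrite /bil linearZ/= -!scalemxAl mxE.
  by ring.
have e1 : phi - z = (- t) *: (x - phi) by rewrite /z opprD addNKr scaleNr.
have e2 : x - z = (1 - t) *: (x - phi) by rewrite /z opprD addrA scalerBl scale1r.
rewrite e1 dZ in h1; rewrite e2 dZ in h2.
have D0 : 0 <= dPhi R r c z (x - phi).
  rewrite -(pmulr_rge0 _ t0) -oppr_le0 -mulNr.
  by have := le_trans h1 h3; rewrite gerDl.
by apply: le_trans h2; rewrite lerDl mulr_ge0// subr_ge0.
Qed.

(** * Local analysis at a critical point *)

Definition near_box (K : realType) (q : nat) (x0 : 'cV[K]_q) (delta : K)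
  (x : 'cV[K]_q) : Prop := forall i, `|x i 0 - x0 i 0| <= delta.

Lemma near_box_segment (K : realType) (q : nat) (x0 x y : 'cV[K]_q) (delta t : K) :
  near_box x0 delta x -> near_box x0 delta y -> 0 <= t <= 1 ->
  near_box x0 delta (x + t *: (y - x)).
Proof.
move=> hx hy /andP[t0 t1] i; rewrite !mxE.
move: (hx i) (hy i); move: (x i 0) (y i 0) (x0 i 0) => u v w.
rewrite !ler_norml => /andP[a1 a2] /andP[b1 b2].
have u1 : 0 <= 1 - t by lra.
have := ler_wpM2l t0 b1; have := ler_wpM2l t0 b2.
have := ler_wpM2l u1 a1; have := ler_wpM2l u1 a2.
rewrite !mulrBr !mulrBl !mul1r.
by move=> *; apply/andP; split; lra.
Qed.

Lemma near_box_le (K : realType) (q : nat) (x0 x : 'cV[K]_q) (d1 d2 : K) :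
  d1 <= d2 -> near_box x0 d1 x -> near_box x0 d2 x.
Proof. by move=> h hx i; apply: le_trans h. Qed.

(** Taylor expansion along the segment, with the Hessian frozen at [(c0, x0)].
    The error is absorbed in the factor [eta] since the form is coercive. *)
Lemma Phi_sandwich (K : realType) (d : nat) (R : 'M[K]_d.+1) (r : 'cV[K]_d.+1)
    (c0 : K) (x0 : 'cV[K]_d.+1) (eta : K) :
  R^T = R -> posmx R -> (forall i, 0 < x0 i 0) -> posdef (hess0 R c0 x0) -> 0 < eta ->
  exists2 delta : K, 0 < delta & forall (c : K) (x y : 'cV[K]_d.+1),
    `|c - c0| <= delta -> near_box x0 delta x -> near_box x0 delta y ->
    open_simplex x -> open_simplex y ->
    (1 - eta) / 2 * hess_form R c0 x0 (y - x)
      <= Phi R r c y - Phi R r c x - dPhi R r c x (y - x)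
      <= (1 + eta) / 2 * hess_form R c0 x0 (y - x).
Proof.
move=> Rs Rp x00 pd e0; have [l l0 hl] := hess_coercive Rs x00 pd.
have le0 : 0 < eta * l by rewrite mulr_gt0.
have [dl dl0 hd] := hess_form_near c0 x00 (Rp _ x00) le0.
exists dl; [exact: dl0|move=> c x y cc bx by_ xo yo].
have vt := tangent_diff (proj2 xo) (proj2 yo).
set v := y - x; set H := hess_form R c0 x0 v.
have bnd (t : K) : 0 <= t <= 1 ->
    (1 - eta) * H <= hess_form R c (x + t *: (y - x)) (y - x) <= (1 + eta) * H.
  move=> t01; have := hd c _ cc (near_box_segment bx by_ t01) v.
  rewrite ler_norml -/v -/H => /andP[h1 h2].
  have := ler_wpM2l (ltW e0) (hl v vt); rewrite -/H !mulrA => h3.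
  by rewrite mulrBl mulrDl mul1r; apply/andP; split; lra.
have [h1 h2] := Phi_taylor r Rs Rp xo yo bnd.
move: h1 h2; rewrite -/v => h1 h2.
by apply/andP; split; lra.
Qed.

(** Moving from [phi] towards [x], one meets the boundary of the box of radius [e]. *)
Lemma box_exit (K : realType) (q : nat) (phi x : 'cV[K]_q) (e : K) : 0 < e ->
  ~ near_box phi e x -> exists t : K, [/\ 0 < t, t < 1,
    near_box phi e (phi + t *: (x - phi))
  & e ^+ 2 <= \sum_i (t *: (x - phi)) i 0 ^+ 2].
Proof.
move=> e0 hx.
have [i0 hi0] : exists i, e < `|x i 0 - phi i 0|.
  by apply: contrapT => h; apply: hx => i; rewrite leNgt; apply/negP => hi; apply: h; exists i.
have [im _ him] := @Order.TotalTheory.arg_maxP _ _ _ i0 predT (fun i => `|x i 0 - phi i 0|) isT.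
set D := `|x im 0 - phi im 0| in him.
have De : e < D by apply: lt_le_trans hi0 (him _ isT).
have D0 : 0 < D by apply: lt_trans De.
exists (e / D); split; rewrite ?divr_gt0 ?ltr_pdivrMr ?mul1r//.
  move=> i; rewrite !mxE (_ : _ - phi i 0 = e / D * (x i 0 - phi i 0)); last by ring.
  rewrite normrM gtr0_norm ?divr_gt0// mulrAC ler_pdivrMr// ler_wpM2l ?(ltW e0)//.
  exact: him.
rewrite (bigD1 im)//= !mxE exprMn -(sqr_normr (x im 0 - phi im 0)) -/D -exprMn divfK ?gt_eqF//.
by rewrite lerDl; apply: sumr_ge0 => i _; exact: sqr_ge0.
Qed.

Lemma bil_bound (K : realType) (q : nat) (R : 'M[K]_q) (v x : 'cV[K]_q) :
  (forall i j, 0 <= R i j) -> (forall i, `|v i 0| <= 1) -> (forall i, `|x i 0| <= 1) ->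
  `|bil R v x| <= \sum_i \sum_j R i j.
Proof.
move=> R0 hv hx; rewrite bilE; apply: (le_trans (ler_norm_sum _ _ _)).
apply: ler_sum => i _; apply: (le_trans (ler_norm_sum _ _ _)).
apply: ler_sum => j _; rewrite !normrM (ger0_norm (R0 i j)).
rewrite -[leRHS]mulr1; apply: ler_pM => //; first exact: mulr_ge0.
by rewrite -[leRHS]mul1r ler_wpM2r.
Qed.

(** Where the segment from [x0] to the critical point [x] of [Phi_c] leaves a
    small box around [x0], the value of [Phi_c] is at most [Phi_c x0], by
    convexity. But there the quadratic growth of [Phi_c] from [x0] prevails over
    its slope at [x0], which is [O (c - c0)]. *)
Lemma critical_near (K : realType) (d : nat) (R : 'M[K]_d.+1) (r : 'cV[K]_d.+1)
    (c0 : K) (x0 : 'cV[K]_d.+1) (delta : K) :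
  R^T = R -> (forall i j, 0 <= R i j) -> posmx R -> open_simplex x0 ->
  posdef (hess0 R c0 x0) -> critical R r c0 x0 -> 0 < delta ->
  exists2 rho : K, 0 < rho & forall (c : K) (x : 'cV[K]_d.+1),
    `|c - c0| <= rho -> convex_at R c -> open_simplex x -> critical R r c x ->
    near_box x0 delta x.
Proof.
move=> Rs R0 Rp x0o pd x0c dl0; have x00 := proj1 x0o.
have [l l0 hl] := hess_coercive Rs x00 pd.
have h120 : 0 < 2^-1 :> K by rewrite invr_gt0.
have [d1 d10 hd] := Phi_sandwich r Rs Rp x00 pd h120.
pose e := Num.min delta d1.
have e0 : 0 < e by rewrite lt_min dl0.
have [e1 e2] : e <= delta /\ e <= d1 by rewrite /e !ge_min !lexx orbT.
set Q := qform R x0; have Q0 : 0 < Q by apply: Rp.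
pose B : K := \sum_i \sum_j R i j.
have B0 : 0 <= B by apply: sumr_ge0 => i _; apply: sumr_ge0.
pose g := l * e ^+ 2 / 4.
have g0 : 0 < g by rewrite /g divr_gt0// mulr_gt0// exprn_gt0.
pose M := 2 * B / Q + 1.
have M0 : 0 < M by rewrite ltr_wpDl// divr_ge0 ?mulr_ge0 ?(ltW Q0).
exists (Num.min d1 (g / (2 * M))).
  by rewrite lt_min d10 divr_gt0// mulr_gt0.
move=> c x; rewrite le_min => /andP[cc cg] cv xo xc.
apply: contrapT => hx.
have {}hx : ~ near_box x0 e x by move=> h; apply: hx; apply: near_box_le h.
have [t [t0 t1 hz hzs]] := box_exit e0 hx.
set z := x0 + t *: (x - x0) in hz.
have t01 : 0 <= t <= 1 by rewrite (ltW t0) (ltW t1).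
have zo : open_simplex z := segment_open x0o xo t01.
have zE : z = x + (1 - t) *: (x0 - x).
  by apply/matrixP => i j; rewrite !mxE; ring.
have t01' : 0 < 1 - t <= 1 by apply/andP; split; lra.
have h1 : Phi R r c z <= Phi R r c x0.
  by rewrite zE; exact: (convex_far Rs Rp cv t01' xo xc x0o).
have h0 : near_box x0 d1 x0 by move=> i; rewrite subrr normr0 ltW.
have := hd c x0 z cc h0 (near_box_le e2 hz) x0o zo => /andP[h2 _].
have zv : z - x0 = t *: (x - x0) by rewrite /z addrC addKr.
have vt : tangent (z - x0) := tangent_diff (proj2 x0o) (proj2 zo).
have h3 := hl _ vt.
have h4 : l * e ^+ 2 <= hess_form R c0 x0 (z - x0).
  by apply: le_trans h3; rewrite ler_wpM2l ?(ltW l0)// zv.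
have h5 : dPhi R r c x0 (z - x0) = - (c - c0) * (2 * bil R (z - x0) x0 / Q).
  have := x0c _ vt; rewrite !dPhi_tangent// -/Q => /eqP; rewrite subr_eq0 => /eqP ->.
  by ring.
have bb : `|bil R (z - x0) x0| <= B.
  apply: bil_bound => // i; last first.
    by rewrite gtr0_norm//; exact: (simplex_le1 i (fun j => ltW (x00 j)) (proj2 x0o)).
  exact: simplex_diff_le1 x0o zo.
have h6 : `|dPhi R r c x0 (z - x0)| <= g / 2.
  rewrite h5 mulNr normrN normrM.
  apply: (@le_trans _ _ (g / (2 * M) * M)); last first.
    by rewrite invfM mulrA divfK ?gt_eqF.
  apply: ler_pM => //.
  rewrite normrM normrV ?unitfE ?gt_eqF// (gtr0_norm Q0) normrM ger0_norm//.
  apply: (@le_trans _ _ (2 * B / Q)); last by rewrite lerDl.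
  by rewrite ler_wpM2r ?invr_ge0 ?(ltW Q0)// ler_wpM2l.
move: h6; rewrite ler_norml => /andP[h6 _].
move: h1 h2 h4 h6 g0; rewrite /g.
move: (Phi _ _ _ _) (Phi _ _ _ _) (dPhi _ _ _ _ _) (hess_form _ _ _ _) (l * e ^+ 2).
by clear; move=> *; lra.
Qed.

Lemma ln_le_sub1 (K : realType) (y : K) : 0 < y -> ln y <= y - 1.
Proof.
move=> y0; have := @le_ln1Dx K (y - 1); rewrite addrCA subrr addr0; apply.
by rewrite ltrBDr addrC subrr.
Qed.

(** Convexity of [x ln x], with its value [0] at [0]. *)
Lemma xlnx_tangent (K : realType) (x u : K) : 0 <= x -> 0 < u ->
  u * ln u + (ln u + 1) * (x - u) <= x * ln x.
Proof.
move=> x0 u0; have [->|xn] := eqVneq x 0; first by rewrite mul0r; lra.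
have xp : 0 < x by rewrite lt_neqAle eq_sym xn.
have := @ln_le_sub1 K (u / x); rewrite divr_gt0// => /(_ isT).
rewrite ln_div ?posrE// => /(ler_wpM2l x0).
rewrite !mulrBr mulr1 (mulrCA x) mulfV// mulr1; lra.
Qed.

Definition entropy_cost (K : realType) (q : nat) (r x : 'cV[K]_q) : K :=
  \sum_i x i 0 * (ln (x i 0) - ln (r i 0)).

Lemma entropy_cost_range (K : realType) (q : nat) (r x : 'cV[K]_q) :
  simplex x -> - (q%:R + \sum_i `|ln (r i 0)|) <= entropy_cost r x
  /\ entropy_cost r x <= \sum_i `|ln (r i 0)|.
Proof.
move=> [x0 x1].
have b i : - (1 + `|ln (r i 0)|) <= x i 0 * (ln (x i 0) - ln (r i 0))
           /\ x i 0 * (ln (x i 0) - ln (r i 0)) <= `|ln (r i 0)|.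
  have xi0 := x0 i; have xi1 := simplex_le1 i x0 x1.
  have h1 := @xlnx_tangent K _ 1 xi0 ltr01; rewrite ln1 in h1.
  have h2 : x i 0 * ln (x i 0) <= 0.
    have [->|xn] := eqVneq (x i 0) 0; first by rewrite mul0r.
    apply: mulr_ge0_le0 => //; rewrite -ln1 ler_ln ?posrE//.
    by rewrite lt_neqAle eq_sym xn.
  have h3 : `|x i 0 * ln (r i 0)| <= `|ln (r i 0)|.
    by rewrite normrM (ger0_norm xi0) ler_piMl.
  move: h3; rewrite ler_norml mulrBr => /andP[h3 h4].
  by split; lra.
split; last by apply: ler_sum => i _; case: (b i).
apply: (@le_trans _ _ (\sum_i - (1 + `|ln (r i 0)|))); last by apply: ler_sum => i _; case: (b i).
by rewrite sumrN big_split/= sumr_const card_ord.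
Qed.

Lemma entropy_cost_convex (K : realType) (q : nat) (r x y : 'cV[K]_q) (t : K) :
  simplex x -> open_simplex y -> 0 < t <= 1 ->
  entropy_cost r (x + t *: (y - x)) <= (1 - t) * entropy_cost r x + t * entropy_cost r y.
Proof.
move=> [x0 _] [y0 _] /andP[t0 t1]; rewrite /entropy_cost !big_distrr -big_split/=.
apply: ler_sum => i _; rewrite !mxE.
move: (x i 0) (y i 0) (ln (r i 0)) (x0 i) (y0 i) => {x0 y0}a b l a0 b0.
set u := a + _.
have uE : u = (1 - t) * a + t * b by rewrite /u; ring.
have t1' : 0 <= 1 - t by lra.
have u0 : 0 < u by rewrite uE ltr_wpDl ?mulr_ge0// mulr_gt0.
have h1 := ler_wpM2l t1' (xlnx_tangent a0 u0).
have h2 := ler_wpM2l (ltW t0) (xlnx_tangent (ltW b0) u0).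
have -> : u * (ln u - l) = (1 - t) * (u * ln u + (ln u + 1) * (a - u))
    + t * (u * ln u + (ln u + 1) * (b - u)) - u * l by rewrite uE; ring.
have -> : (1 - t) * (a * (ln a - l)) + t * (b * (ln b - l))
   = (1 - t) * (a * ln a) + t * (b * ln b) - u * l by rewrite uE; ring.
by rewrite lerB// lerD.
Qed.

Lemma qform_mono (K : realType) (q : nat) (R : 'M[K]_q) (x y : 'cV[K]_q) (s : K) :
  (forall i j, 0 <= R i j) -> 0 <= s -> (forall i, 0 <= x i 0) ->
  (forall i, s * x i 0 <= y i 0) -> s ^+ 2 * qform R x <= qform R y.
Proof.
move=> R0 s0 x0 h; rewrite !qformE big_distrr/=; apply: ler_sum => i _.
rewrite big_distrr/=; apply: ler_sum => j _.
have sx k : 0 <= s * x k 0 by apply: mulr_ge0.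
have hh := ler_wpM2l (R0 i j) (ler_pM (sx i) (sx j) (h i) (h j)).
have -> : s ^+ 2 * (x i 0 * x j 0 * R i j) = R i j * (s * x i 0 * (s * x j 0)) by ring.
by rewrite [leRHS]mulrC.
Qed.

(** Moving a point of the closed simplex slightly towards an interior point
    costs little. This replaces continuity of [Phi_c], which fails on the
    boundary where the quadratic form vanishes: the form is at least multiplied
    by [(1 - t) ^ 2]. *)
Lemma Phi_blend (K : realType) (q : nat) (R : 'M[K]_q) (r : 'cV[K]_q)
    (c : K) (x phi : 'cV[K]_q) (t : K) :
  (forall i j, 0 <= R i j) -> 0 <= c -> simplex x -> open_simplex phi ->
  0 < t <= 1 / 2 -> c = 0 \/ 0 < qform R x ->
  Phi R r c (x + t *: (phi - x))
    <= Phi R r c x + t * (q%:R + 2 * \sum_i `|ln (r i 0)| + 4 * c).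
Proof.
move=> R0 c0 xs po /andP[t0 t1] hq.
have t01 : 0 < t <= 1 by rewrite t0; lra.
have ec := entropy_cost_convex r xs po t01.
have [a1 a2] := entropy_cost_range r xs.
have ps : simplex phi by split; [move=> i; exact: ltW (proj1 po i)|exact: (proj2 po)].
have [b1 b2] := entropy_cost_range r ps.
rewrite /Phi -/(entropy_cost r x) -/(entropy_cost r (x + t *: (phi - x))).
set L := \sum_i `|_| in a1 a2 b1 b2 *.
have hl : - (c * ln (qform R (x + t *: (phi - x)))) <= - (c * ln (qform R x)) + 4 * c * t.
  case: hq => [->|Q0]; first by rewrite !(mul0r, mulr0, oppr0, add0r).
  have s0 : 0 < 1 - t by lra.
  have hm : (1 - t) ^+ 2 * qform R x <= qform R (x + t *: (phi - x)).
    apply: qform_mono => //; [exact: ltW|exact: (proj1 xs)|move=> i].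
    rewrite !mxE; have -> : x i 0 + t * (phi i 0 - x i 0) = (1 - t) * x i 0 + t * phi i 0 by ring.
    by rewrite lerDl mulr_ge0 ?(ltW t0)// ltW// (proj1 po).
  have p0 : 0 < (1 - t) ^+ 2 * qform R x by rewrite mulr_gt0// exprn_gt0.
  have h1 : ln ((1 - t) ^+ 2 * qform R x) <= ln (qform R (x + t *: (phi - x))).
    by rewrite ler_ln ?posrE// (lt_le_trans p0).
  rewrite lnM ?posrE ?exprn_gt0// lnXn// in h1.
  have i0 : 0 < (1 - t)^-1 by rewrite invr_gt0.
  have h2 := ln_le_sub1 i0; rewrite lnV ?posrE// in h2.
  have h3 : (1 - t)^-1 - 1 <= 2 * t.
    rewrite lerBlDr -[leLHS]mul1r ler_pdivrMr//.
    have -> : (2 * t + 1) * (1 - t) = 1 + t * (1 - 2 * t) by ring.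
    by rewrite lerDl mulr_ge0 ?(ltW t0)//; lra.
  have h4 : ln (qform R x) - 4 * t <= ln (qform R (x + t *: (phi - x))).
    rewrite -mulr_natl in h1; lra.
  have := ler_wpM2l c0 h4; rewrite mulrBr; lra.
have h5 : t * (entropy_cost r phi - entropy_cost r x) <= t * (q%:R + 2 * L).
  by rewrite ler_wpM2l ?(ltW t0)//; lra.
clear -h5 ec hl; clearbody L; move: h5 ec hl; move: (entropy_cost _ _) (entropy_cost _ _) (entropy_cost _ _) (ln _) (ln _).
by move=> *; lra.
Qed.

(** Close to the critical point, [Phi_c] is quadratic up to a factor
    [1 + eta] or [1 - eta]. Farther away, convexity propagates the growth
    reached on the boundary of a box, and [Phi_blend] extends this to the
    boundary of the simplex. The constants do not depend on [c] near [c0]. *)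
Lemma Phi_local (K : realType) (d : nat) (R : 'M[K]_d.+1) (r : 'cV[K]_d.+1)
    (c0 : K) (x0 : 'cV[K]_d.+1) (eta dl0 : K) :
  R^T = R -> (forall i j, 0 <= R i j) -> posmx R -> 0 <= c0 ->
  open_simplex x0 -> posdef (hess0 R c0 x0) -> critical R r c0 x0 ->
  0 < eta -> 0 < dl0 ->
  exists delta rho kap : K, [/\ 0 < delta <= dl0, 0 < rho, 0 < kap &
    forall (c : K) (phi : 'cV[K]_d.+1), 0 <= c -> `|c - c0| <= rho -> convex_at R c ->
      open_simplex phi -> critical R r c phi ->
      [/\ near_box x0 (delta / 2) phi,
          forall x : 'cV[K]_d.+1, open_simplex x -> near_box x0 delta x ->
            (1 - eta) / 2 * hess_form R c0 x0 (x - phi) <= Phi R r c x - Phi R r c phi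
              <= (1 + eta) / 2 * hess_form R c0 x0 (x - phi)
        & forall x : 'cV[K]_d.+1, simplex x -> ~ near_box x0 delta x ->
            c = 0 \/ 0 < qform R x -> Phi R r c phi + kap <= Phi R r c x]].
Proof.
move=> Rs R0 Rp c00 x0o pd x0c e0 dl00; have x00 := proj1 x0o.
have [l l0 hl] := hess_coercive Rs x00 pd.
have h120 : 0 < 2^-1 :> K by rewrite invr_gt0.
have [d1 d10 hd1] := Phi_sandwich r Rs Rp x00 pd h120.
have [d2 d20 hd2] := Phi_sandwich r Rs Rp x00 pd e0.
pose de := Num.min dl0 (Num.min d1 d2).
have de0 : 0 < de by rewrite !lt_min dl00 d10.
have [ea eb ec] : [/\ de <= dl0, de <= d1 & de <= d2].
  by rewrite /de !ge_min !lexx !orbT.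
clearbody de.
(* Boxes of radius [e] about a point at distance [e] from [x0] stay well inside
   the box of radius [de] about [x0]. *)
pose e := de / 8; have e80 : 0 < e by rewrite divr_gt0.
pose g := l * e ^+ 2 / 4.
have g0 : 0 < g by rewrite /g divr_gt0// mulr_gt0// exprn_gt0.
have [rh rh0 hrh] := critical_near Rs R0 Rp x0o pd x0c e80.
pose B := d.+1%:R + 2 * \sum_i `|ln (r i 0)| + 4 * (c0 + 1).
have B0 : 0 < B.
  rewrite ltr_wpDl ?mulr_gt0//; last by lra.
  by rewrite addr_ge0// mulr_ge0// sumr_ge0.
pose t := Num.min (1 / 2) (Num.min e (g / (2 * B))).
have t0 : 0 < t.
  rewrite /t !lt_min e80/= divr_gt0//=.
  by rewrite divr_gt0// mulr_gt0.
have [t1 t2 t3] : [/\ t <= 1 / 2, t <= e & t <= g / (2 * B)].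
  by rewrite /t !ge_min !lexx !orbT.
clearbody t.
exists de, (Num.min 1 (Num.min rh de)), (g / 2).
split; [by rewrite de0 ea| |by rewrite divr_gt0|].
  by rewrite lt_min ltr01 lt_min rh0 de0.
move=> c phi c_0; rewrite !le_min => /andP[c1 /andP[crh cde]] cv po pc.
have pb : near_box x0 e phi := hrh c phi crh cv po pc.
have ede : e <= de by rewrite /e; clear -de0; lra.
have cle : c <= c0 + 1 by move: c1; rewrite ler_norml => /andP[_]; clear; lra.
split.
- by apply: near_box_le pb; rewrite /e; clear -de0; lra.
- move=> x xo xb.
  have := hd2 c phi x (le_trans cde ec) (near_box_le (le_trans ede ec) pb)
     (near_box_le ec xb) po xo.
  by rewrite (pc _ (tangent_diff (proj2 po) (proj2 xo))) subr0.
have far x : open_simplex x -> ~ near_box phi e x -> Phi R r c phi + g <= Phi R r c x.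
  move=> xo hx; have [s [s0 s1 hz hzs]] := box_exit e80 hx.
  set z := phi + s *: (x - phi) in hz.
  have s01 : 0 <= s <= 1 by rewrite (ltW s0) (ltW s1).
  have s01' : 0 < s <= 1 by rewrite s0 (ltW s1).
  have zo : open_simplex z := segment_open po xo s01.
  have zb : near_box x0 d1 z.
    move=> i; move: (hz i) (pb i); rewrite !ler_norml /e.
    by clear -de0 eb => /andP[? ?] /andP[? ?]; apply/andP; split; lra.
  have h1 := convex_far Rs Rp cv s01' po pc xo; rewrite -/z in h1.
  have := hd1 c phi z (le_trans cde eb) (near_box_le (le_trans ede eb) pb) zb po zo.
  have vt : tangent (z - phi) := tangent_diff (proj2 po) (proj2 zo).
  rewrite (pc _ vt) subr0 => /andP[h2 _].
  have zv : z - phi = s *: (x - phi) by rewrite /z addrC addKr.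
  have h4 : l * e ^+ 2 <= hess_form R c0 x0 (z - phi).
    by apply: le_trans (hl _ vt); rewrite ler_wpM2l ?(ltW l0)// zv.
  move: h1 h2 h4; rewrite /g.
  move: (Phi _ _ _ _) (Phi _ _ _ _) (Phi _ _ _ _) (hess_form _ _ _ _) (l * e ^+ 2).
  by clear; move=> *; lra.
move=> x xs hx hq.
have tt : 0 < t <= 1 / 2 by rewrite t0.
have hb := Phi_blend r R0 c_0 xs po tt hq.
have yo : open_simplex (x + t *: (phi - x)).
  split=> [i|].
    rewrite !mxE; have -> : x i 0 + t * (phi i 0 - x i 0) = (1 - t) * x i 0 + t * phi i 0 by ring.
    rewrite ltr_wpDl ?mulr_gt0 ?(proj1 po)// mulr_ge0 ?(proj1 xs)//; lra.
  under eq_bigr do rewrite !mxE.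
  by rewrite big_split/= -big_distrr/= sumrB (proj2 xs) (proj2 po) subrr mulr0 addr0.
have yf : ~ near_box phi e (x + t *: (phi - x)).
  move=> hy; apply: hx => i; move: (hy i) (pb i); rewrite !mxE.
  have : `|t * (phi i 0 - x i 0)| <= e.
    rewrite normrM (gtr0_norm t0) -[leRHS]mulr1; apply: ler_pM (ltW t0) _ t2 _ => //.
    have := simplex_le1 i (proj1 xs) (proj2 xs); have := proj1 xs i.
    have := simplex_le1 i (fun j => ltW (proj1 po j)) (proj2 po); have := proj1 po i.
    by clear; rewrite ler_norml => *; apply/andP; split; lra.
  rewrite !ler_norml /e; clear -de0 => /andP[? ?] /andP[? ?] /andP[? ?].
  by apply/andP; split; lra.
have h1 := far _ yo yf.
have h2 : t * (d.+1%:R + 2 * \sum_i `|ln (r i 0)| + 4 * c) <= g / 2.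
  apply: (@le_trans _ _ (t * B)); first by rewrite ler_wpM2l ?(ltW t0)// /B; lra.
  by move: t3; rewrite invfM mulrA ler_pdivlMr.
move: h1 h2 hb; clear; lra.
Qed.

(** * The saddle point method *)

Definition cfreq (K : realType) (q n : nat) (g : 'I_q -> nat) : 'cV[K]_q :=
  \col_i ((g i)%:R / n%:R).

Definition near_boxb (K : realType) (q : nat) (x0 : 'cV[K]_q) (delta : K)
  (x : 'cV[K]_q) : bool := [forall i, `|x i 0 - x0 i 0| <= delta].

Lemma near_boxP (K : realType) (q : nat) (x0 : 'cV[K]_q) (delta : K) (x : 'cV[K]_q) :
  reflect (near_box x0 delta x) (near_boxb x0 delta x).
Proof. exact: forallP. Qed.

Definition lap_term (K : realType) (q : nat) (R : 'M[K]_q) (r : 'cV[K]_q) (n m : nat)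
    (g : 'I_q -> nat) : K :=
  (\prod_i r i 0 ^+ g i) * qform R (cfreq K n g) ^+ m.

Lemma expR_ln_exp (K : realType) (x : K) (k : nat) : k = 0%N \/ 0 < x ->
  expR (k%:R * ln x) = x ^+ k.
Proof.
case=> [->|x0]; first by rewrite mul0r expR0 expr0.
by rewrite expRM_natl lnK ?posrE.
Qed.

Lemma cfreq_simplex (K : realType) (q n : nat) (g : 'I_q -> nat) : (0 < n)%N ->
  (\sum_i g i = n)%N -> simplex (cfreq K n g).
Proof.
move=> n0 gs; split=> [i|]; first by rewrite mxE divr_ge0.
under eq_bigr do rewrite mxE.
by rewrite -big_distrl/= -natr_sum gs divff// pnatr_eq0 -lt0n.
Qed.

Lemma expR_Phi (K : realType) (q : nat) (R : 'M[K]_q) (r : 'cV[K]_q) (n m : nat)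
    (g : 'I_q -> nat) : (0 < n)%N -> (forall i, 0 < r i 0) ->
  m = 0%N \/ 0 < qform R (cfreq K n g) ->
  lap_term R r n m g = expR (- (n%:R * Phi R r (m%:R / n%:R) (cfreq K n g)))
    * \prod_i ((g i)%:R / n%:R) ^+ g i.
Proof.
move=> n0 r0 hq; have nn : n%:R != 0 :> K by rewrite pnatr_eq0 -lt0n.
have xE i : ((g i)%:R / n%:R) ^+ g i = expR ((g i)%:R * ln ((g i)%:R / n%:R)) :> K.
  rewrite expR_ln_exp//; case: (posnP (g i)) => [->|gi]; [by left|right].
  by rewrite divr_gt0// ltr0n.
under eq_bigr do rewrite xE.
rewrite /lap_term -(expR_ln_exp hq) -expR_sum.
under eq_bigr do rewrite -(@expR_ln_exp _ _ (g _) (or_intror (r0 _))).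
rewrite -expR_sum -!expRD; congr expR.
have S1 : n%:R * (\sum_i cfreq K n g i 0 * (ln (cfreq K n g i 0) - ln (r i 0)))
    = \sum_i (g i)%:R * ln ((g i)%:R / n%:R) - \sum_i (g i)%:R * ln (r i 0).
  rewrite big_distrr/= -sumrB; apply: eq_bigr => i _; rewrite mxE.
  by rewrite mulrA (mulrCA n%:R) mulfV// mulr1 mulrBr.
rewrite /Phi mulrBr S1 mulrA (mulrCA n%:R) mulfV// mulr1; ring.
Qed.

(** The exponential is the weight divided by [\prod_i x_i ^ g_i], and
    [multinom_le1] says that the multinomial coefficient is at most the inverse
    of this product. *)
Lemma lap_term_far (K : realType) (q : nat) (R : 'M[K]_q) (r : 'cV[K]_q) (n m : nat)
    (g : 'I_q -> nat) : (0 < n)%N -> (forall i, 0 < r i 0) -> (\sum_i g i = n)%N ->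
  m = 0%N \/ 0 < qform R (cfreq K n g) ->
  multinom K n g * lap_term R r n m g
    <= expR (- (n%:R * Phi R r (m%:R / n%:R) (cfreq K n g))).
Proof.
move=> n0 r0 gs hq; rewrite expR_Phi// mulrCA -[leRHS]mulr1 ler_wpM2l ?expR_ge0//.
exact: multinom_le1.
Qed.

Lemma multinom_gt0 (K : realType) (q n : nat) (g : 'I_q -> nat) : 0 < multinom K n g.
Proof.
by rewrite /multinom divr_gt0 ?ltr0n ?fact_gt0// prodr_gt0// => i _; rewrite ltr0n fact_gt0.
Qed.

Lemma lap_term_near (K : realType) (d : nat) : exists sigma : K,
  forall (R : 'M[K]_d.+1) (r : 'cV[K]_d.+1) (eps delta : K),
  (forall i, 0 < r i 0) -> 0 < eps -> 0 < delta -> exists N : nat,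
  forall (n m : nat) (g : 'I_d.+1 -> nat), (N <= n)%N -> (0 < n)%N -> (\sum_i g i = n)%N ->
    (forall i, delta <= cfreq K n g i 0) -> 0 < qform R (cfreq K n g) ->
    let w := - (d%:R * sigma) - d%:R / 2 * ln n%:R - 2^-1 * \sum_i ln (cfreq K n g i 0)
      - n%:R * Phi R r (m%:R / n%:R) (cfreq K n g) in
    expR (w - eps) <= multinom K n g * lap_term R r n m g
    /\ multinom K n g * lap_term R r n m g <= expR (w + eps).
Proof.
have [sigma Hs] := multinom_local K d; exists sigma => R r eps delta r0 e0 d0.
have [N HN] := Hs _ _ e0 d0; exists N => n m g Nn n0 gs hd Q0.
have hd' i : delta <= (g i)%:R / n%:R by have := hd i; rewrite mxE.
have := HN n g Nn n0 gs hd'; cbv zeta.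
rewrite expR_Phi//; last by right.
have xE i : ((g i)%:R / n%:R) ^+ g i = expR ((g i)%:R * ln ((g i)%:R / n%:R)) :> K.
  by rewrite expR_ln_exp//; right; apply: lt_le_trans (hd' i).
rewrite (eq_bigr _ (fun i _ => xE i)) -expR_sum.
have nn : n%:R != 0 :> K by rewrite pnatr_eq0 -lt0n.
have -> : n%:R * (\sum_i (g i)%:R / n%:R * ln ((g i)%:R / n%:R))
   = \sum_i (g i)%:R * ln ((g i)%:R / n%:R) :> K.
  rewrite big_distrr/=; apply: eq_bigr => i _.
  by rewrite mulrA (mulrCA n%:R) mulfV// mulr1.
have -> : \sum_i ln (cfreq K n g i 0) = \sum_i ln ((g i)%:R / n%:R).
  by apply: eq_bigr => i _; rewrite mxE.
have ME : expR (ln (multinom K n g)) = multinom K n g by rewrite lnK// posrE multinom_gt0.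
move: ME; move: (ln (multinom K n g)) => L <-.
move: (\sum_i _) (\sum_i _) (_ * Phi _ _ _ _) => A B C.
rewrite ler_norml -!expRD !ler_expR => /andP[? ?]; split; lra.
Qed.

Lemma sqrt_expR (K : realType) (x : K) : 0 < x -> Num.sqrt x = expR (ln x / 2).
Proof.
move=> x0; have e0 := expR_ge0 (ln x / 2).
rewrite -[RHS](ger0_norm e0) -sqrtr_sqr; congr Num.sqrt.
by rewrite expr2 -expRD -mulrDr [_^-1 + _](_ : _ = 1) ?mulr1 ?lnK//; field.
Qed.

(** Bookkeeping: the powers of [n] from Stirling's formula and from the Gaussian
    integral cancel. *)
Lemma gauss_const (K : realType) (d : nat) (sigma n u D w : K) (x : 'cV[K]_d.+1) :
  0 < n -> 0 < u -> 0 < D -> (forall i, 0 < x i 0) ->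
  expR (- (d%:R * sigma) - d%:R / 2 * ln n - 2^-1 * \sum_i ln (x i 0) - w)
    * (Num.sqrt (2 * pi / (u / n)) ^+ d / Num.sqrt D)
  = (Num.sqrt (2 * pi) * expR (- sigma)) ^+ d / Num.sqrt (D * \prod_i x i 0)
    * expR (- w) * Num.sqrt u^-1 ^+ d.
Proof.
move=> n0 u0 D0 x0.
have p0 : 0 < 2 * pi :> K by rewrite mulr_gt0// pi_gt0.
have X0 : 0 < \prod_i x i 0 by apply: prodr_gt0.
have -> : 2 * pi / (u / n) = 2 * pi * (n * u^-1).
  by rewrite invf_div.
rewrite !sqrtrM ?ltW// (sqrt_expR n0) (sqrt_expR X0) ln_prod//.
rewrite !exprMn -!expRM_natl invfM -expRN.
set a := Num.sqrt _; set b := Num.sqrt D; set e := Num.sqrt u^-1; set S := \sum_i _.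
rewrite (_ : expR (_ - w) = expR (d%:R * - sigma) * expR (- (d%:R * (ln n / 2)))
   * expR (- (S / 2)) * expR (- w)); last first.
  by rewrite -!expRD; congr expR; field.
rewrite (expRN (d%:R * (ln n / 2))).
have := expR_gt0 (d%:R * (ln n / 2)); move: (expR (d%:R * (ln n / 2))) => z z0.
have b0 : b != 0 by rewrite gt_eqF// sqrtr_gt0.
by field; rewrite b0 gt_eqF.
Qed.

(** The quadratic lower bound on the exponential, raised to the power [d + 1]. *)
Lemma poly_exp_small (K : realType) (d : nat) (kap eps : K) : 0 < kap -> 0 < eps ->
  exists N : nat, forall n, (N <= n)%N -> n.+1%:R ^+ d * expR (- (n%:R * kap)) <= eps.
Proof.
move=> k0 e0; pose l := kap / (2 * d.+1%:R).
have l0 : 0 < l by rewrite divr_gt0// mulr_gt0.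
pose e := Num.min 1 eps; have ep : 0 < e by rewrite lt_min ltr01.
have [e1 e2] : e <= 1 /\ e <= eps by rewrite /e !ge_min !lexx orbT.
clearbody e.
exists (Num.truncn (2 / (e * l ^+ 2))).+1 => n hn.
have n0 : (0 < n)%N by apply: leq_trans hn.
have nK : 0 < n%:R :> K by rewrite ltr0n.
have hn' : 2 / (e * l ^+ 2) <= n%:R.
  have h0 : 0 <= 2 / (e * l ^+ 2) by rewrite divr_ge0// mulr_ge0 ?sqr_ge0// ltW.
  by apply: (le_trans (ltW (truncnS_gt _))); rewrite ler_nat.
pose y := n.+1%:R * expR (- (2 * (n%:R * l))).
have y0 : 0 <= y by rewrite mulr_ge0 ?expR_ge0.
have ye : y <= e.
  rewrite /y expRN ler_pdivrMr ?expR_gt0//.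
  have h1 : (n%:R * l) ^+ 2 <= expR (2 * (n%:R * l)).
    have nl0 : 0 <= n%:R * l by rewrite mulr_ge0// ltW.
    have nle : n%:R * l <= expR (n%:R * l) by have := expR_ge1Dx (n%:R * l); lra.
    by rewrite expRM_natl; apply: lerXn2r; rewrite ?nnegrE ?expR_ge0.
  have h2 : n.+1%:R <= e * (n%:R * l) ^+ 2.
    apply: (@le_trans _ _ (2 * n%:R)).
      have : 1 <= n%:R :> K by rewrite ler1n.
      by rewrite -natr1; move: n%:R => z z1; lra.
    have -> : e * (n%:R * l) ^+ 2 = n%:R * (e * l ^+ 2) * n%:R by ring.
    by rewrite ler_wpM2r// -ler_pdivrMr// mulr_gt0// exprn_gt0//.
  by apply: (le_trans h2); rewrite ler_wpM2l// ltW.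
have yd : y ^+ d.+1 <= y by rewrite exprS ler_piMr// exprn_ile1// (le_trans ye).
apply: le_trans e2; apply: le_trans ye; apply: le_trans yd; rewrite /y exprMn -expRM_natl.
have -> : d.+1%:R * - (2 * (n%:R * l)) = - (n%:R * kap).
  have : d.+1%:R != 0 :> K by rewrite pnatr_eq0.
  by rewrite /l; move: (d.+1%:R) => z z0; field.
rewrite ler_wpM2r ?expR_ge0// exprS ler_peMl ?exprn_ge0//.
by rewrite ler1n.
Qed.

Lemma sum_freq_by_cnt (K : realType) (d n m : nat) (R : 'M[K]_d.+1) (r : 'cV[K]_d.+1)
    (P : pred 'cV[K]_d.+1) :
  \sum_(t : {ffun 'I_n -> 'I_d.+1} | P (freq K t))
     (\prod_u r (t u) 0) * qform R (freq K t) ^+ m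
  = \sum_(k : 'cV['I_n.+1]_d | (\sum_j k j ord0 <= n)%N && P (cfreq K n (full_cnt k)))
     multinom K n (full_cnt k) * lap_term R r n m (full_cnt k).
Proof.
rewrite big_mkcondr/= big_mkcond/=.
rewrite (eq_bigr (fun t => (fun g => if P (cfreq K n g) then lap_term R r n m g else 0)
   (cnt t))); last by move=> t _; rewrite (prod_cnt t (fun i => r i 0)).
rewrite (sum_by_cnt n (fun g => if P (cfreq K n g) then lap_term R r n m g else 0)).
by apply: eq_bigr => k _; case: ifP => _; rewrite ?mulr0.
Qed.

Lemma row'_cfreq (K : realType) (d n : nat) (k : 'cV['I_n.+1]_d) :
  row' ord0 (cfreq K n (full_cnt k)) = n%:R^-1 *: vnat K k.
Proof. by apply/colP => j; rewrite !mxE /full_cnt liftK mulrC. Qed.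

Lemma qform_scale (K : realType) (q : nat) (H : 'M[K]_q) (a : K) (y : 'cV[K]_q) :
  qform H (a *: y) = a ^+ 2 * qform H y.
Proof.
rewrite !qformE big_distrr/=; apply: eq_bigr => i _; rewrite big_distrr/=.
by apply: eq_bigr => j _; rewrite !mxE; ring.
Qed.

Lemma row'_cfreq_sub (K : realType) (d n : nat) (k : 'cV['I_n.+1]_d) (phi : 'cV[K]_d.+1) :
  (0 < n)%N -> row' ord0 (cfreq K n (full_cnt k) - phi)
    = n%:R^-1 *: (vnat K k - n%:R *: row' ord0 phi) :> 'cV[K]_d.
Proof.
move=> n0; rewrite scalerBr scalerA mulVf ?pnatr_eq0 -?lt0n// scale1r -row'_cfreq.
by apply/colP => j; rewrite !mxE.
Qed.

(** The window constrains all coordinates but the first, which is then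
    controlled since the coordinates add up to [1]. *)
Lemma window_near (K : realType) (d n : nat) (phi : 'cV[K]_d.+1) (D : K)
    (k : 'cV['I_n.+1]_d) : (0 < n)%N -> open_simplex phi -> 0 <= D ->
  d%:R * D <= phi ord0 0 -> in_window (n%:R *: row' ord0 phi) (D * n%:R) k ->
  (\sum_j k j ord0 <= n)%N /\ near_box phi (d.+1%:R * D) (cfreq K n (full_cnt k)).
Proof.
move=> n0 [p0 p1] D0 Dp /forallP hw.
have nK : 0 < n%:R :> K by rewrite ltr0n.
have hj (j : 'I_d) : `|(k j 0)%:R / n%:R - phi (lift ord0 j) 0| <= D.
  have -> : (k j 0)%:R / n%:R - phi (lift ord0 j) 0
    = ((k j 0)%:R - n%:R * phi (lift ord0 j) 0) / n%:R by field; rewrite gt_eqF.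
  rewrite normrM normfV (gtr0_norm nK) ler_pdivrMr//.
  by have := hw j; rewrite !mxE.
rewrite big_ord_recl in p1.
have hs : `|\sum_(j < d) (k j 0)%:R / n%:R - (1 - phi ord0 0)| <= d%:R * D.
  have -> : 1 - phi ord0 0 = \sum_(j < d) phi (lift ord0 j) 0.
    by rewrite -p1 addrC addKr.
  rewrite -sumrB.
  apply: (le_trans (ler_norm_sum _ _ _)).
  apply: (@le_trans _ _ (\sum_(j < d) D)); first by apply: ler_sum.
  by rewrite sumr_const card_ord mulr_natl.
have kn : (\sum_j k j ord0 <= n)%N.
  rewrite -(ler_nat K) natr_sum -[leRHS]mul1r -ler_pdivrMr// big_distrl/=.
  by move: hs; rewrite ler_norml => /andP[_ ?]; lra.
split=> // i; rewrite mxE; case: (unliftP ord0 i) => [j ->|->].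
  rewrite /full_cnt liftK; apply: (le_trans (hj j)).
  by rewrite -[leLHS]mul1r ler_wpM2r// ler1n.
rewrite /full_cnt unlift_none natrB// natr_sum mulrBl divff ?gt_eqF// big_distrl/=.
rewrite -normrN opprB (_ : _ - _ = \sum_(j < d) (k j 0)%:R / n%:R - (1 - phi ord0 0)); last by ring.
by apply: (le_trans hs); rewrite ler_wpM2r// ler_nat.
Qed.

Lemma inv_le_expR (K : realType) (t : K) : 0 <= t <= 1 / 2 -> (1 - t)^-1 <= expR (2 * t).
Proof.
move=> /andP[t0 t1]; have u0 : 0 < 1 - t by lra.
apply: le_trans (expR_ge1Dx _); rewrite -[leLHS]mul1r ler_pdivrMr//.
have -> : (1 + 2 * t) * (1 - t) = 1 + t * (1 - 2 * t) by ring.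
by rewrite lerDl mulr_ge0//; lra.
Qed.

Lemma sqrt_exp_bounds (K : realType) (d : nat) (t : K) : 0 <= t <= 1 / 2 ->
  Num.sqrt (1 - t)^-1 ^+ d <= expR (d%:R * (2 * t))
  /\ expR (- (d%:R * t)) <= Num.sqrt (1 + t)^-1 ^+ d.
Proof.
move=> t01; have /andP[t0 t1] := t01.
have sq (y : K) : 0 <= y -> Num.sqrt (y ^+ 2) = y by move=> y0; rewrite sqrtr_sqr ger0_norm.
rewrite -mulrN !expRM_natl; split.
  apply: lerXn2r; rewrite ?nnegrE ?sqrtr_ge0 ?expR_ge0//.
  rewrite -[leRHS]sq ?expR_ge0// ler_wsqrtr//.
  by apply: (le_trans (inv_le_expR t01)); rewrite -!expRM_natl ler_expR; lra.
apply: lerXn2r; rewrite ?nnegrE ?sqrtr_ge0 ?expR_ge0//.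
rewrite -[leLHS]sq ?expR_ge0// ler_wsqrtr//.
have u0 : 0 < 1 + t by lra.
rewrite expRN exprVn lef_pV2 ?posrE ?exprn_gt0 ?expR_gt0//.
by apply: (le_trans (expR_ge1Dx t)); rewrite -expRM_natl ler_expR; lra.
Qed.

Lemma sum_ln_near (K : realType) (q : nat) (x0 : 'cV[K]_q) (eta : K) :
  (forall i, 0 < x0 i 0) -> 0 < eta -> exists2 delta : K, 0 < delta &
  forall x : 'cV[K]_q, near_box x0 delta x ->
    `|\sum_i ln (x i 0) - \sum_i ln (x0 i 0)| <= eta.
Proof.
move=> x00 e0.
have hc : cont2 (fun p : K * 'cV[K]_q => \sum_i ln (p.2 i 0)) (0, x0).
  by apply: cont2_sum => i; apply: cont2_ln => //; exact: cont2_coord.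
have [d d0 hd] := cont2_near hc e0; exists d => // x hx.
by apply: (hd 0 x) => //; rewrite subrr normr0 ltW.
Qed.

(** The size predicted by the saddle point method. [G] collects [sqrt (2 pi)]
    and the constant of Stirling's formula. *)
Definition lap_main (K : realType) (d : nat) (G : K) (R : 'M[K]_d.+1) (r : 'cV[K]_d.+1)
    (c0 : K) (x0 : 'cV[K]_d.+1) (n : nat) (c : K) (phi : 'cV[K]_d.+1) : K :=
  G ^+ d / Num.sqrt (\det (hess0 R c0 x0) * \prod_i x0 i 0)
  * expR (- (n%:R * Phi R r c phi)).

(** In the box the terms are lattice Gaussians of parameter [(1 +- eta) / n]
    centred at [n phi]. Outside of it there are polynomially many terms, each
    exponentially smaller. The Hessian and the product of the coordinates are
    those at the base point [x0], which does not move with [n]. *)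
Lemma laplace_local (K : realType) (d : nat) : exists2 G : K, 0 < G &
  forall (R : 'M[K]_d.+1) (r : 'cV[K]_d.+1) (c0 : K) (x0 : 'cV[K]_d.+1) (zeta dl0 : K),
  R^T = R -> (forall i j, 0 <= R i j) -> posmx R -> (forall i, 0 < r i 0) -> 0 <= c0 ->
  open_simplex x0 -> posdef (hess0 R c0 x0) -> critical R r c0 x0 ->
  0 < zeta -> 0 < dl0 ->
  exists (delta rho : K) (N : nat), [/\ 0 < delta <= dl0, 0 < rho &
  forall (n m : nat) (phi : 'cV[K]_d.+1), (N <= n)%N -> (0 < n)%N ->
    `|m%:R / n%:R - c0| <= rho -> convex_at R (m%:R / n%:R) ->
    open_simplex phi -> critical R r (m%:R / n%:R) phi ->
    let A := lap_main G R r c0 x0 n (m%:R / n%:R) phi in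
    let Z (P : pred 'cV[K]_d.+1) := \sum_(t : {ffun 'I_n -> 'I_d.+1} | P (freq K t))
     (\prod_u r (t u) 0) * qform R (freq K t) ^+ m in
    [/\ near_box x0 delta phi,
        expR (- zeta) * A <= Z (near_boxb x0 delta),
        Z (near_boxb x0 delta) <= expR zeta * A
      & Z (fun x => ~~ near_boxb x0 delta x) <= zeta * A]].
Proof.
have [sigma Hs] := lap_term_near K d.
exists (Num.sqrt (2 * pi) * expR (- sigma)).
  by rewrite mulr_gt0 ?expR_gt0// sqrtr_gt0 mulr_gt0// pi_gt0.
move=> R r c0 x0 zeta dl0 Rs R0 Rp r0 c00 x0o pd x0c z0 dl00; have x00 := proj1 x0o.
pose H := hess0 R c0 x0.
have D0 : 0 < \det H := posdef_det_gt0 pd.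
have X0 : 0 < \prod_i x0 i 0 by apply: prodr_gt0.
pose G := Num.sqrt (2 * pi) * expR (- sigma).
have G0 : 0 < G by rewrite mulr_gt0 ?expR_gt0// sqrtr_gt0 mulr_gt0// pi_gt0.
pose A0 := G ^+ d / Num.sqrt (\det H * \prod_i x0 i 0).
have A00 : 0 < A0 by rewrite divr_gt0 ?exprn_gt0// sqrtr_gt0 mulr_gt0.
(* The tolerance [tau] of each approximation enters the final exponent at most
   [2 d + 5] times. *)
pose tau := Num.min (1 / 4) (zeta / (2 * d%:R + 5)).
have dd0 : 0 < 2 * d%:R + 5 :> K by rewrite ltr_wpDl// mulr_ge0.
have tau0 : 0 < tau by rewrite /tau lt_min divr_gt0//= divr_gt0.
have [tau1 tau2] : tau <= 1 / 4 /\ tau <= zeta / (2 * d%:R + 5).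
  by rewrite /tau !ge_min !lexx orbT.
clearbody tau.
rewrite ler_pdivlMr// in tau2.
have [mu mu0 hmu] : exists2 mu : K, 0 < mu & forall i, mu <= x0 i 0.
  apply: fin_delta => [i e e' h e'0 ee'|i]; first exact: le_trans ee' h.
  by exists (x0 i 0) => //; exact: x00.
have [dl1 dl10 hln] := sum_ln_near x00 tau0.
pose dl := Num.min dl0 (Num.min (mu / 4) dl1).
have dl_0 : 0 < dl by rewrite /dl !lt_min dl00 dl10 divr_gt0.
have [dla dlb dlc] : [/\ dl <= dl0, dl <= mu / 4 & dl <= dl1].
  by rewrite /dl !ge_min !lexx !orbT.
clearbody dl.
have [de [rho [kap [/andP[de0 dedl] rho0 kap0 HP]]]] :=
  Phi_local Rs R0 Rp c00 x0o pd x0c tau0 dl_0.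
have mu20 : 0 < mu / 2 by rewrite divr_gt0.
have [N1 HN1] := Hs R r tau (mu / 2) r0 tau0 mu20.
have [k1 k10 Hk1] := lattice_gauss_le pd tau0.
(* A window of half-width [dw] in the last [d] coordinates moves the first one
   by at most [d * dw], and so stays in the box of radius [de / 2] about [phi]. *)
pose dw := de / (2 * d.+1%:R).
have dw0 : 0 < dw by rewrite divr_gt0// mulr_gt0.
have dwE : d.+1%:R * dw = de / 2.
  have : d.+1%:R != 0 :> K by rewrite pnatr_eq0.
  by rewrite /dw; move: (d.+1%:R) => z zn; field.
have [k2 k20 Hk2] := lattice_gauss_ge pd tau0 dw0.
have [N3 HN3] := @poly_exp_small K d kap (zeta * A0) kap0 (mulr_gt0 z0 A00).
pose N2 := (Num.truncn (2 / Num.min k1 k2)).+1.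
exists de, rho, (maxn N1 (maxn N2 N3)); split; [by rewrite de0 (le_trans dedl)|exact: rho0|].
move=> n m phi; rewrite !geq_max => /and3P[n1 n2 n3] n0.
set c := m%:R / n%:R => cc cv po pc.
have nK : 0 < n%:R :> K by rewrite ltr0n.
have c_0 : 0 <= c by rewrite divr_ge0.
have [pb hnear hfar] := HP c phi c_0 cc cv po pc.
rewrite /lap_main -/H -/G -/A0; cbv zeta.
pose E := expR (- (n%:R * Phi R r c phi)); rewrite -/E.
have E0 : 0 < E by apply: expR_gt0.
have kk0 : 0 < Num.min k1 k2 by rewrite lt_min k10.
have hkk : 2 / n%:R <= Num.min k1 k2.
  rewrite ler_pdivrMr// mulrC -ler_pdivrMr//.
  apply: (le_trans (ltW (truncnS_gt _))); first by rewrite ler_nat.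
have [hk1 hk2] : 2 / n%:R <= k1 /\ 2 / n%:R <= k2.
  by move: hkk; rewrite le_min => /andP[].
pose s : 'cV[K]_d := n%:R *: row' ord0 phi.
pose P0 := expR (- (d%:R * sigma) - d%:R / 2 * ln n%:R - 2^-1 * \sum_i ln (x0 i 0)
   - n%:R * Phi R r c phi).
have P00 : 0 <= P0 := expR_ge0 _.
have near (k : 'cV['I_n.+1]_d) : (\sum_j k j ord0 <= n)%N ->
    near_box x0 de (cfreq K n (full_cnt k)) ->
    expR (- (2 * tau)) * (P0 * lgauss H ((1 + tau) / n%:R) s k)
      <= multinom K n (full_cnt k) * lap_term R r n m (full_cnt k)
    /\ multinom K n (full_cnt k) * lap_term R r n m (full_cnt k)
      <= expR (2 * tau) * (P0 * lgauss H ((1 - tau) / n%:R) s k).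
  move=> kn kb; have gs := sum_full_cnt kn.
  set x := cfreq K n (full_cnt k) in kb *.
  have xm i : mu / 2 <= x i 0.
    by have := kb i; have := hmu i; rewrite ler_norml => h1 /andP[h2 h3]; clear -h1 h2 h3 dedl dlb mu0; lra.
  have xo : open_simplex x.
    split=> [i|]; first by apply: lt_le_trans (xm i).
    exact: (proj2 (cfreq_simplex K n0 gs)).
  have Q0 : 0 < qform R x by apply: Rp; exact: (proj1 xo).
  have [h1 h2] := HN1 n m _ n1 n0 gs xm Q0; rewrite -/x -/c in h1 h2.
  have /andP[h3 h4] := hnear x xo kb.
  have h5 := hln x (near_box_le (le_trans dedl dlc) kb).
  have vt := tangent_diff (proj2 po) (proj2 xo).
  have HE : hess_form R c0 x0 (x - phi) = n%:R^-1 ^+ 2 * qform H (vnat K k - s).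
    by rewrite -(hess0_form c0 Rs x00 vt) row'_cfreq_sub// qform_scale.
  rewrite HE in h3 h4; rewrite /lgauss /P0 -!expRD.
  have n'0 : 0 <= n%:R :> K by [].
  have := ler_wpM2l n'0 h3; have := ler_wpM2l n'0 h4.
  set T := qform H (vnat K k - s).
  have -> : n%:R * ((1 + tau) / 2 * (n%:R^-1 ^+ 2 * T)) = (1 + tau) / n%:R / 2 * T.
    by field; rewrite gt_eqF.
  have -> : n%:R * ((1 - tau) / 2 * (n%:R^-1 ^+ 2 * T)) = (1 - tau) / n%:R / 2 * T.
    by field; rewrite gt_eqF.
  move: h1 h2 h5; rewrite ler_norml (mulrBr n%:R (Phi R r c x)).
  move: (_ / 2 * T) (_ / 2 * T) (n%:R * Phi _ _ _ _) (n%:R * Phi _ _ _ _) (\sum_i _) (\sum_i _).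
  clear -tau0 => a b p1 p2 l1 l2 h1 h2 /andP[h3 h4] h5 h6; split.
    by apply: le_trans h1; rewrite ler_expR; lra.
  by apply: (le_trans h2); rewrite ler_expR; lra.
have tau12 : 0 <= tau <= 1 / 2 by clear -tau0 tau1; apply/andP; split; lra.
have [sq1 sq2] := sqrt_exp_bounds d tau12.
have cst u : 0 < u -> P0 * (Num.sqrt (2 * pi / (u / n%:R)) ^+ d / Num.sqrt (\det H))
     = A0 * E * Num.sqrt u^-1 ^+ d.
  by move=> u0; rewrite /P0 gauss_const.
have p1 : 0 < 1 + tau by clear -tau0; lra.
have m1 : 0 < 1 - tau by clear -tau1; lra.
have AE0 : 0 <= A0 * E := mulr_ge0 (ltW A00) (ltW E0).
split; first by apply: near_box_le pb; clear -de0; lra.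
- rewrite sum_freq_by_cnt.
  have kap2 : 0 < (1 + tau) / n%:R by rewrite divr_gt0.
  have kap2' : (1 + tau) / n%:R <= k2.
    by apply: le_trans hk2; rewrite ler_pM2r ?invr_gt0//; clear -tau1; lra.
  have dwn : dw / ((1 + tau) / n%:R) = dw / (1 + tau) * n%:R by rewrite invf_div mulrA mulrAC.
  have dw1 : dw / (1 + tau) <= dw.
    by rewrite ler_pdivrMr// ler_peMr ?(ltW dw0)//; clear -tau0; lra.
  have dw10 : 0 <= dw / (1 + tau) by apply: divr_ge0; apply: ltW.
  have dwde : dw <= de / 2.
    by rewrite -dwE -[leLHS]mul1r ler_wpM2r ?(ltW dw0)// ler1n.
  have phde i : de <= phi i 0.
    have := pb i; have := hmu i; rewrite ler_norml => h1 /andP[h2 h3]; clear -h1 h2 h3 dedl dlb mu0 de0; lra.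
  have ddw : d%:R * (dw / (1 + tau)) <= de / 2.
    rewrite -dwE; apply: ler_pM => //; by rewrite ler_nat.
  have win i : dw / ((1 + tau) / n%:R) <= s i 0
      /\ s i 0 + dw / ((1 + tau) / n%:R) <= n.+1%:R.
    rewrite dwn !mxE (mulrC n%:R) ler_pM2r// -mulrDl; split.
      by have h := phde (lift ord0 i); clear -h dw1 dwde de0; lra.
    apply: (@le_trans _ _ (1 * n%:R)); last by rewrite mul1r ler_nat.
    rewrite ler_pM2r//.
    have p_sum := proj2 po; rewrite big_ord_recl (bigD1 i)//= in p_sum.
    have : 0 <= \sum_(j < d | j != i) phi (lift ord0 j) 0.
      by apply: sumr_ge0 => j _; exact: ltW (proj1 po _).
    by have h := phde ord0; clear -h p_sum dw1 dwde de0; lra.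
  have h := Hk2 _ n.+1 s kap2 kap2' win; rewrite dwn in h.
  have hP := ler_wpM2l P00 h; rewrite mulrCA cst// in hP.
  apply: (@le_trans _ _ (expR (- (2 * tau)) * ((1 - tau) * (A0 * E * Num.sqrt (1 + tau)^-1 ^+ d)))).
    have -> : expR (- (2 * tau)) * ((1 - tau) * (A0 * E * Num.sqrt (1 + tau)^-1 ^+ d))
       = expR (- (2 * tau)) * (1 - tau) * Num.sqrt (1 + tau)^-1 ^+ d * (A0 * E) by ring.
    rewrite ler_wpM2r//.
    apply: (@le_trans _ _ (expR (- (2 * tau)) * expR (- (2 * tau)) * expR (- (d%:R * tau)))).
      rewrite -!expRD ler_expR; have : 0 <= d%:R * tau by rewrite mulr_ge0// ltW.
      clear -tau2 tau0; lra.
    apply: ler_pM; rewrite ?mulr_ge0 ?expR_ge0//.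
    rewrite ler_wpM2l ?expR_ge0// expRN -[leRHS]invrK lef_pV2 ?posrE ?expR_gt0 ?invr_gt0//.
    exact: inv_le_expR.
  apply: (le_trans (ler_wpM2l (expR_ge0 _) hP)).
  rewrite !big_distrr/= big_mkcond [leRHS]big_mkcond/=; apply: ler_sum => k _.
  case: ifP => hw; last first.
    case: ifP => // /andP[kn /near_boxP kb]; apply: le_trans (proj1 (near k kn kb)).
    by rewrite !mulr_ge0 ?expR_ge0// lgauss_ge0.
  have dph : d%:R * (dw / (1 + tau)) <= phi ord0 0.
    by apply: le_trans ddw _; have h7 := phde ord0; clear -h7 de0; lra.
  have [kn kb] := window_near n0 po dw10 dph hw.
  have kb' : near_box x0 de (cfreq K n (full_cnt k)).
    move=> i; have h3 : d.+1%:R * (dw / (1 + tau)) <= de / 2 by rewrite -dwE ler_wpM2l.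
    have := le_trans (kb i) h3; have := pb i.
    by clear; rewrite !ler_norml => /andP[? ?] /andP[? ?]; apply/andP; split; lra.
  have -> : ((\sum_j k j ord0 <= n)%N && near_boxb x0 de (cfreq K n (full_cnt k))) = true.
    by rewrite kn; apply/near_boxP.
  exact: (proj1 (near k kn kb')).
- rewrite sum_freq_by_cnt.
  have kap2 : 0 < (1 - tau) / n%:R by rewrite divr_gt0.
  have kap2' : (1 - tau) / n%:R <= k1.
    by apply: le_trans hk1; rewrite ler_pM2r ?invr_gt0//; clear -tau0 tau1; lra.
  have h := Hk1 _ n.+1 s kap2 kap2'.
  have hP := ler_wpM2l P00 h; rewrite mulrCA cst// in hP.
  apply: (@le_trans _ _ (expR (2 * tau) * (P0 * \sum_(k : 'cV['I_n.+1]_d) lgauss H ((1 - tau) / n%:R) s k))).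
    rewrite !big_distrr/= big_mkcond/=; apply: ler_sum => k _.
    case: ifP => [/andP[kn /near_boxP kb]|_]; first exact: (proj2 (near k kn kb)).
    by rewrite !mulr_ge0 ?expR_ge0// lgauss_ge0.
  apply: (le_trans (ler_wpM2l (expR_ge0 _) hP)).
  have -> : expR (2 * tau) * ((1 + tau) * (A0 * E * Num.sqrt (1 - tau)^-1 ^+ d))
     = expR (2 * tau) * (1 + tau) * Num.sqrt (1 - tau)^-1 ^+ d * (A0 * E) by ring.
  rewrite ler_wpM2r//.
  apply: (@le_trans _ _ (expR (2 * tau) * expR tau * expR (d%:R * (2 * tau)))); last first.
    rewrite -!expRD ler_expR; have : 0 <= d%:R * tau by rewrite mulr_ge0// ltW.
    clear -tau2 tau0; lra.
  apply: ler_pM; rewrite ?mulr_ge0 ?expR_ge0 ?exprn_ge0 ?sqrtr_ge0 ?(ltW p1)//.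
  by rewrite ler_wpM2l ?expR_ge0// expR_ge1Dx.
rewrite (sum_freq_by_cnt n m R r (fun x => ~~ near_boxb x0 de x)).
apply: (@le_trans _ _ (\sum_(k : 'cV['I_n.+1]_d) expR (- (n%:R * kap)) * E)); last first.
  rewrite sumr_const card_mx card_ord muln1 -[leLHS]mulr_natl natrX mulrA [leRHS]mulrA.
  by rewrite ler_wpM2r ?(ltW E0)//; apply: HN3.
rewrite big_mkcond/=; apply: ler_sum => k _.
case: ifP => [/andP[kn /near_boxP kb]|_]; last by rewrite mulr_ge0 ?expR_ge0// ltW.
have gs := sum_full_cnt kn.
have xs := cfreq_simplex K n0 gs.
set x := cfreq K n (full_cnt k) in kb xs *.
have hm : (m = 0%N \/ 0 < qform R x) \/ (0 < m)%N /\ qform R x = 0.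
  have Q0 : 0 <= qform R x.
    rewrite qformE; apply: sumr_ge0 => i _; apply: sumr_ge0 => j _.
    by rewrite !mulr_ge0// (proj1 xs).
  case: (posnP m) => [->|m0]; first by left; left.
  move: Q0; rewrite le_eqVlt => /orP[/eqP <-|Q0]; first by right.
  by left; right.
case: hm => [hm|[m0 Q0]]; last first.
  rewrite /lap_term -/x Q0 expr0n eqn0Ngt m0 /= !mulr0.
  by rewrite mulr_ge0 ?expR_ge0// ltW.
apply: (le_trans (lap_term_far n0 r0 gs hm)).
have hc : c = 0 \/ 0 < qform R x.
  by case: hm => [m0|]; [left; rewrite /c m0 mul0r|right].
rewrite /E -expRD ler_expR -/x -/c -opprD lerN2 -mulrDr ler_pM2l//.
by rewrite addrC; exact: hfar.
Qed.

(** * Inserting the edges *)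

Lemma hess_mx_coef (K : realType) (q : nat) (R : 'M[K]_q) (c : K) (x : 'cV[K]_q) :
  R^T = R -> (forall i, 0 < x i 0) ->
  hess_mx R c x = \matrix_(i, j) hess_coef R c x i j.
Proof.
move=> Rs x0; have Rsym i k : R i k = R k i by rewrite -[in LHS]Rs mxE.
apply/matrixP => i j; rewrite /hess_mx invmx_diag// !mxE /hess_coef.
congr (_ + _ * (_ * _ - _)); rewrite big_distrr/=; apply: eq_bigr => k _.
by rewrite !mxE big_ord1 !mxE (Rsym k) mulrAC mulrA.
Qed.

Definition corr_exponent (K : realType) (q : nat) (R : 'M[K]_q) (c : K) (x : 'cV[K]_q) : K :=
  let D := diag_mx x^T *m R in
  let k := c / qform R x in
  - k * \tr D - k ^+ 2 * \tr (D *m D).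

Lemma edge_corrE (K : realType) (q : nat) (R : 'M[K]_q) (c : K) (x : 'cV[K]_q) :
  edge_corr R c x = expR (corr_exponent R c x).
Proof. by []. Qed.

Lemma cont2_corr_exponent (K : realType) (q : nat) (R : 'M[K]_q) (p : K * 'cV[K]_q) :
  R^T = R -> 0 < qform R p.2 -> cont2 (fun p => corr_exponent R p.1 p.2) p.
Proof.
move=> Rs Q0.
rewrite (_ : (fun p => _) = (fun p : K * 'cV[K]_q =>
   - (p.1 * (qform R p.2)^-1 * \sum_i p.2 i 0 * R i i)
   - (p.1 * (qform R p.2)^-1 * (p.1 * (qform R p.2)^-1))
     * \sum_i \sum_j p.2 i 0 * p.2 j 0 * R i j ^+ 2)); last first.
  by apply/funext => z; rewrite /corr_exponent tr_diagM tr_diagM2// expr2 mulNr.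
have hk : cont2 (fun p => p.1 * (qform R p.2)^-1) p.
  apply: cont2M; first exact: cont2_fst.
  by apply: cont2V; [rewrite gt_eqF|exact: cont2_qform].
apply: cont2D; apply: cont2N; apply: cont2M => //.
- by apply: cont2_sum => i; apply: cont2M; [exact: cont2_coord|exact: cont2_cst].
- exact: cont2M.
- apply: cont2_sum => i; apply: cont2_sum => j; apply: cont2M; last exact: cont2_cst.
  by apply: cont2M; exact: cont2_coord.
Qed.

(** The determinant under the square root of the formula, with its matrix in a
    form that is visibly continuous. *)
Definition hess_vol (K : realType) (d : nat) (R : 'M[K]_d.+1) (c : K) (x : 'cV[K]_d.+1) : K :=
  \det ((frame0 K d)^T *m (\matrix_(i, j) hess_coef R c x i j) *m frame0 K d)
  * \prod_i x i 0.

Lemma cont2_hess_vol (K : realType) (d : nat) (R : 'M[K]_d.+1) (p : K * 'cV[K]_d.+1) :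
  (forall i, 0 < p.2 i 0) -> 0 < qform R p.2 -> cont2 (fun p => hess_vol R p.1 p.2) p.
Proof.
move=> x0 Q0; rewrite /hess_vol; apply: cont2M; last first.
  by apply: cont2_prod => i; exact: cont2_coord.
have ent i j : cont2 (fun p : K * 'cV[K]_d.+1 => ((frame0 K d)^T
    *m (\matrix_(i, j) hess_coef R p.1 p.2 i j) *m frame0 K d) i j) p.
  rewrite (_ : (fun p => _) = (fun p : K * 'cV[K]_d.+1 => \sum_k
     (\sum_l (frame0 K d)^T i l * hess_coef R p.1 p.2 l k) * frame0 K d k j)); last first.
    apply/funext => z; rewrite mxE; apply: eq_bigr => k _; congr (_ * _).
    by rewrite mxE; apply: eq_bigr => l _; rewrite !mxE.
  apply: cont2_sum => k; apply: cont2M; last exact: cont2_cst.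
  by apply: cont2_sum => l; apply: cont2M; [exact: cont2_cst|exact: cont2_hess_coef].
rewrite /determinant; apply: cont2_sum => s; apply: cont2M; first exact: cont2_cst.
by apply: cont2_prod => i; exact: ent.
Qed.

Lemma hess_volE (K : realType) (d : nat) (R : 'M[K]_d.+1) (c : K) (x : 'cV[K]_d.+1) :
  R^T = R -> (forall i, 0 < x i 0) ->
  hess_vol R c x = \det (hess0 R c x) * \prod_i x i 0.
Proof. by move=> Rs x0; rewrite /hess_vol -hess_mx_coef. Qed.

Lemma edge_scale_gt0 (K : realType) (n m : nat) : (0 < n)%N -> 0 < edge_scale K n m.
Proof.
move=> n0; have f0 : 0 < m`!%:R :> K by rewrite ltr0n fact_gt0.
have n0' : 0 < n%:R :> K by rewrite ltr0n.
by apply: divr_gt0; rewrite ?exprn_gt0// mulr_gt0// exprn_gt0.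
Qed.

Lemma edge_wt_ge0 (K : realType) (q : nat) (R : 'M[K]_q) n (t : {ffun 'I_n -> 'I_q}) e :
  (forall i j, 0 <= R i j) -> 0 <= edge_wt R t e.
Proof. by move=> R0; rewrite /edge_wt; case: ifP. Qed.

(** A bound valid for all types, for use where the quadratic form may be small. *)
Lemma elsym_le_scale (K : realType) (q : nat) (R : 'M[K]_q) n m
    (t : {ffun 'I_n -> 'I_q}) : (0 < n)%N -> R^T = R -> (forall i j, 0 <= R i j) ->
  elsym (edge_wt R t) m <= edge_scale K n m * qform R (freq K t) ^+ m.
Proof.
move=> n0 Rs R0; have w0 e : 0 <= edge_wt R t e by exact: edge_wt_ge0.
apply: (le_trans (elsym_le m w0)).
have h : psum (edge_wt R t) 1 <= n%:R ^+ 2 / 2 * qform R (freq K t).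
  rewrite psum_freq// qformE ler_wpM2l ?divr_ge0 ?exprn_ge0//.
  under eq_bigr do under eq_bigr do rewrite expr1.
  rewrite gerBl mulr_ge0 ?invr_ge0//; apply: sumr_ge0 => i _.
  by rewrite mulr_ge0 ?exprn_ge0// freq_ge0.
have p0 : 0 <= psum (edge_wt R t) 1 by exact: psum_ge0.
rewrite (_ : edge_scale K n m * _ = (n%:R ^+ 2 / 2 * qform R (freq K t)) ^+ m / m`!%:R).
  by rewrite ler_wpM2r ?invr_ge0// lerXn2r ?nnegrE// (le_trans p0).
rewrite [in RHS]exprMn expr_div_n -exprM /edge_scale invfM.
by move: (_ ^-1) (_ ^-1) => y z; ring.
Qed.

(** The term of the formula at [phi], with the powers of [r] and [phi] collected
    into the exponential of [- n Phi_c phi]. *)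
Definition graph_main (K : realType) (d : nat) (R : 'M[K]_d.+1) (r : 'cV[K]_d.+1)
    (n m : nat) (c : K) (phi : 'cV[K]_d.+1) : K :=
  edge_scale K n m * expR (- (n%:R * Phi R r c phi)) *
  (edge_corr R c phi / Num.sqrt (hess_vol R c phi)).

(** The asymptotic law near a base point, up to a power of the constant [G]. *)
Definition graph_law (K : realType) (d : nat) (G : K) : Prop :=
  forall (R : 'M[K]_d.+1) (r : 'cV[K]_d.+1) (c0 : K) (x0 : 'cV[K]_d.+1) (zeta : K),
  R^T = R -> (forall i j, 0 <= R i j) -> posmx R -> (forall i, 0 < r i 0) -> 0 <= c0 ->
  open_simplex x0 -> posdef (hess0 R c0 x0) -> critical R r c0 x0 -> 0 < zeta ->
  exists2 rho : K, 0 < rho & exists N : nat,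
  forall (n m : nat) (phi : 'cV[K]_d.+1), (N <= n)%N -> (0 < n)%N ->
    `|m%:R / n%:R - c0| <= rho -> convex_at R (m%:R / n%:R) ->
    open_simplex phi -> critical R r (m%:R / n%:R) phi ->
    let W := G ^+ d * graph_main R r n m (m%:R / n%:R) phi in
    expR (- zeta) * W <= SG R r n m <= expR zeta * W.

(** Near the critical point the contribution of the edges is nearly constant
    and factors out of the sum over types; elsewhere the crude bound on it
    suffices. Finally the prefactors at [x0] are replaced by those at [phi]. *)
Lemma graph_local (K : realType) (d : nat) : exists2 G : K, 0 < G & graph_law d G.
Proof.
have [G G0 HG] := laplace_local K d; exists G => // R r c0 x0 zeta Rs R0 Rp r0 c00 x0o pd x0c z0.
have x00 := proj1 x0o.
have Q0 : 0 < qform R x0 := Rp _ x00.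
pose tau := zeta / 6; have tau0 : 0 < tau by rewrite divr_gt0.
have V0 : 0 < hess_vol R c0 x0.
  by rewrite hess_volE// mulr_gt0 ?posdef_det_gt0// prodr_gt0.
have [d1 d10 h1] := cont2_near (@cont2_corr_exponent _ _ R (c0, x0) Rs Q0) tau0.
have hv : cont2 (fun p : K * 'cV[K]_d.+1 => ln (hess_vol R p.1 p.2)) (c0, x0).
  by apply: cont2_ln; [exact: V0|exact: cont2_hess_vol].
have [d2 d20 h2] := cont2_near hv tau0.
have Q20 : 0 < qform R x0 / 2 by rewrite divr_gt0.
have [d3 d30 h3] := cont2_near (@cont2_qform _ _ R (c0, x0)) Q20.
have c01 : 0 <= c0 + 1 by rewrite addr_ge0.
have [C C0 [N1 HN1]] := edge_sum_asym Rs R0 Q20 c01.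
pose B0 := expR (corr_exponent R c0 x0).
have B00 : 0 < B0 by apply: expR_gt0.
pose dl0 := Num.min d1 (Num.min d2 d3).
have dl00 : 0 < dl0 by rewrite /dl0 !lt_min d10 d20.
have [ea eb ec] : [/\ dl0 <= d1, dl0 <= d2 & dl0 <= d3].
  by rewrite /dl0 !ge_min !lexx !orbT.
clearbody dl0.
(* The part far from the critical point carries no factor [B0], so its tolerance
   is taken relative to [B0]. *)
pose ze := tau * Num.min 1 B0.
have ze0 : 0 < ze by rewrite mulr_gt0// lt_min ltr01.
have [ze1 ze2] : ze <= tau /\ ze <= tau * B0.
  split; rewrite /ze; first by rewrite -[leRHS]mulr1 ler_wpM2l ?(ltW tau0)// ge_min lexx.
  by rewrite ler_wpM2l ?(ltW tau0)// ge_min lexx orbT.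
clearbody ze.
have [de [rho [N2 [/andP[de0 dedl] rho0 HL]]]] :=
  HG R r c0 x0 ze dl0 Rs R0 Rp r0 c00 x0o pd x0c ze0 dl00.
exists (Num.min (Num.min 1 dl0) rho); first by rewrite !lt_min ltr01 dl00.
exists (maxn N1 (maxn N2 (Num.truncn (C / tau)).+1)) => n m phi.
rewrite !geq_max => /and3P[n1 n2 n3] n0.
set c := m%:R / n%:R; rewrite !le_min => /andP[/andP[c1 cd] cr] cv po pc.
have nK : 0 < n%:R :> K by rewrite ltr0n.
have c_0 : 0 <= c by rewrite divr_ge0.
have := HL n m phi n2 n0 cr cv po pc; rewrite -/c; cbv zeta.
set A := lap_main _ _ _ _ _ _ _ _ => -[pb Z1 Z2 Z3].
have A_0 : 0 <= A.
  by rewrite mulr_ge0 ?expR_ge0// divr_ge0 ?sqrtr_ge0 ?exprn_ge0// ltW.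
have CN : C / n%:R <= tau.
  rewrite ler_pdivrMr// mulrC -ler_pdivrMr//.
  by apply: (le_trans (ltW (truncnS_gt _))); rewrite ler_nat.
set S := edge_scale K n m.
have S0 : 0 <= S by rewrite ltW// edge_scale_gt0.
have rt0 (t : {ffun 'I_n -> 'I_d.+1}) : 0 <= \prod_u r (t u) 0.
  by apply: prodr_ge0 => u _; exact: ltW.
have qf0 (t : {ffun 'I_n -> 'I_d.+1}) : 0 <= qform R (freq K t).
  rewrite qformE; apply: sumr_ge0 => i _; apply: sumr_ge0 => j _.
  by rewrite !mulr_ge0// freq_ge0.
have near (t : {ffun 'I_n -> 'I_d.+1}) : near_boxb x0 de (freq K t) ->
   expR (- (2 * tau)) * (S * B0) * qform R (freq K t) ^+ m <= elsym (edge_wt R t) m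
   /\ elsym (edge_wt R t) m <= expR (2 * tau) * (S * B0) * qform R (freq K t) ^+ m.
  move=> /near_boxP/(near_box_le dedl) tb.
  have tQ : qform R x0 / 2 <= qform R (freq K t).
    have := h3 c _ (le_trans cd ec) (near_box_le ec tb) => /=.
    by rewrite ler_norml => /andP[? _]; lra.
  have mb : m%:R <= (c0 + 1) * n%:R.
    by rewrite -ler_pdivrMr// -/c; move: c1; rewrite ler_norml => /andP[_ ?]; lra.
  have := HN1 n m t n1 n0 mb tQ; rewrite -/c -/S edge_corrE; cbv zeta => -[e1 e2].
  have := h1 c _ (le_trans cd ea) (near_box_le ea tb) => /=.
  rewrite ler_norml => /andP[e3 e4].
  have SQ : 0 <= S * qform R (freq K t) ^+ m by rewrite mulr_ge0// exprn_ge0.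
  split.
    apply: le_trans e1; rewrite -[leRHS]mulrA -expRD /B0.
    have -> : expR (- (2 * tau)) * (S * expR (corr_exponent R c0 x0)) * qform R (freq K t) ^+ m
      = S * qform R (freq K t) ^+ m * expR (- (2 * tau) + corr_exponent R c0 x0).
      by rewrite (expRD (- (2 * tau))); ring.
    by rewrite ler_wpM2l// ler_expR; lra.
  apply: (le_trans e2); rewrite -[leLHS]mulrA -expRD /B0.
  have -> : expR (2 * tau) * (S * expR (corr_exponent R c0 x0)) * qform R (freq K t) ^+ m
    = S * qform R (freq K t) ^+ m * expR (2 * tau + corr_exponent R c0 x0).
    by rewrite (expRD (2 * tau)); ring.
  by rewrite ler_wpM2l// ler_expR; lra.
have SB0 : 0 <= S * B0 by rewrite mulr_ge0// ltW.
have SBA : 0 <= S * B0 * A by rewrite mulr_ge0.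
have el0 (t : {ffun 'I_n -> 'I_d.+1}) : 0 <= elsym (edge_wt R t) m.
  by apply: elsym_ge0 => e; exact: edge_wt_ge0.
have lo : expR (- (3 * tau)) * (S * B0 * A) <= SG R r n m.
  rewrite SG_elsym.
  apply: (@le_trans _ _ (\sum_(t : {ffun 'I_n -> 'I_d.+1} | near_boxb x0 de (freq K t)) (\prod_u r (t u) 0) * elsym (edge_wt R t) m)); last first.
    rewrite [leRHS](bigID (fun t => near_boxb x0 de (freq K t)))/= lerDl.
    by apply: sumr_ge0 => t _; rewrite mulr_ge0.
  apply: (@le_trans _ _ (expR (- (2 * tau)) * (S * B0) * \sum_(t : {ffun 'I_n -> 'I_d.+1} | near_boxb x0 de (freq K t)) (\prod_u r (t u) 0) * qform R (freq K t) ^+ m)); last first.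
    rewrite big_distrr/=; apply: ler_sum => t tn; rewrite mulrCA ler_wpM2l//.
    exact: (proj1 (near t tn)).
  apply: (@le_trans _ _ (expR (- (2 * tau)) * (S * B0) * (expR (- ze) * A))); last first.
    by rewrite ler_wpM2l ?mulr_ge0 ?expR_ge0 ?(ltW B00).
  have -> : expR (- (2 * tau)) * (S * B0) * (expR (- ze) * A)
    = expR (- (2 * tau) + - ze) * (S * B0 * A) by rewrite expRD; ring.
  by rewrite ler_wpM2r// ler_expR; lra.
have up : SG R r n m <= expR (4 * tau) * (S * B0 * A).
  rewrite SG_elsym (bigID (fun t => near_boxb x0 de (freq K t)))/=.
  have u1 : \sum_(t : {ffun 'I_n -> 'I_d.+1} | near_boxb x0 de (freq K t)) (\prod_u r (t u) 0) * elsym (edge_wt R t) m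
     <= expR (3 * tau) * (S * B0 * A).
    apply: (@le_trans _ _ (expR (2 * tau) * (S * B0) * \sum_(t : {ffun 'I_n -> 'I_d.+1} | near_boxb x0 de (freq K t)) (\prod_u r (t u) 0) * qform R (freq K t) ^+ m)).
      rewrite big_distrr/=; apply: ler_sum => t tn; rewrite mulrCA ler_wpM2l//.
      exact: (proj2 (near t tn)).
    apply: (@le_trans _ _ (expR (2 * tau) * (S * B0) * (expR ze * A))).
      by rewrite ler_wpM2l ?mulr_ge0 ?expR_ge0 ?(ltW B00).
    have -> : expR (2 * tau) * (S * B0) * (expR ze * A)
      = expR (2 * tau + ze) * (S * B0 * A) by rewrite expRD; ring.
    by rewrite ler_wpM2r// ler_expR; lra.
  have u2 : \sum_(t : {ffun 'I_n -> 'I_d.+1} | ~~ near_boxb x0 de (freq K t)) (\prod_u r (t u) 0) * elsym (edge_wt R t) m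
     <= tau * (S * B0 * A).
    apply: (@le_trans _ _ (S * \sum_(t : {ffun 'I_n -> 'I_d.+1} | ~~ near_boxb x0 de (freq K t)) (\prod_u r (t u) 0) * qform R (freq K t) ^+ m)).
      rewrite big_distrr/=; apply: ler_sum => t tn; rewrite mulrCA ler_wpM2l//.
      exact: elsym_le_scale.
    apply: (@le_trans _ _ (S * (tau * B0 * A))).
      rewrite ler_wpM2l//; apply: (le_trans Z3); by rewrite ler_wpM2r.
    by rewrite le_eqVlt; apply/orP; left; apply/eqP; ring.
  apply: (le_trans (lerD u1 u2)); rewrite -mulrDl ler_wpM2r//.
  have -> : 4 * tau = 3 * tau + tau by ring.
  rewrite expRD; have g1 : 1 <= expR (3 * tau) by rewrite -[leLHS]expR0 ler_expR mulr_ge0// ltW.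
  have g2 := expR_ge1Dx tau; have e30 := expR_ge0 (3 * tau).
  have := ler_wpM2l e30 g2; have := ler_wpM2r (ltW tau0) g1; rewrite mul1r mulrDr mulr1; lra.
have V1 : 0 < hess_vol R c phi.
  rewrite (hess_volE c Rs (proj1 po)) mulr_gt0//; last by apply: prodr_gt0 => i _; exact: (proj1 po).
  by apply: posdef_det_gt0; exact: cv.
have pb' := near_box_le dedl pb.
have := h1 c _ (le_trans cd ea) (near_box_le ea pb') => /=.
have := h2 c _ (le_trans cd eb) (near_box_le eb pb') => /=.
rewrite !ler_norml => /andP[w1 w2] /andP[w3 w4].
pose w := corr_exponent R c phi - corr_exponent R c0 x0
   - (ln (hess_vol R c phi) - ln (hess_vol R c0 x0)) / 2.
have WE : G ^+ d * graph_main R r n m c phi = expR w * (S * B0 * A).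
  rewrite /graph_main /A /lap_main -hess_volE// !sqrt_expR// edge_corrE /B0 /w -/S.
  move: (corr_exponent R c phi) (corr_exponent R c0 x0) => u v.
  rewrite (_ : u - v - _ = u - v - ln (hess_vol R c phi) / 2 + ln (hess_vol R c0 x0) / 2);
    last by rewrite mulrBl; ring.
  move: (ln _ / 2) (ln _ / 2) (expR (- (n%:R * _))) => y z e.
  rewrite !expRD !expRN.
  by field; rewrite !gt_eqF ?expR_gt0.
cbv zeta; rewrite WE !(mulrA _ (expR w)) -!expRD; apply/andP; split.
  apply: le_trans lo; rewrite ler_wpM2r// ler_expR /w.
  move: w1 w2 w3 w4; rewrite /tau; clear; lra.
apply: (le_trans up); rewrite ler_wpM2r// ler_expR /w.
by move: w1 w2 w3 w4; rewrite /tau; clear; lra.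
Qed.

(** * The value of the constant *)

(** Both sides are the determinant of the block matrix with rows [(1, u)] and [(- v, 1)],
    reduced by rows in two ways. *)
Lemma det_rank1 (K : comNzRingType) (d : nat) (u : 'rV[K]_d) (v : 'cV[K]_d) :
  \det (1%:M + v *m u) = 1 + (u *m v) 0 0.
Proof.
pose M := block_mx (1%:M : 'M[K]_1) u (- v) (1%:M : 'M[K]_d).
have m1 : block_mx (1%:M : 'M[K]_1) (- u) 0 (1%:M : 'M[K]_d) *m M
   = block_mx (1%:M + u *m v) 0 (- v) 1%:M.
  by rewrite mulmx_block !mul1mx !mul0mx !mulmx1 mulNmx mulmxN opprK !add0r subrr.
have m2 : block_mx (1%:M : 'M[K]_1) 0 v (1%:M : 'M[K]_d) *m M
   = block_mx 1%:M u 0 (1%:M + v *m u).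
  by rewrite mulmx_block !mul1mx !mul0mx !mulmx1 !addr0 subrr addrC.
have := congr1 determinant m1; have := congr1 determinant m2.
rewrite !det_mulmx !det_ublock !det_lblock !det1 !mul1r mulr1 => -> ->.
by rewrite det_mx11 !mxE eqxx.
Qed.

Lemma det_frame0_sq (K : realType) (d : nat) :
  \det ((frame0 K d)^T *m frame0 K d) = d.+1%:R.
Proof.
have -> : (frame0 K d)^T *m frame0 K d
    = 1%:M + (const_mx 1 : 'cV[K]_d) *m (const_mx 1 : 'rV[K]_d).
  apply/matrixP => i j; rewrite !mxE big_ord_recl big_ord1 addrC !mxE unlift_none.
  congr (_ + _); first by ring.
  rewrite (bigD1 i)//= !mxE liftK eqxx mul1r big1 ?addr0 => [//|k ki].
  by rewrite !mxE liftK (negbTE ki) mul0r.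
rewrite det_rank1 !mxE; under eq_bigr do rewrite !mxE mul1r.
by rewrite sumr_const card_ord -natr1 addrC.
Qed.

(** With all weights equal to [1] and no edges, the sum is the number
    [(d + 1) ^ n] of type assignments, and it coincides with [graph_main]. *)
Lemma graph_const (K : realType) (d : nat) (G : K) : 0 < G -> graph_law d G -> G ^+ d = 1.
Proof.
move=> G0 HG.
pose R : 'M[K]_d.+1 := const_mx 1; pose r : 'cV[K]_d.+1 := const_mx 1.
pose D : K := d.+1%:R; have D0 : 0 < D by rewrite ltr0n.
pose x : 'cV[K]_d.+1 := const_mx D^-1.
have Rs : R^T = R by apply/matrixP => i j; rewrite !mxE.
have R0 i j : 0 <= R i j by rewrite mxE.
have Rp : posmx R.
  move=> y y0; rewrite qformE big_ord_recl ltr_wpDr//.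
    apply: sumr_ge0 => i _; apply: sumr_ge0 => j _; rewrite mxE mulr1.
    by apply: mulr_ge0; apply: ltW.
  rewrite big_ord_recl ltr_wpDr//; last by rewrite mxE mulr1 mulr_gt0.
  by apply: sumr_ge0 => j _; rewrite mxE mulr1; apply: mulr_ge0; apply: ltW.
have r0 i : 0 < r i 0 by rewrite mxE.
have x_0 i : 0 < x i 0 by rewrite mxE invr_gt0.
have xo : open_simplex x.
  split=> //; under eq_bigr do rewrite mxE.
  by rewrite sumr_const card_ord -[_ *+ _]mulr_natl divff// gt_eqF.
have cv : convex_at R 0 := convex_at0 Rs.
have xc : critical R r 0 x.
  move=> v vt; rewrite dPhi_tangent// mul0r subr0.
  under eq_bigr do rewrite !mxE.
  by rewrite -big_distrl/= vt mul0r.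
have main n : (0 < n)%N -> graph_main R r n 0 0 x = SG R r n 0.
  move=> n0; rewrite SG_elsym.
  have -> : \sum_(t : {ffun 'I_n -> 'I_d.+1}) \prod_u r (t u) 0 * elsym (edge_wt R t) 0 = D ^+ n.
    under eq_bigr => t _.
      rewrite elsym0 mulr1 big1 => [|u _]; last by rewrite mxE.
      over.
    by rewrite sumr_const card_ffun !card_ord natrX.
  rewrite /graph_main /edge_scale muln0 !expr0 fact0 !mulr1 divr1 mul1r.
  rewrite /edge_corr !mul0r oppr0 mul0r expr0n/= mul0r subr0 expR0.
  have -> : Phi R r 0 x = - ln D.
    rewrite /Phi mul0r subr0; under eq_bigr do rewrite !mxE ln1 subr0.
    rewrite sumr_const card_ord -[_ *+ _]mulr_natl mulrA divff ?gt_eqF// mul1r lnV//.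
  rewrite mulrN opprK expRM_natl lnK ?posrE//.
  rewrite hess_volE// /hess0.
  have -> : hess_mx R 0 x = D%:M.
    rewrite /hess_mx invmx_diag// mulr0 mul0r scale0r addr0.
    by apply/matrixP => i j; rewrite !mxE invrK.
  rewrite mul_mx_scalar -scalemxAl detZ det_frame0_sq.
  have -> : \prod_i x i 0 = D^-1 ^+ d.+1.
    by under eq_bigr do rewrite mxE; rewrite prodr_const card_ord.
  rewrite -exprSr -exprMn divff ?gt_eqF// expr1n sqrtr1 divr1 mulr1//.
have key zeta : 0 < zeta -> expR (- zeta) * G ^+ d <= 1 <= expR zeta * G ^+ d.
  move=> z0; have [rho rho0 [N HN]] := HG R r 0 x zeta Rs R0 Rp r0 (lexx _) xo (cv x xo) xc z0.
  pose n := N.+1; have c0 : 0%:R / n%:R = 0 :> K by rewrite mul0r.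
  have := HN n 0%N x (leqnSn N) isT; rewrite c0 subrr normr0 => /(_ (ltW rho0) cv xo xc).
  cbv zeta; rewrite main//.
  have S0 : 0 < SG R r n 0.
    rewrite SG_elsym; apply: (@lt_le_trans _ _ (\sum_(t : {ffun 'I_n -> 'I_d.+1}) 1)).
      by rewrite sumr_const card_ffun !card_ord natrX exprn_gt0.
    apply: ler_sum => t _; rewrite elsym0 mulr1 big1// => u _; by rewrite mxE.
  by rewrite !mulrA -[X in _ <= X <= _]mul1r !ler_pM2r.
have Gd : 0 < G ^+ d by rewrite exprn_gt0.
rewrite -[LHS]lnK ?posrE// -[RHS]expR0; congr expR.
apply/eqP; rewrite -normr_le0; apply/ler_addgt0Pl => z z0; rewrite addr0.
have /andP[h1 h2] := key z z0.
rewrite ler_norml -(ler_expR (- z)) -(ler_expR _ z) lnK ?posrE//; apply/andP; split.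
  by rewrite expRN -[leLHS]mulr1 ler_pdivrMl ?expR_gt0.
by move: h1; rewrite expRN ler_pdivrMl ?expR_gt0// mulr1.
Qed.

(** * Uniformity in the ratio *)

(** One nonzero coefficient makes the form positive on positive vectors. *)
Lemma posmx_neq0 (K : realType) (q : nat) (R : 'M[K]_q) :
  (forall i j, 0 <= R i j) -> R != 0 -> posmx R.
Proof.
move=> R0 Rn x x0.
have [[i j] Rij] : exists ij : 'I_q * 'I_q, R ij.1 ij.2 != 0.
  apply/existsP; apply: contra_neqT Rn => /existsPn h.
  by apply/matrixP => i j; rewrite mxE; apply/eqP; have := h (i, j); rewrite negbK.
rewrite qformE (bigD1 i)//= ltr_wpDr//.
  by apply: sumr_ge0 => k _; apply: sumr_ge0 => l _; rewrite !mulr_ge0// ltW.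
rewrite (bigD1 j)//= ltr_wpDr//.
  by apply: sumr_ge0 => l _; rewrite !mulr_ge0// ltW.
by rewrite !mulr_gt0// lt_neqAle eq_sym Rij R0.
Qed.

Lemma irreducible_size1 (K : realType) (q : nat) : (0 < q)%N ->
  irreducible_mx (0 : 'M[K]_q) -> q = 1%N.
Proof.
case: q => [//|[//|q]] _ /(_ (finset.set1 ord0)).
by rewrite cards1 => /(_ isT)[i [j [_ _]]]; rewrite mxE eqxx.
Qed.

Lemma SG_term_main (K : realType) (d : nat) (E : 'M[K]_(d.+1, d)) (R : 'M[K]_d.+1)
    (r : 'cV[K]_d.+1) (n m : nat) (phi : 'cV[K]_d.+1) :
  R^T = R -> @tangent_frame K d.+1 E -> (0 < n)%N -> (forall i, 0 < r i 0) ->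
  (forall i, 0 < phi i 0) -> 0 < qform R phi ->
  edge_scale K n m * @SG_term K d.+1 E R r n m (m%:R / n%:R) phi
  = graph_main R r n m (m%:R / n%:R) phi.
Proof.
move=> Rs Ef n0 r0 p0 Q0; have nn : n%:R != 0 :> K by rewrite pnatr_eq0 -lt0n.
rewrite /graph_main /SG_term -/(edge_corr R (m%:R / n%:R) phi) det_hess_frame//.
rewrite -hess_volE// mulrA; congr (_ * _ * _).
have pE (y : 'cV[K]_d.+1) : (forall i, 0 < y i 0) ->
    \prod_i y i 0 `^ phi i 0 = expR (\sum_i phi i 0 * ln (y i 0)).
  by move=> y0; rewrite expR_sum; apply: eq_bigr => i _; rewrite /powR gt_eqF.
rewrite !pE// -expRN -expRD -expRM_natl -(expR_ln_exp (or_intror Q0)) -expRD.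
have SE : \sum_i phi i 0 * (ln (phi i 0) - ln (r i 0))
    = \sum_i phi i 0 * ln (phi i 0) - \sum_i phi i 0 * ln (r i 0).
  by rewrite -sumrB; apply: eq_bigr => i _; rewrite mulrBr.
congr expR; rewrite /Phi SE.
by move: (\sum_i _) (\sum_i _) (ln _) nn => x y z nn; field.
Qed.

(** Compactness of the interval: near each of its points [graph_local] provides
    a threshold, and finitely many of them suffice. *)
Lemma graph_uniform (K : realType) (d : nat) (R : 'M[K]_d.+1) (r : 'cV[K]_d.+1)
    (a b zeta : K) :
  R^T = R -> (forall i j, 0 <= R i j) -> posmx R -> (forall i, 0 < r i 0) ->
  (forall c x, a <= c <= b -> open_simplex x -> \det (hess0 R c x) != 0) -> 0 < zeta ->
  exists N : nat, forall (n m : nat) (phi : 'cV[K]_d.+1), (N <= n)%N -> (0 < n)%N ->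
    a <= m%:R / n%:R <= b -> open_simplex phi -> critical R r (m%:R / n%:R) phi ->
    let W := graph_main R r n m (m%:R / n%:R) phi in
    expR (- zeta) * W <= SG R r n m <= expR zeta * W.
Proof.
move=> Rs R0 Rp r0 hd z0.
have [G G0 HG] := graph_local K d; have G1 := graph_const G0 HG.
pose a' := Num.max a 0.
have cvx c : a' <= c <= b -> convex_at R c /\ exists2 phi, open_simplex phi & critical R r c phi.
  rewrite /a' ge_max => /andP[/andP[ac c0] cb]; apply: convex_from_det => // x xo.
  by apply: hd => //; rewrite ac cb.
pose P (N : nat) (c : K) := forall (n m : nat) (phi : 'cV[K]_d.+1), (N <= n)%N -> (0 < n)%N ->
    m%:R / n%:R = c -> convex_at R c -> open_simplex phi -> critical R r c phi ->
    expR (- zeta) * graph_main R r n m c phi <= SG R r n m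
      <= expR zeta * graph_main R r n m c phi.
have cov := (compact_near_coveringP _).1 (@segment_compact K a' b).
have [N _ HN] : \forall N \near \oo, `[a', b]%classic `<=` P N.
  apply: cov => c0 /=; rewrite in_itv/= => c0i.
  have [cv [x0 x0o x0c]] := cvx c0 c0i.
  have c00 : 0 <= c0 by move: c0i; rewrite /a' ge_max => /andP[/andP[_ ->]].
  have [rho rho0 [N HN]] := HG R r c0 x0 zeta Rs R0 Rp r0 c00 x0o (cv _ x0o) x0c z0.
  exists (ball c0 rho, [set i | (N <= i)%N]) => /=.
    by split; [exact: nbhsx_ballx|exists N].
  move=> [c i] /= [cb Ni] n m phi ni n0 mc cv' po pc.
  have := HN n m phi (leq_trans Ni ni) n0; rewrite G1 mul1r mc; apply=> //.
  by move: cb; rewrite /ball/= distrC => /ltW.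
exists N => n m phi Nn n0 /andP[ac cb] po pc.
have ci : a' <= m%:R / n%:R <= b by rewrite /a' ge_max ac cb divr_ge0.
have cS : `[a', b]%classic (m%:R / n%:R) by rewrite /= in_itv.
exact: (HN N (leqnn N) _ cS n m phi Nn n0 erefl (proj1 (cvx _ ci)) po pc).
Qed.

Lemma SG_asymptotics_main (K : realType) (d : nat) (E : 'M[K]_(d.+1, d)) (R : 'M[K]_d.+1)
    (r : 'cV[K]_d.+1) (n m : nat) (phi : 'cV[K]_d.+1) :
  R^T = R -> posmx R -> (forall i, 0 < r i 0) -> @tangent_frame K d.+1 E -> (0 < n)%N ->
  convex_at R (m%:R / n%:R) -> open_simplex phi -> critical R r (m%:R / n%:R) phi ->
  @SG_asymptotics K d.+1 E R r n m = graph_main R r n m (m%:R / n%:R) phi.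
Proof.
move=> Rs Rp r0 Ef n0 cv po pc; rewrite /SG_asymptotics.
rewrite (local_minima_convex Rs Rp Ef cv po pc) fsbig_set1 -/(edge_scale K n m).
by rewrite SG_term_main//; [exact: (proj1 po)|apply: Rp; exact: (proj1 po)].
Qed.

Lemma elsym_edge0 (K : realType) (q n m : nat) (t : {ffun 'I_n -> 'I_q}) :
  elsym (edge_wt (0 : 'M[K]_q) t) m = (m == 0%N)%:R.
Proof.
case: m => [|m]; first by rewrite elsym0.
have w0 e : edge_wt (0 : 'M[K]_q) t e = 0 by rewrite /edge_wt mxE; case: ifP.
apply/eqP; rewrite eq_le elsym_ge0 ?andbT => [|e]; last by rewrite w0.
apply: (le_trans (elsym_le _ _)) => [e|]; first by rewrite w0.
by rewrite /psum big1 ?expr0n ?mul0r// => e _; rewrite w0 expr1.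
Qed.

(** With a single type and [R = 0] there are no edges, and the formula is exact. *)
Lemma SG_zero (K : realType) (E : 'M[K]_(1, 0)) (r : 'cV[K]_1) (n m : nat) :
  (0 < n)%N -> (forall i, 0 < r i 0) ->
  SG (0 : 'M[K]_1) r n m = @SG_asymptotics K 1 E 0 r n m.
Proof.
move=> n0 r0; rewrite SG_elsym /SG_asymptotics.
under eq_bigr do rewrite elsym_edge0.
pose phi : 'cV[K]_1 := const_mx 1.
have simp1 (x : 'cV[K]_1) : \sum_i x i 0 = 1 -> x = phi.
  by rewrite big_ord1 => h; apply/colP => i; rewrite !mxE ord1.
have -> : @local_minima K 1 E 0 r (m%:R / n%:R) = [set phi].
  apply/seteqP; split=> [x [[_ x1] _ _]|x -> /=]; first exact: simp1.
  split.
  - by split=> [i|]; rewrite ?big_ord1 mxE.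
  - by apply/matrixP => i [].
  - apply: (@filterS _ _ _ (@simplex K 1)); last exact: withinT.
    by move=> y [_ /simp1 ->].
rewrite fsbig_set1 /SG_term.
have -> : qform (0 : 'M[K]_1) phi = 0 by rewrite /qform mulmx0 mul0mx mxE.
rewrite mulmx0 mulmx0 !mxtrace0 !mulr0 subr0 expR0 det_mx00 !big_ord1 mxE.
rewrite mulr1 sqrtr1 divr1 !powRr1 ?ler01 ?(ltW (r0 _))// divr1 mulr1.
have -> : \sum_(t : {ffun 'I_n -> 'I_1}) \prod_u r (t u) 0 * (m == 0%N)%:R
    = r ord0 0 ^+ n * (m == 0%N)%:R.
  rewrite -big_distrl/=; congr (_ * _).
  rewrite (eq_bigr (fun=> r ord0 0 ^+ n)) => [|t _].
    by rewrite sumr_const card_ffun !card_ord exp1n.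
  by under eq_bigr do rewrite ord1; rewrite prodr_const card_ord.
case: m => [|m]; last by rewrite expr0n/= !mulr0.
by rewrite muln0 !expr0 fact0 !mulr1 divr1 mul1r.
Qed.

Lemma sandwich_dist (K : realType) (eps x W : K) : 0 < eps -> 0 <= W ->
  expR (- ln (1 + eps)) * W <= x <= expR (ln (1 + eps)) * W -> `|x - W| <= eps * `|W|.
Proof.
move=> e0 W0; have e1 : 0 < 1 + eps by rewrite addr_gt0.
rewrite expRN lnK ?posrE// (ger0_norm W0) ler_pdivrMl// => /andP[h1 h2].
have h3 := ler_wpM2l (ltW e0) W0.
rewrite ler_norml; apply/andP; split; last by lra.
suff : 0 <= (1 + eps) * (x - W + eps * W) by rewrite pmulr_rge0//; lra.
have : 0 <= eps * eps * W by rewrite !mulr_ge0 ?(ltW e0).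
rewrite mulr0 in h3.
have -> : (1 + eps) * (x - W + eps * W) = (1 + eps) * x - W + eps * eps * W by ring.
lra.
Qed.

Lemma graph_main_ge0 (K : realType) (d : nat) (R : 'M[K]_d.+1) (r : 'cV[K]_d.+1)
    (n m : nat) (c : K) (phi : 'cV[K]_d.+1) : (0 < n)%N -> 0 <= graph_main R r n m c phi.
Proof.
move=> n0; rewrite /graph_main mulr_ge0//.
  by rewrite mulr_ge0 ?expR_ge0// ltW// edge_scale_gt0.
by rewrite divr_ge0 ?sqrtr_ge0// expR_ge0.
Qed.

Unset Implicit Arguments.

Theorem theorem14 (K : realType) (q : nat) (R : 'M[K]_q) (r : 'cV[K]_q)
    (E : 'M[K]_(q, q.-1)) (a b : K)
    (q_gt0 : (0 < q)%N)
    (R_sym : R^T = R)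
    (R_ge0 : forall i j, 0 <= R i j)
    (R_irr : irreducible_mx R)
    (r_gt0 : forall i, 0 < r i 0)
    (E_frame : tangent_frame E)
    (leab : a <= b)
    (hess_neq0 : forall (c : K) (x : 'cV[K]_q), a <= c <= b -> open_simplex x ->
       \det (hess_Phi E R c x) != 0) :
  (fun p : nat * nat => SG R r p.1 p.2)
  ~_(ratio_oo a b) (fun p : nat * nat => SG_asymptotics E R r p.1 p.2).
Proof.
apply/eqaddoP => eps e0.
suff [N HN] : exists N : nat, forall n m : nat, (N <= n)%N -> (0 < n)%N ->
    a <= m%:R / n%:R <= b ->
    `|SG R r n m - SG_asymptotics E R r n m| <= eps * `|SG_asymptotics E R r n m|.
  exists ([set n | (maxn N 1 <= n)%N], setT) => /=.
    by split; [exists (maxn N 1)|].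
  move=> [n m] /= [Nn _] hab; move: Nn; rewrite geq_max => /andP[Nn n1].
  exact: HN.
case: q R r E q_gt0 R_sym R_ge0 R_irr r_gt0 E_frame hess_neq0 => [//|d] R r E _ Rs R0 Ri r0 Ef hd.
have [Rz|Rn] := eqVneq R 0.
  have d1 := irreducible_size1 (ltn0Sn d) (eq_ind R (@irreducible_mx K d.+1) Ri 0 Rz).
  case: d d1 R r E Rs R0 Ri r0 Ef hd Rz => [_|//] R r E _ _ _ r0 _ _ ->.
  exists 0%N => n m _ n0 _; rewrite (SG_zero E)// subrr normr0 mulr_ge0//; exact: ltW.
have Rp := posmx_neq0 R0 Rn.
have hd0 c x : a <= c <= b -> open_simplex x -> \det (hess0 R c x) != 0.
  by move=> ci xo; rewrite -(det_hess_frame R c x Ef); exact: hd.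
have z0 : 0 < ln (1 + eps) by rewrite ln_gt0// ltrDl.
have [N HN] := graph_uniform Rs R0 Rp r0 hd0 z0.
exists N => n m Nn n0 hab.
have c0 : 0 <= m%:R / n%:R :> K by rewrite divr_ge0.
have [cv [phi po pc]] := convex_from_det r Rs R0 Rp c0 (fun x => hd0 _ x hab).
rewrite (SG_asymptotics_main Rs Rp r0 Ef n0 cv po pc).
apply: sandwich_dist => //; first exact: graph_main_ge0.
exact: HN.
Qed.
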